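(* Let $T=(T_1,\ldots,T_n)\in B(H)^n$ be a finitely generated $\gamma$-graded commuting row contraction. Then there are Hilbert spaces $\mathcal D^0,\ldots,\mathcal D^n$ such that $T$ admits a finite weak resolution of the form $$0\rightarrow H^2_n(\mathcal D^n)\stackrel{\Pi^n}{\longrightarrow}\ldots\stackrel{\Pi^2}{\longrightarrow}H^2_n(\mathcal D^1)\stackrel{\Pi^1}{\longrightarrow}H^2_n(\mathcal D^0)\stackrel{\Pi^0}{\longrightarrow}H\rightarrow0 ,$$ where each $H^2_n(\mathcal D^i)$ carries the tuple $M_z^{\mathcal D^i}$. Any two weak resolutions of $T$ of the form $(H^2_n(\mathcal D^\bullet),\Pi^\bullet,M_z^{\mathcal D^\bullet})$ and $(H^2_n(\mathcal E^\bullet),\Gamma^\bullet,M_z^{\mathcal E^\bullet})$ are isomorphic.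
   Context: $\mathbb N=\{0,1,2,\ldots\}$, $\mathbb C[z]=\mathbb C[z_1,\ldots,z_n]$. $H$ is a complex Hilbert space with a fixed orthogonal decomposition into closed subspaces $H_k$ ($k\in\mathbb N$), i.e. $H$ is the Hilbert space orthogonal direct sum of the $H_k$; $\gamma=(\gamma_1,\ldots,\gamma_n)$ is a tuple of integers $\gamma_i>0$. A commuting tuple $T\in B(H)^n$ is finitely generated and $\gamma$-graded if $T_iH_k\subset H_{k+\gamma_i}$ for all $k\in\mathbb N$, $i=1,\ldots,n$, and the algebraic direct sum $\tilde H=\bigoplus_{k\ge0}H_k$ is a finitely generated $\mathbb C[z]$-module with respect to $(p,x)\mapsto p(T)x$. $T$ is a row contraction if $\sum_{i=1}^nT_iT_i^*\le 1_H$. For a commuting tuple $S\in B(K)^n$ and a closed $S$-invariant subspace $M\subset K$, $W_S(M)=M\ominus\sum_{i=1}^nS_iM$ is the orthogonal complement of $\sum_iS_iM$ in $M$. For a Hilbert space $\mathcal E$, $H^2_n(\mathcal E)$ is the $\mathcal E$-valued Drury–Arveson space, i.e. the Hilbert space of analytic functions $\mathbb B\to\mathcal E$ on the open unit ball $\mathbb B\subset\mathbb C^n$ with reproducing kernel $K_{\mathcal E}(z,w)=\frac{1_{\mathcal E}}{1-\langle z,w\rangle}$, and $M_z^{\mathcal E}=(M_{z_1},\ldots,M_{z_n})\in B(H^2_n(\mathcal E))^n$ is the tuple of multiplication operators with the coordinate functions. Weak resolution: let $(H^i,T^i)_{i\ge0}$ be Hilbert spaces with commuting tuples $T^i\in B(H^i)^n$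 and let $\ldots\stackrel{\Pi^2}{\to}H^1\stackrel{\Pi^1}{\to}H^0\stackrel{\Pi^0}{\to}H\to0$ be a complex of bounded linear operators intertwining the tuples $T^i$ and $T$ componentwise (i.e. $\Pi^0T^0_j=T_j\Pi^0$ and $\Pi^iT^i_j=T^{i-1}_j\Pi^i$ for $i\ge1$). Finite families are allowed and are regarded as extended by zero spaces (so a finite resolution $0\to H^m\stackrel{\Pi^m}{\to}H^{m-1}\to\ldots$ has $H^i=0$ for $i>m$). $(H^\bullet,\Pi^\bullet,T^\bullet)$ is a weak resolution of $T$ if $\overline{\Pi^0H^0}=H$ and $\overline{\Pi^iH^i}=\operatorname{Ker}\Pi^{i-1}$ for all $i\ge1$, and if $\Pi^0$ and $\Pi^i$ ($i\ge1$) restrict to unitary operators $W_{T^0}(H^0)\to W_T(H)$ and $W_{T^i}(H^i)\to W_{T^{i-1}}(\operatorname{Ker}\Pi^{i-1})$ $(i\ge1)$. Two weak resolutions $(H^\bullet,\Pi^\bullet,T^\bullet)$ and $(K^\bullet,\Gamma^\bullet,S^\bullet)$ of $T$ are isomorphic if there are unitary operators $U^i:H^i\to K^i$ that intertwine $T^i$ and $S^i$ componentwise and satisfy $\Pi^0=\Gamma^0U^0$ and $U^{i-1}\Pi^i=\Gamma^iU^i$ for $i\ge1$. *)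

(* Defs.v *)
From HB Require Import structures.
From mathcomp Require Import all_boot all_order all_algebra.
From mathcomp Require Import complex.
From mathcomp Require Import classical_sets reals topology normedtype.
From mathcomp Require Import sequences derive.
(* mpoly is not imported: its notations clash with those of topology. *)
From mathcomp Require mpoly.
Import Order.TTheory GRing.Theory Num.Theory.
Import numFieldNormedType.Exports.

Set Implicit Arguments.
Unset Strict Implicit.
Unset Printing Implicit Defensive.

Local Open Scope classical_set_scope.
Local Open Scope complex_scope.
Local Open Scope ring_scope.

(* The inner product is linear in the first and conjugate-linear in the second
   variable, and [inner_norm] makes it induce the (complete) norm of H. *)
HB.mixin Record isHilbert (R : realType) H & CompleteNormedModule R[i] H := {
  inner : {dot H for (@Num.conj R[i])};
  inner_norm : forall x : H, inner x x = `|x| ^+ 2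
}.

#[short(type="hilbertType")]
HB.structure Definition Hilbert (R : realType) :=
  {H of CompleteNormedModule R[i] H & isHilbert R H}.

Record boundedOp (R : realType) (H K : hilbertType R) := BoundedOp {
  op_linear :> {linear H -> K};
  op_bounded : exists c : R, forall x : H, `|op_linear x| <= c%:C * `|x|
}.

Notation "''B' ( H , K )" := (boundedOp H K)
  (at level 8, format "''B' ( H ,  K )") : type_scope.

Definition commuting_tuple (R : realType) (n : nat) (H : hilbertType R)
    (T : 'I_n -> 'B(H, H)) : Prop :=
  forall (i j : 'I_n) (x : H), T i (T j x) = T j (T i x).

Definition intertwines (R : realType) (n : nat) (H K : hilbertType R)
    (A : 'B(H, K)) (S : 'I_n -> 'B(H, H)) (T : 'I_n -> 'B(K, K)) : Prop :=
  forall (j : 'I_n) (x : H), A (S j x) = T j (A x).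

Definition is_adjoint (R : realType) (H K : hilbertType R)
    (A : 'B(H, K)) (B : 'B(K, H)) : Prop :=
  forall (x : H) (y : K), inner (A x) y = inner x (B y).

(* The order on self-adjoint operators is that of their quadratic forms. *)
Definition row_contraction (R : realType) (n : nat) (H : hilbertType R)
    (T : 'I_n -> 'B(H, H)) : Prop :=
  exists T' : 'I_n -> 'B(H, H),
    (forall i, is_adjoint (T i) (T' i)) /\
    forall x : H, inner (\sum_(i < n) T i (T' i x)) x <= inner x x.

Definition closed_subspace (R : realType) (H : hilbertType R) (V : set H) :
    Prop :=
  [/\ V 0, forall (a : R[i]) (x y : H), V x -> V y -> V (a *: x + y)
    & closed V].

Definition orthogonal_decomposition (R : realType) (H : hilbertType R)
    (Hk : nat -> set H) : Prop :=
  [/\ forall k, closed_subspace (Hk k),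
      forall (k l : nat) (x y : H), k <> l -> Hk k x -> Hk l y -> inner x y = 0
    & forall x : H, exists u : nat -> H,
        (forall k, Hk k (u k)) /\ series u @ \oo --> x].

Definition algebraic_sum (R : realType) (H : hilbertType R)
    (Hk : nat -> set H) : set H :=
  [set x | exists (m : nat) (u : nat -> H),
     (forall k, Hk k (u k)) /\ x = \sum_(k < m) u k].

(* T^m x for a multi-index m; the composite is taken in the order of 'I_n. *)
Definition monomial_act (R : realType) (n : nat) (H : hilbertType R)
    (T : 'I_n -> 'B(H, H)) (m : mpoly.multinom n) (x : H) : H :=
  foldr (fun (i : 'I_n) (y : H) => iter (mpoly.fun_of_multinom m i) (T i) y)
    x (enum 'I_n).

(* The module action (p, x) |-> p(T) x. *)
Definition poly_act (R : realType) (n : nat) (H : hilbertType R)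
    (T : 'I_n -> 'B(H, H)) (p : mpoly.mpoly n R[i]) (x : H) : H :=
  \sum_(m <- mpoly.msupp p) mpoly.mcoeff m p *: monomial_act T m x.

Definition finitely_generated_module (R : realType) (n : nat)
    (H : hilbertType R) (T : 'I_n -> 'B(H, H)) (V : set H) : Prop :=
  exists (m : nat) (g : 'I_m -> H),
    (forall j, V (g j)) /\
    forall x, V x -> exists p : 'I_m -> mpoly.mpoly n R[i],
      x = \sum_(j < m) poly_act T (p j) (g j).

Definition fg_graded (R : realType) (n : nat) (H : hilbertType R)
    (Hk : nat -> set H) (gam : 'I_n -> nat) (T : 'I_n -> 'B(H, H)) : Prop :=
  (forall (k : nat) (i : 'I_n) (x : H), Hk k x -> Hk (k + gam i)%N (T i x)) /\
  finitely_generated_module T (algebraic_sum Hk).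

Definition tuple_image (R : realType) (n : nat) (K : hilbertType R)
    (S : 'I_n -> 'B(K, K)) (M : set K) : set K :=
  [set y | exists u : 'I_n -> K,
     (forall i, M (u i)) /\ y = \sum_(i < n) S i (u i)].

Definition wandering (R : realType) (n : nat) (K : hilbertType R)
    (S : 'I_n -> 'B(K, K)) (M : set K) : set K :=
  [set x | M x /\ forall y, tuple_image S M y -> inner x y = 0].

Definition restricts_to_unitary (R : realType) (H K : hilbertType R)
    (A : 'B(H, K)) (V : set H) (W : set K) : Prop :=
  A @` V = W /\ forall x y, V x -> V y -> inner (A x) (A y) = inner x y.

Definition ker_op (R : realType) (H K : hilbertType R) (A : 'B(H, K)) : set H :=
  [set x | A x = 0].

(* Complexes  ... -> Hs 1 -> Hs 0 -> H -> 0  are given by the augmentation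
   P0 : Hs 0 -> H and the maps P i : Hs i.+1 -> Hs i; thus P i is the map
   usually written Pi^(i+1), and [map_ker P0 P i] the kernel of the map
   leaving Hs i. *)
Definition map_ker (R : realType) (H : hilbertType R)
    (Hs : nat -> hilbertType R) (P0 : 'B(Hs 0%N, H))
    (P : forall i, 'B(Hs i.+1, Hs i)) (i : nat) : set (Hs i) :=
  match i return set (Hs i) with
  | 0%N => ker_op P0
  | j.+1 => ker_op (P j)
  end.
Arguments map_ker {R H Hs} P0 P i _.

Record weak_resolution (R : realType) (n : nat) (H : hilbertType R)
    (T : 'I_n -> 'B(H, H)) (Hs : nat -> hilbertType R)
    (Ts : forall i, 'I_n -> 'B(Hs i, Hs i))
    (P0 : 'B(Hs 0%N, H)) (P : forall i, 'B(Hs i.+1, Hs i)) : Prop := {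
  wr_commuting : forall i, commuting_tuple (Ts i);
  wr_intertwines0 : intertwines P0 (Ts 0%N) T;
  wr_intertwines : forall i, intertwines (P i) (Ts i.+1) (Ts i);
  wr_complex : forall i (x : Hs i.+1), map_ker P0 P i (P i x);
  wr_dense0 : closure (range P0) = setT;
  wr_exact : forall i, closure (range (P i)) = map_ker P0 P i;
  wr_unitary0 :
    restricts_to_unitary P0 (wandering (Ts 0%N) setT) (wandering T setT);
  wr_unitary : forall i,
    restricts_to_unitary (P i) (wandering (Ts i.+1) setT)
      (wandering (Ts i) (map_ker P0 P i))
}.

Definition isomorphic_resolutions (R : realType) (n : nat) (H : hilbertType R)
    (Hs : nat -> hilbertType R) (Ts : forall i, 'I_n -> 'B(Hs i, Hs i))
    (P0 : 'B(Hs 0%N, H)) (P : forall i, 'B(Hs i.+1, Hs i))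
    (Ks : nat -> hilbertType R) (Ss : forall i, 'I_n -> 'B(Ks i, Ks i))
    (G0 : 'B(Ks 0%N, H)) (G : forall i, 'B(Ks i.+1, Ks i)) : Prop :=
  exists U : forall i, 'B(Hs i, Ks i),
    [/\ forall i, restricts_to_unitary (U i) setT setT,
        forall i, intertwines (U i) (Ts i) (Ss i),
        forall x, P0 x = G0 (U 0%N x)
      & forall i x, U i (P i x) = G i (U i.+1 x)].

Definition cdot (R : realType) (n : nat) (z w : 'rV[R[i]]_n) : R[i] :=
  \sum_(i < n) z 0 i * Num.conj (w 0 i).

Definition unit_ball (R : realType) (n : nat) : set 'rV[R[i]]_n :=
  [set z | cdot z z < 1].

(* For K = R[i], Frechet differentiability over K on an open set A is
   analyticity on A. *)
Definition holomorphic_on (K : numFieldType) (V W : normedModType K)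
    (A : set V) (f : V -> W) : Prop :=
  forall z, A z -> differentiable f z.

(* A Hilbert space of E-valued analytic functions on the unit ball with
   reproducing kernel 1_E / (1 - <z, w>), which determines the space.  An
   element f of the carrier stands for the function z |-> da_eval f z, whose
   values outside the ball are irrelevant. *)
Record druryArveson (R : realType) (n : nat) (E : hilbertType R) :=
  DruryArveson {
  da_space :> hilbertType R;
  da_eval : da_space -> 'rV[R[i]]_n -> E;
  da_eval_linear : forall (a : R[i]) (f g : da_space) (z : 'rV[R[i]]_n),
    unit_ball z -> da_eval (a *: f + g) z = a *: da_eval f z + da_eval g z;
  da_eval_inj : forall f g : da_space,
    (forall z, unit_ball z -> da_eval f z = da_eval g z) -> f = g;
  da_analytic : forall f : da_space, holomorphic_on (@unit_ball R n) (da_eval f);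
  da_kernel : forall (w : 'rV[R[i]]_n) (e : E), unit_ball w ->
    exists k : da_space,
      (forall z, unit_ball z -> da_eval k z = (1 - cdot z w)^-1 *: e) /\
      (forall f : da_space, inner f k = inner (da_eval f w) e);
  da_Mz : 'I_n -> 'B(da_space, da_space);
  da_MzE : forall (i : 'I_n) (f : da_space) (z : 'rV[R[i]]_n),
    unit_ball z -> da_eval (da_Mz i f) z = z 0 i *: da_eval f z
}.

(* Main.v *)
(* The space H^2_n(E) is realised as the symmetric Fock space: square-summable
   symmetric families (a_w) of vectors of E indexed by words, with f(z) the sum
   of the z^w a_w; M_z is the adjoint of the tuple of backward shifts
   (B_i a)_w = a_{iw}.

   Existence.  For a graded row contraction T on H with finite-dimensional
   homogeneous components, put W = W_T(H).  The map h |-> (P_W T_w^* h)_w is a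
   contraction H -> H^2_n(W) intertwining T_i^* with B_i, and its adjoint P
   intertwines M_z with T, restricts to the identity of W, and maps the
   homogeneous components onto those of H.  The restriction of M_z to Ker P is
   again such a tuple, so that the construction can be iterated.  If
   z_1, .., z_l is a regular sequence on H, then z_1, .., z_(l+1) is one on
   Ker P (as on a submodule of a free module); once z_1, .., z_n is regular, the
   next map is injective.  Hence all spaces of index above n vanish.

   Uniqueness.  A unitary between the wandering subspaces of two
   Drury-Arveson spaces extends, by comparing the Gram matrices of the
   reproducing kernels, to a unitary intertwining the shifts; since constants
   generate the space, it is compatible with the maps of the resolutions. *)
From HB Require Import structures.
From mathcomp Require Import all_boot all_order all_algebra.
From mathcomp Require Import complex.
From mathcomp Require Import boolp classical_sets functions reals interval_inference.
From mathcomp Require Import topology normedtype.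
From mathcomp Require Import sequences landau derive.
From mathcomp Require mpoly.
From mathcomp Require Import ring lra.
Require Import Defs.
Import Order.TTheory GRing.Theory Num.Theory.
Import numFieldNormedType.Exports.

Set Implicit Arguments.
Unset Strict Implicit.
Unset Printing Implicit Defensive.

Local Open Scope classical_set_scope.
Local Open Scope ring_scope.

(** * Hilbert spaces and bounded operators *)

(** The norms take values in R[i], which is only partially ordered, so estimates go through the
    real-valued [cabs] and [hnorm].

    The Fock model avoids multinomial weights: splitting off the first letter of a word gives <x, y>
    = <x_0, y_0> + sum_i <B_i x, B_i y>, where x_0 is the coefficient of the empty word, and most
    estimates are inductions along this identity. Evaluation at z uses the resolvent of sum_i z_i
    B_i instead of a power series, so that analyticity and injectivity come from the resolvent
    identity.

    The obstacle in the existence part is that P need not have closed range: exactness holds only up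
    to closure, whereas regular sequences are an algebraic notion. The algebra therefore takes place
    in the homogeneous components. They are finite-dimensional, so orthogonal complements exist
    inside them and P is onto in each degree; inductions on the degree terminate because each
    gamma_i is positive. The row contraction property makes h |-> (P_W T_w^* h)_w bounded, and Ker P
    inherits it because the adjoint of a restriction is a compression of the adjoint. *)

Definition cabs (R : realType) (z : R[i]) : R := complex.Re `|z|.
Definition hnorm (R : realType) (H : hilbertType R) (x : H) : R :=
  complex.Re `|x|.

Section Hilbert_norm.
Variables (R : realType) (H : hilbertType R).
Implicit Types (x y z : H) (a : R[i]).

Lemma Re_norm (V : normedZmodType R[i]) (v : V) :
  (complex.Re `|v|)%:C%C = `|v|.
Proof. by apply: RRe_real; exact: normr_real. Qed.

Lemma cabsE a : (cabs a)%:C%C = `|a|. Proof. exact: Re_norm. Qed.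
Lemma hnormE x : (hnorm x)%:C%C = `|x|. Proof. exact: Re_norm. Qed.

Lemma cabs_ge0 a : 0 <= cabs a.
Proof. by rewrite -lecR cabsE normr_ge0. Qed.
Lemma hnorm_ge0 x : 0 <= hnorm x.
Proof. by rewrite -lecR hnormE normr_ge0. Qed.

Lemma cabs0 : cabs (0 : R[i]) = 0. Proof. by rewrite /cabs normr0. Qed.
Lemma cabs_eq0 a : cabs a = 0 -> a = 0.
Proof. by move=> h; apply/eqP; rewrite -normr_eq0 -cabsE h. Qed.
Lemma hnorm0 : hnorm (0 : H) = 0. Proof. by rewrite /hnorm normr0. Qed.
Lemma hnorm_eq0 x : hnorm x = 0 -> x = 0.
Proof. by move=> h; apply/eqP; rewrite -normr_eq0 -hnormE h. Qed.

Lemma hnorm_opp x : hnorm (- x) = hnorm x. Proof. by rewrite /hnorm normrN. Qed.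
Lemma hnorm_subC x y : hnorm (x - y) = hnorm (y - x).
Proof. by rewrite -hnorm_opp opprB. Qed.
Lemma ler_hnormD x y : hnorm (x + y) <= hnorm x + hnorm y.
Proof. by rewrite -lecR rmorphD /= !hnormE ler_normD. Qed.
Lemma ler_hnormB x y : hnorm (x - y) <= hnorm x + hnorm y.
Proof. by rewrite -[hnorm y]hnorm_opp ler_hnormD. Qed.
Lemma hnorm_triangle z x y : hnorm (x - y) <= hnorm (x - z) + hnorm (z - y).
Proof. by apply: le_trans (ler_hnormD _ _); rewrite addrA subrK. Qed.
Lemma hnormZ a x : hnorm (a *: x) = cabs a * hnorm x.
Proof.
by apply: (@complexI R); rewrite rmorphM /= !hnormE cabsE normrZ.
Qed.

Lemma cabsM a b : cabs (a * b) = cabs a * cabs b.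
Proof. by apply: (@complexI R); rewrite rmorphM /= !cabsE normrM. Qed.
Lemma cabsD a b : cabs (a + b) <= cabs a + cabs b.
Proof. by rewrite -lecR rmorphD /= !cabsE ler_normD. Qed.
Lemma cabsJ a : cabs a^* = cabs a.
Proof. by apply: (@complexI R); rewrite !cabsE norm_conjC. Qed.
Lemma cabsR (r : R) : 0 <= r -> cabs r%:C%C = r.
Proof. by move=> r0; apply: (@complexI R); rewrite cabsE ger0_norm // lecR. Qed.
Lemma cabsN a : cabs (- a) = cabs a. Proof. by rewrite /cabs normrN. Qed.
Lemma cabs_real (r : R) : cabs r%:C%C = `|r|.
Proof.
have [r0|/ltW r0] := leP 0 r; first by rewrite cabsR // ger0_norm.
by rewrite ler0_norm // -cabsN -rmorphN cabsR // oppr_ge0.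
Qed.
Lemma cabs_nat k : cabs (k%:R : R[i]) = k%:R.
Proof. by rewrite -(rmorph_nat (real_complex R)) cabsR. Qed.
Lemma cabs1 : cabs (1 : R[i]) = 1. Proof. exact: (cabs_nat 1). Qed.
Lemma cabsX2 a : (cabs a ^+ 2)%:C%C = a * a^*.
Proof. by rewrite rmorphXn /= cabsE normCK. Qed.

Lemma ipC x y : inner x y = (inner y x)^*.
Proof. by have := hermC (@inner R H) x y; rewrite expr0 mul1r. Qed.
Lemma ip0l y : inner (0 : H) y = 0. Proof. by rewrite linear0l. Qed.
Lemma ip0r x : inner x (0 : H) = 0. Proof. by rewrite linear0r. Qed.
Lemma ipDl x y z : inner (x + y) z = inner x z + inner y z.
Proof. exact: linearDl. Qed.
Lemma ipDr x y z : inner x (y + z) = inner x y + inner x z.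
Proof. exact: linearDr. Qed.
Lemma ipNr x y : inner x (- y) = - inner x y. Proof. exact: linearNr. Qed.
Lemma ipBl x y z : inner (x - y) z = inner x z - inner y z.
Proof. exact: linearBl. Qed.
Lemma ipBr x y z : inner x (y - z) = inner x y - inner x z.
Proof. exact: linearBr. Qed.
Lemma ipZl a x y : inner (a *: x) y = a * inner x y.
Proof. exact: linearZl_LR. Qed.
Lemma ipZr a x y : inner x (a *: y) = a^* * inner x y.
Proof. by rewrite ipC ipZl rmorphM /= -ipC. Qed.
Lemma ip_suml I (r : seq I) (P : pred I) (F : I -> H) y :
  inner (\sum_(i <- r | P i) F i) y = \sum_(i <- r | P i) inner (F i) y.
Proof.
by elim/big_rec2: _ => [|i a b _ <-]; rewrite ?ip0l ?ipDl.
Qed.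
Lemma ip_sumr I (r : seq I) (P : pred I) (F : I -> H) x :
  inner x (\sum_(i <- r | P i) F i) = \sum_(i <- r | P i) inner x (F i).
Proof.
by elim/big_rec2: _ => [|i a b _ <-]; rewrite ?ip0r ?ipDr.
Qed.

Lemma ip_hnorm x : inner x x = (hnorm x ^+ 2)%:C%C.
Proof. by rewrite inner_norm rmorphXn /= hnormE. Qed.
Lemma hnorm_ip x : hnorm x ^+ 2 = complex.Re (inner x x).
Proof. by rewrite ip_hnorm. Qed.
Lemma ip_eq0 x : inner x x = 0 -> x = 0.
Proof.
move=> h; apply: hnorm_eq0; apply/eqP; rewrite -sqrf_eq0.
by rewrite hnorm_ip h.
Qed.
Lemma ip_inj x y : (forall z, inner x z = inner y z) -> x = y.
Proof.
by move=> h; apply/eqP; rewrite -subr_eq0; apply/eqP/ip_eq0; rewrite ipBl h subrr.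
Qed.
Lemma orthC x y : inner x y = 0 -> inner y x = 0.
Proof. by move=> h; rewrite ipC h rmorph0. Qed.

Lemma ReD a b : complex.Re (a + b) = complex.Re a + complex.Re b.
Proof. by case: a; case: b. Qed.
Lemma ReN a : complex.Re (- a) = - complex.Re a.
Proof. by case: a. Qed.
Lemma ReJ a : complex.Re a^* = complex.Re a.
Proof. by case: a. Qed.
Lemma ReM_real (r : R) a : complex.Re (r%:C%C * a) = r * complex.Re a.
Proof. by case: a => b c /=; rewrite mul0r subr0. Qed.
Lemma Re_sum I (r : seq I) (P : pred I) (F : I -> R[i]) :
  complex.Re (\sum_(i <- r | P i) F i) = \sum_(i <- r | P i) complex.Re (F i).
Proof. by elim/big_rec2: _ => [|i b c _ <-]; rewrite ?ReD. Qed.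
Lemma Re_le_cabs a : complex.Re a <= cabs a.
Proof.
apply: le_trans (ler_norm _) _.
by rewrite -lecR cabsE normc_ge_Re.
Qed.

Lemma sqr_hnormD x y :
  hnorm (x + y) ^+ 2 = hnorm x ^+ 2 + hnorm y ^+ 2 + complex.Re (inner x y) *+ 2.
Proof.
rewrite !hnorm_ip ipDl !ipDr !ReD (ipC y x) ReJ; ring.
Qed.
Lemma sqr_hnormB x y :
  hnorm (x - y) ^+ 2 = hnorm x ^+ 2 + hnorm y ^+ 2 - complex.Re (inner x y) *+ 2.
Proof. by rewrite sqr_hnormD hnorm_opp ipNr ReN mulNrn. Qed.
Lemma parallelogram x y : hnorm (x + y) ^+ 2 + hnorm (x - y) ^+ 2
  = (hnorm x ^+ 2 + hnorm y ^+ 2) *+ 2.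
Proof. rewrite sqr_hnormD sqr_hnormB; ring. Qed.
Lemma pythagoras x y : inner x y = 0 ->
  hnorm (x + y) ^+ 2 = hnorm x ^+ 2 + hnorm y ^+ 2.
Proof. by move=> h; rewrite sqr_hnormD h /= mul0rn addr0. Qed.

Lemma hnorm_le x (c : R) : 0 <= c -> hnorm x ^+ 2 <= c ^+ 2 -> hnorm x <= c.
Proof. by move=> c0; rewrite ler_pXn2r // nnegrE hnorm_ge0. Qed.

Lemma cauchy_schwarz x y : cabs (inner x y) <= hnorm x * hnorm y.
Proof.
have [->|y0] := eqVneq y 0; first by rewrite ip0r cabs0 hnorm0 mulr0.
have ny : 0 < hnorm y.
  by rewrite lt_def hnorm_ge0 andbT; apply/eqP => /hnorm_eq0/eqP; apply/negP.
pose t := inner x y / (hnorm y ^+ 2)%:C%C.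
have yy : (hnorm y ^+ 2)%:C%C != 0 :> R[i].
  by rewrite (inj_eq (@complexI R)) expf_neq0 // gt_eqF.
have tE : inner x y = t * (hnorm y ^+ 2)%:C%C by rewrite divfK.
have xy : inner (x - t *: y) y = 0 by rewrite ipBl ipZl ip_hnorm tE subrr.
have h : hnorm x ^+ 2 = hnorm (x - t *: y) ^+ 2 + hnorm (t *: y) ^+ 2.
  by rewrite -pythagoras ?subrK // ipZr xy mulr0.
have : hnorm (t *: y) <= hnorm x.
  by apply: hnorm_le; rewrite ?hnorm_ge0 // h lerDr sqr_ge0.
rewrite tE cabsM cabsR ?sqr_ge0 // expr2 mulrA hnormZ => h1.
by rewrite ler_wpM2r // hnorm_ge0.
Qed.

End Hilbert_norm.

(** * Closure, convergence and completeness in terms of real epsilons *)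

Section Topology.
Variables (R : realType) (H : hilbertType R).
Implicit Types (x y z : H) (V : set H).

Lemma ballE x (e : R) y : ball x e%:C%C y <-> hnorm (x - y) < e.
Proof. by rewrite -ball_normE /= -hnormE ltcR. Qed.

Lemma realC_gt0 (e : R[i]) : 0 < e -> exists2 r : R, 0 < r & e = r%:C%C.
Proof.
move=> e0; exists (complex.Re e); last by rewrite RRe_real // gtr0_real.
by rewrite -ltcR RRe_real // gtr0_real.
Qed.

Lemma closureE_hnorm V x :
  closure V x <-> forall e : R, 0 < e -> exists2 y, V y & hnorm (x - y) < e.
Proof.
split=> [h e e0|h B /nbhs_ballP [e /= /realC_gt0 [r r0 ->]] rB].
  have [|y [Vy /ballE xy]] := h (ball x e%:C%C); last by exists y.
  by apply: nbhsx_ballx; rewrite ltcR.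
by have [y Vy xy] := h r r0; exists y; split=> //; apply/rB/ballE.
Qed.

Lemma closedE_hnorm V : closed V <->
  forall x, (forall e : R, 0 < e -> exists2 y, V y & hnorm (x - y) < e) -> V x.
Proof.
split=> h x; first by move/closureE_hnorm/h.
by move/closureE_hnorm/h.
Qed.

Lemma cvgn_hnorm (u : nat -> H) x : u @ \oo --> x <->
  forall e : R, 0 < e -> exists N, forall k, (N <= k)%N -> hnorm (x - u k) < e.
Proof.
split=> [/cvgrPdist_lt h e e0|h].
  have := h e%:C%C; rewrite ltcR => /(_ e0) [N _ hN]; exists N => k Nk.
  by have := hN k Nk; rewrite /= -hnormE ltcR.
apply/cvgrPdist_lt => _ /realC_gt0 [r r0 ->]; have [N hN] := h r r0.
by exists N => // k Nk /=; rewrite -hnormE ltcR hN.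
Qed.

Lemma cauchy_hnorm (u : nat -> H) :
  (forall e : R, 0 < e -> exists N, forall p q, (N <= p)%N -> (N <= q)%N ->
     hnorm (u p - u q) < e) ->
  exists x, forall e : R, 0 < e ->
    exists N, forall k, (N <= k)%N -> hnorm (x - u k) < e.
Proof.
move=> h; suff /cauchy_cvg /cvg_ex[x /cvgn_hnorm ux] : cauchy (u @ \oo).
  by exists x.
apply/cauchy_ballP => _ /realC_gt0 [r r0 ->]; have [N hN] := h r r0.
exists (u @` [set k | (N <= k)%N], u @` [set k | (N <= k)%N]).
  by split; exists N => // k Nk; exists k.
by move=> [_ _] /= [[p Np <-] [q Nq <-]]; apply/ballE/hN.
Qed.

End Topology.

(** * Subspaces and orthogonal projection *)

Section Projection.
Variables (R : realType) (H : hilbertType R).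
Implicit Types (x y z : H) (V : set H).

Definition subspace V := V 0 /\ forall (a : R[i]) x y, V x -> V y -> V (a *: x + y).

Section Subspace.
Variable V : set H.
Hypothesis sV : subspace V.
Lemma subspace0 : V 0. Proof. exact: sV.1. Qed.
Lemma subspaceZ a x : V x -> V (a *: x).
Proof. by move=> Vx; rewrite -[_ *: _]addr0; apply: sV.2 => //; exact: sV.1. Qed.
Lemma subspaceD x y : V x -> V y -> V (x + y).
Proof. by move=> Vx Vy; rewrite -[x]scale1r; apply: sV.2. Qed.
Lemma subspaceN x : V x -> V (- x).
Proof. by rewrite -scaleN1r; exact: subspaceZ. Qed.
Lemma subspaceB x y : V x -> V y -> V (x - y).
Proof. by move=> Vx Vy; apply: subspaceD => //; apply: subspaceN. Qed.
Lemma subspace_sum I (r : seq I) (P : pred I) (F : I -> H) :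
  (forall i, P i -> V (F i)) -> V (\sum_(i <- r | P i) F i).
Proof.
by move=> h; elim/big_rec: _ => [|i x Pi Vx]; [exact: subspace0|
  apply: subspaceD => //; exact: h].
Qed.
End Subspace.

Lemma closed_subspace_subspace V : closed_subspace V -> subspace V.
Proof. by case. Qed.

Lemma closure_subspace V : subspace V -> closed_subspace (closure V).
Proof.
move=> sV; split.
- by apply: subset_closure; exact: subspace0.
- move=> a x y /closureE_hnorm hx /closureE_hnorm hy.
  apply/closureE_hnorm => e e0.
  have ca : 0 < cabs a + 1 by rewrite ltr_wpDl ?cabs_ge0.
  have [x' Vx' xx'] := hx (e / 2 / (cabs a + 1)) ltac:(by rewrite !divr_gt0).
  have [y' Vy' yy'] := hy (e / 2) ltac:(by rewrite !divr_gt0).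
  exists (a *: x' + y'); first exact: sV.2.
  rewrite opprD addrACA -scalerBr; apply: le_lt_trans (ler_hnormD _ _) _.
  rewrite hnormZ [ltRHS]splitr ler_ltD //.
  have h : hnorm (x - x') * (cabs a + 1) < e / 2 by rewrite -ltr_pdivlMr.
  apply: le_trans (ltW h); rewrite mulrDr mulr1 mulrC lerDl hnorm_ge0 //.
- exact: closed_closure.
Qed.

(** Two points of V within d + r of x, where d is the distance from x to V, have squared distance at
    most 4 (d + r)^2 - 4 d^2; hence minimising sequences are Cauchy. *)
Lemma small_quadratic (d e : R) : 0 <= d -> 0 < e ->
  exists2 r : R, 0 < r & (d + r) ^+ 2 *+ 4 - d ^+ 2 *+ 4 < e ^+ 2.
Proof.
(* For r <= 1 the difference 8 d r + 4 r^2 is at most (8 d + 4) r; the extra 1 in k makes the bound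
   strict. *)
move=> d0 e0; pose k := d *+ 8 + 4 + 1.
have k0 : 0 < k by rewrite /k; lra.
have e20 : 0 < e ^+ 2 by rewrite exprn_gt0.
exists (Num.min 1 (e ^+ 2 / k)).
  by rewrite lt_min ltr01 divr_gt0.
set r := Num.min _ _.
have r1 : r <= 1 by rewrite /r ge_min lexx.
have r0 : 0 < r by rewrite /r lt_min ltr01 divr_gt0.
have rk : r * k <= e ^+ 2.
  by rewrite -ler_pdivlMr // /r ge_min lexx orbT.
have rr : r ^+ 2 <= r by rewrite expr2 ler_piMr // ltW.
apply: lt_le_trans rk; rewrite /k; nra.
Qed.

Theorem projection_theorem V : closed_subspace V ->
  forall x, exists2 p, V p & forall v, V v -> inner (x - p) v = 0.
Proof.
move=> cV x; have sV := closed_subspace_subspace cV.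
have [_ _ /closedE_hnorm clV] := cV.
pose D := [set hnorm (x - v) | v in V]; pose d := inf D.
have hD : has_inf D.
  split; first by exists (hnorm (x - 0)), 0 => //; exact: subspace0.
  by exists 0 => _ [v _ <-]; exact: hnorm_ge0.
have dle v : V v -> d <= hnorm (x - v).
  by move=> Vv; apply: ge_inf; [case: hD|exists v].
have d0 : 0 <= d.
  by apply: lb_le_inf; [case: hD|move=> _ [v _ <-]; exact: hnorm_ge0].
have near (r : R) : 0 < r -> exists2 v, V v & hnorm (x - v) < d + r.
  by move=> r0; have [_ [v Vv <-] lt] := inf_adherent r0 hD; exists v.
(* Parallelogram law: the midpoint of v and w lies in V, so its distance to x is at least d. *)
have close v w (r : R) : 0 < r -> V v -> V w -> hnorm (x - v) < d + r ->
    hnorm (x - w) < d + r ->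
    hnorm (v - w) ^+ 2 <= (d + r) ^+ 2 *+ 4 - d ^+ 2 *+ 4.
  move=> r0 Vv Vw hv hw.
  have := parallelogram (x - v) (x - w).
  have -> : x - v - (x - w) = w - v.
    by rewrite opprB addrC addrA subrK.
  have -> : x - v + (x - w) = 2 *: (x - 2^-1 *: (v + w)).
    rewrite scalerBr scalerA divff ?pnatr_eq0 // scale1r scaler_nat mulr2n.
    by rewrite opprD addrACA.
  rewrite hnormZ (_ : cabs 2 = 2); last first.
    by rewrite -[2]/(2%:R) -(rmorph_nat (real_complex R)) cabsR.
  have := dle (2^-1 *: (v + w)) (subspaceZ sV _ (subspaceD sV Vv Vw)).
  set m := hnorm (x - 2^-1 *: _) => dm.
  have hm := hnorm_ge0 (x - v); have hm' := hnorm_ge0 (x - w).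
  rewrite (hnorm_subC w v) exprMn.
  have dr : 0 <= d + r by rewrite addr_ge0 // ltW.
  have : hnorm (x - v) ^+ 2 <= (d + r) ^+ 2.
    by rewrite ler_pXn2r // ltW.
  have : hnorm (x - w) ^+ 2 <= (d + r) ^+ 2.
    by rewrite ler_pXn2r // ltW.
  have : d ^+ 2 <= m ^+ 2 by rewrite ler_pXn2r // ?nnegrE // (le_trans d0).
  by rewrite !mulr2n; lra.
have /choice [u hu] : forall k : nat, exists v, V v /\ hnorm (x - v) < d + k.+1%:R^-1.
  by move=> k; have [|v] := near k.+1%:R^-1; rewrite ?invr_gt0 ?ltr0n //; exists v.
have ule (r : R) : 0 < r -> exists N, forall k, (N <= k)%N -> hnorm (x - u k) < d + r.
  move=> r0; have [N hN] : exists N, N.+1%:R^-1 < r.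
    exists (Num.truncn r^-1); rewrite invf_plt ?posrE ?ltr0n //.
    by rewrite truncnS_gt.
  exists N => k Nk; apply: lt_le_trans (hu k).2 _; rewrite lerD2l.
  apply: le_trans (ltW hN); rewrite lef_pV2 ?posrE ?ltr0n // ler_nat ltnS //.
have [|p hp] := @cauchy_hnorm R H u.
  move=> e e0; have [r r0 re] := small_quadratic d0 e0.
  have [N hN] := ule r r0; exists N => k l Nk Nl.
  rewrite -(@ltr_pXn2r _ 2) ?nnegrE ?hnorm_ge0 ?ltW //.
  apply: le_lt_trans re; apply: close => //; by [exact: (hu _).1|exact: hN].
have Vp : V p.
  apply: clV => e /hp [N hN]; exists (u N); first exact: (hu N).1.
  exact: hN.
have dp : hnorm (x - p) <= d.
  apply/ler_addgt0Pr => e e0.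
  have [N1 h1] := hp (e / 2) ltac:(by rewrite divr_gt0).
  have [N2 h2] := ule (e / 2) ltac:(by rewrite divr_gt0).
  have := h1 _ (leq_maxl N1 N2); have := h2 _ (leq_maxr N1 N2).
  have := hnorm_triangle (u (maxn N1 N2)) x p.
  by rewrite (hnorm_subC (u _) p); lra.
exists p => // v Vv.
have [->|v0] := eqVneq v 0; first by rewrite ip0r.
have vv : inner v v != 0 by apply: contra_neq v0 => /ip_eq0.
(* Replacing p by p + t v decreases the squared distance to x by |t v|^2, so minimality forces t v =
   0. *)
pose t := inner (x - p) v / inner v v.
have tE : inner (x - p) v = t * inner v v by rewrite divfK.
have o : inner (x - p - t *: v) (t *: v) = 0.
  by rewrite ipZr ipBl ipZl tE subrr mulr0.
have := pythagoras o; rewrite subrK => h.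
have le : hnorm (x - p) ^+ 2 <= hnorm (x - p - t *: v) ^+ 2.
  rewrite ler_pXn2r // ?nnegrE ?hnorm_ge0 //; apply: le_trans dp _.
  by rewrite -addrA -opprD; apply: dle; apply: subspaceD => //; exact: subspaceZ.
have /eqP : hnorm (t *: v) ^+ 2 = 0.
  by apply/eqP; rewrite eq_le sqr_ge0 andbT; move: le; rewrite h gerDl.
rewrite sqrf_eq0 => /eqP /hnorm_eq0 /eqP.
by rewrite scaler_eq0 (negPf v0) orbF tE => /eqP ->; rewrite mul0r.
Qed.

Lemma total_closed_subspace V : closed_subspace V ->
  (forall x, (forall v, V v -> inner x v = 0) -> x = 0) -> V = setT.
Proof.
move=> cV tot; apply/seteqP; split=> // x _.
have [p Vp /tot /eqP] := projection_theorem cV x.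
by rewrite subr_eq0 => /eqP ->.
Qed.

Lemma total_dense V : subspace V ->
  (forall x, (forall v, V v -> inner x v = 0) -> x = 0) -> closure V = setT.
Proof.
move=> sV tot; apply: total_closed_subspace; first exact: closure_subspace.
by move=> x h; apply: tot => v Vv; apply: h; exact: subset_closure.
Qed.

Lemma orth_closed_subspace (S : set H) :
  closed_subspace [set x | forall y, S y -> inner x y = 0].
Proof.
split=> /=.
- by move=> y _; rewrite ip0l.
- by move=> a x y hx hy z Sz; rewrite ipDl ipZl hx // hy // mulr0 addr0.
- apply/closedE_hnorm => x hx y Sy; apply: cabs_eq0; apply/eqP.
  rewrite eq_le cabs_ge0 andbT; apply/ler_addgt0Pr => e e0; rewrite add0r.
  have c0 : 0 < hnorm y + 1 by rewrite ltr_wpDl ?hnorm_ge0.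
  have [z hz xz] := hx (e / (hnorm y + 1)) ltac:(by rewrite divr_gt0).
  have -> : inner x y = inner (x - z) y by rewrite ipBl hz // subr0.
  apply: le_trans (cauchy_schwarz _ _) _.
  move: xz; rewrite ltr_pdivlMr // => /ltW; apply: le_trans.
  by rewrite ler_wpM2l ?hnorm_ge0 // lerDl.
Qed.

End Projection.

(** * Bounded operators, Riesz representation and adjoints *)

Section Operators.
Variable R : realType.
Implicit Types H K L : hilbertType R.

Lemma op_hnorm_bound H K (A : 'B(H, K)) :
  exists2 c : R, 0 <= c & forall x, hnorm (A x) <= c * hnorm x.
Proof.
have [c hc] := op_bounded A; exists (Num.max 0 c).
  by rewrite le_max lexx.
move=> x; apply: (@le_trans _ _ (c * hnorm x)).
  by rewrite -lecR rmorphM /= !hnormE hc.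
by rewrite ler_wpM2r ?hnorm_ge0 // le_max lexx orbT.
Qed.

Lemma mkop_proof H K (f : H -> K) :
  (exists c : R, forall x, hnorm (f x) <= c * hnorm x) ->
  exists c : R, forall x : H, `|f x| <= c%:C%C * `|x|.
Proof.
by move=> [c hc]; exists c => x; rewrite -!hnormE -rmorphM lecR.
Qed.

Definition mkop H K (f : H -> K) (lin : linear f)
    (bd : exists c : R, forall x, hnorm (f x) <= c * hnorm x) : 'B(H, K) :=
  @BoundedOp R H K
    (HB.pack_for {linear H -> K} f (GRing.isLinear.Build R[i] H K *:%R f lin))
    (mkop_proof bd).

Lemma mkopE H K (f : H -> K) lin bd x : @mkop H K f lin bd x = f x.
Proof. by []. Qed.

Lemma opP H K (A : 'B(H, K)) a x y : A (a *: x + y) = a *: A x + A y.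
Proof. exact: linearP. Qed.

Lemma op0 H K (A : 'B(H, K)) : A 0 = 0. Proof. exact: linear0. Qed.
Lemma opB H K (A : 'B(H, K)) x y : A (x - y) = A x - A y.
Proof. exact: linearB. Qed.
Lemma opD H K (A : 'B(H, K)) x y : A (x + y) = A x + A y.
Proof. exact: linearD. Qed.
Lemma opZ H K (A : 'B(H, K)) a x : A (a *: x) = a *: A x.
Proof. exact: linearZ. Qed.
Lemma op_sum H K (A : 'B(H, K)) I (r : seq I) (P : pred I) (F : I -> H) :
  A (\sum_(i <- r | P i) F i) = \sum_(i <- r | P i) A (F i).
Proof. exact: linear_sum. Qed.

Lemma id_op_bd H : exists c : R, forall x : H, hnorm (id x) <= c * hnorm x.
Proof. by exists 1 => x; rewrite mul1r. Qed.
Definition id_op H : 'B(H, H) := mkop (fun _ _ _ => erefl) (id_op_bd H).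

Lemma comp_op_lin H K L (A : 'B(K, L)) (B : 'B(H, K)) :
  linear (fun x => A (B x)).
Proof. by move=> a x y; rewrite !opP. Qed.
Lemma comp_op_bd H K L (A : 'B(K, L)) (B : 'B(H, K)) :
  exists c : R, forall x, hnorm (A (B x)) <= c * hnorm x.
Proof.
have [c c0 hc] := op_hnorm_bound A; have [d d0 hd] := op_hnorm_bound B.
exists (c * d) => x; apply: le_trans (hc _) _.
by rewrite -mulrA ler_wpM2l.
Qed.
Definition comp_op H K L (A : 'B(K, L)) (B : 'B(H, K)) : 'B(H, L) :=
  mkop (comp_op_lin A B) (comp_op_bd A B).

Arguments id_op : simpl never.
Arguments comp_op : simpl never.

(** Together with [total_closed_subspace] or [da_cyclic] this reduces an identity between bounded
    operators to a total or generating family. *)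
Lemma closed_eq_op H K (A B : 'B(H, K)) : closed_subspace [set x | A x = B x].
Proof.
split=> /=; first by rewrite !linear0.
  by move=> a x y hx hy; rewrite !opP hx hy.
apply/closedE_hnorm => x hx; apply/eqP; rewrite -subr_eq0; apply/eqP.
apply: hnorm_eq0; apply/eqP; rewrite eq_le hnorm_ge0 andbT.
have [c c0 hc] := op_hnorm_bound A; have [d d0 hd] := op_hnorm_bound B.
apply/ler_addgt0Pr => e e0; rewrite add0r.
have cd : 0 < c + d + 1 by rewrite ltr_wpDl ?addr_ge0.
have [y /= hy xy] := hx (e / (c + d + 1)) ltac:(by rewrite divr_gt0).
have -> : A x - B x = A (x - y) - B (x - y).
  by rewrite !opB hy opprB addrA subrK.
apply: le_trans (ler_hnormB _ _) _.
move: xy; rewrite ltr_pdivlMr // => /ltW; apply: le_trans.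
have := hc (x - y); have := hd (x - y); have := hnorm_ge0 (x - y); nra.
Qed.

Lemma ker_closed_subspace H K (A : 'B(H, K)) : closed_subspace (ker_op A).
Proof.
have lin0 : linear (fun _ : H => 0 : K) by move=> a x y; rewrite scaler0 addr0.
have bd0 : exists c : R, forall x : H, hnorm (0 : K) <= c * hnorm x.
  by exists 0 => x; rewrite hnorm0 mul0r.
exact: (closed_eq_op A (mkop lin0 bd0)).
Qed.

Theorem riesz H (f : H -> R[i]) :
  (forall a x y, f (a *: x + y) = a * f x + f y) ->
  (exists c : R, forall x, cabs (f x) <= c * hnorm x) ->
  exists y, forall x, f x = inner x y.
Proof.
move=> lin [c hc].
have f0 : f 0 = 0 by apply: (addrI (f 0)); have := lin 1 0 0; rewrite scale1r addr0 mul1r addr0.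
have fZ a x : f (a *: x) = a * f x by have := lin a x 0; rewrite !addr0 f0 addr0.
have fB x y : f (x - y) = f x - f y.
  by have := lin (-1) y x; rewrite scaleN1r mulN1r addrC => ->; rewrite addrC.
have cK : closed_subspace [set x | f x = 0].
  split=> //=; first by move=> a x y hx hy; rewrite lin hx hy mulr0 addr0.
  apply/closedE_hnorm => x hx; apply: cabs_eq0; apply/eqP.
  rewrite eq_le cabs_ge0 andbT; apply/ler_addgt0Pr => e e0; rewrite add0r.
  have c0 : 0 < `|c| + 1 by rewrite ltr_wpDl.
  have [y /= hy xy] := hx (e / (`|c| + 1)) ltac:(by rewrite divr_gt0).
  have -> : f x = f (x - y) by rewrite fB hy subr0.
  apply: le_trans (hc _) _; move: xy; rewrite ltr_pdivlMr // => /ltW.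
  apply: le_trans; rewrite mulrC ler_wpM2l ?hnorm_ge0 //.
  by rewrite (le_trans (ler_norm _)) // lerDl.
have [[x0 nx0]|all0] := pselect (exists x, f x <> 0); last first.
  exists 0 => x; rewrite ip0r; apply: contrapT => nfx.
  by apply: all0; exists x.
have [p fp orth] := projection_theorem cK x0.
pose z := x0 - p; have fz : f z != 0 by rewrite fB fp subr0; apply/eqP.
have zz : inner z z != 0.
  by apply: contra_neq fz => /ip_eq0 ->.
(* z is orthogonal to the kernel of f, which contains x - (f x / f z) z; this determines inner x
   z. *)
exists (((f z)^* / inner z z) *: z) => x.
have : inner z (x - (f x / f z) *: z) = 0.
  by apply: orth; rewrite /= fB fZ divfK // subrr.
rewrite ipBr ipZr => /eqP; rewrite subr_eq0 => /eqP zx.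
rewrite ipZr (ipC x) zx !rmorphM /= !conjCK fmorphV /= -!ipC.
by field; rewrite fz.
Qed.

Theorem adjoint_ex H K (A : 'B(H, K)) : exists B : 'B(K, H), is_adjoint A B.
Proof.
have [c c0 hc] := op_hnorm_bound A.
have /choice [g hg] : forall y : K, exists z : H, forall x, inner (A x) y = inner x z.
  move=> y; apply: (@riesz H (fun x => inner (A x) y)).
    by move=> a x z; rewrite opP ipDl ipZl.
  exists (c * hnorm y) => x; apply: le_trans (cauchy_schwarz _ _) _.
  by rewrite mulrAC ler_wpM2r ?hnorm_ge0.
have lin : linear g.
  move=> a y z; apply: ip_inj => x; rewrite ipC -hg ipDr ipZr rmorphD rmorphM /=.
  by rewrite conjCK !hg -!ipC ipDl ipZl.
have bd : exists d : R, forall y, hnorm (g y) <= d * hnorm y.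
  (* |g y|^2 = <A (g y), y> <= c |g y| |y|. *)
  exists c => y; have := hg y (g y); rewrite ip_hnorm => /(congr1 (@cabs R)).
  rewrite cabsR ?sqr_ge0 // => h.
  have := cauchy_schwarz (A (g y)) y; rewrite h => h1.
  have h2 := hc (g y).
  have [->|gy0] := eqVneq (hnorm (g y)) 0; first by rewrite mulr_ge0 ?hnorm_ge0.
  have gp : 0 < hnorm (g y) by rewrite lt_def gy0 hnorm_ge0.
  rewrite -(ler_pM2l gp) -expr2; apply: le_trans h1 _.
  by rewrite mulrA (mulrC (hnorm (g y))) ler_wpM2r ?hnorm_ge0.
by exists (mkop lin bd) => x y; rewrite hg.
Qed.

Definition adj H K (A : 'B(H, K)) : 'B(K, H) := sval (cid (adjoint_ex A)).

Lemma adjP H K (A : 'B(H, K)) x y : inner (A x) y = inner x (adj A y).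
Proof. by rewrite /adj; case: cid. Qed.
Lemma adjPl H K (A : 'B(H, K)) x y : inner (adj A y) x = inner y (A x).
Proof. by rewrite ipC -adjP -ipC. Qed.

Lemma is_adjoint_adj H K (A : 'B(H, K)) B : is_adjoint A B -> B =1 adj A.
Proof.
by move=> h y; apply: ip_inj => x; rewrite ipC -h adjP -ipC.
Qed.

Lemma op_isom_hnorm H K (A : 'B(H, K)) x :
  inner (A x) (A x) = inner x x -> hnorm (A x) = hnorm x.
Proof.
move=> h; apply/eqP; rewrite -(@eqrXn2 _ 2) ?hnorm_ge0 //.
by rewrite !hnorm_ip h.
Qed.

End Operators.

(** Completeness is phrased through sequences and the squared norm, so that an instance needs no
    topology in advance; the norm and the uniform structure are derived from the form. *)
Record preHilbert (R : realType) := PreHilbert {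
  ph_sort : lmodType R[i];
  ph_ip : ph_sort -> ph_sort -> R[i];
  ph_linear : forall a x y z, ph_ip (a *: x + y) z = a * ph_ip x z + ph_ip y z;
  ph_herm : forall x y, ph_ip x y = (ph_ip y x)^*;
  ph_pos : forall x, x != 0 -> 0 < ph_ip x x;
  ph_complete : forall u : nat -> ph_sort,
    (forall e : R, 0 < e -> exists N, forall p q, (N <= p)%N -> (N <= q)%N ->
       complex.Re (ph_ip (u p - u q) (u p - u q)) < e) ->
    exists x, forall e : R, 0 < e -> exists N, forall k, (N <= k)%N ->
       complex.Re (ph_ip (x - u k) (x - u k)) < e
}.

(** * The Hilbert space of a complete inner product *)

Section Hilbert_of_form.
Variables (R : realType) (P : preHilbert R).

Definition ph_type : Type := ph_sort P.
HB.instance Definition _ := GRing.Lmodule.on ph_type.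

Definition ph_form (x y : ph_type) : R[i] := ph_ip x y.
Implicit Types x y z : ph_type.

Lemma ph_formDl x y z : ph_form (x + y) z = ph_form x z + ph_form y z.
Proof. by have := ph_linear 1 x y z; rewrite scale1r mul1r. Qed.
Lemma ph_form0l y : ph_form 0 y = 0.
Proof. by apply: (addrI (ph_form 0 y)); rewrite -ph_formDl !addr0. Qed.
Lemma ph_formZl a x z : ph_form (a *: x) z = a * ph_form x z.
Proof.
have := ph_linear a x (0 : ph_type) z; rewrite -!/(ph_form _ _).
by rewrite ph_form0l !addr0.
Qed.
Lemma ph_formC x y : ph_form x y = (ph_form y x)^*.
Proof. exact: ph_herm. Qed.
Lemma ph_formDr x y z : ph_form x (y + z) = ph_form x y + ph_form x z.
Proof. by rewrite ph_formC ph_formDl rmorphD /= -!ph_formC. Qed.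
Lemma ph_formZr a x y : ph_form x (a *: y) = a^* * ph_form x y.
Proof. by rewrite ph_formC ph_formZl rmorphM /= -!ph_formC. Qed.

Lemma ph_linear_l y : zmod_morphism (ph_form ^~ y).
Proof. by move=> a b /=; rewrite -scaleN1r ph_formDl ph_formZl mulN1r. Qed.
Lemma ph_linear_r x : zmod_morphism (ph_form x).
Proof.
by move=> a b /=; rewrite -scaleN1r ph_formDr ph_formZr rmorphN rmorph1 mulN1r.
Qed.
Lemma ph_hermitian x y : ph_form x y = (-1) ^+ false * (ph_form y x)^*.
Proof. by rewrite expr0 mul1r ph_formC. Qed.

HB.instance Definition _ := @isBilinear.Build R[i] ph_type ph_type R[i]
  *%R (Num.conj \; *%R) ph_form ph_linear_l ph_linear_r
  (fun y a x => ph_formZl a x y) (fun x a y => ph_formZr a x y).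
HB.instance Definition _ :=
  @isHermitianSesquilinear.Build R[i] ph_type false Num.conj ph_form ph_hermitian.
HB.instance Definition _ :=
  @isDotProduct.Build R[i] ph_type ph_form (@ph_pos R P).

Definition ph_q x : R := complex.Re (ph_form x x).

Lemma ph_q_form x : ph_form x x = (ph_q x)%:C%C.
Proof.
rewrite /ph_q RRe_real // ger0_real //.
have [->|/ph_pos/ltW//] := eqVneq x 0; by rewrite ph_form0l.
Qed.
Lemma ph_q_ge0 x : 0 <= ph_q x.
Proof.
rewrite -lecR -ph_q_form.
have [->|/ph_pos/ltW//] := eqVneq x 0; by rewrite ph_form0l.
Qed.
Lemma ph_qD x y : ph_q (x + y) = ph_q x + ph_q y + complex.Re (ph_form x y) *+ 2.
Proof.
by rewrite /ph_q ph_formDl !ph_formDr !ReD (ph_formC y x) ReJ; ring.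
Qed.
Lemma ph_qZ a x : ph_q (a *: x) = cabs a ^+ 2 * ph_q x.
Proof.
apply: (@complexI R); rewrite rmorphM /= -!ph_q_form cabsX2.
by rewrite ph_formZl ph_formZr mulrA.
Qed.
Lemma ph_q0 x : ph_q x = 0 -> x = 0.
Proof.
move=> h; apply: contrapT => /eqP /ph_pos.
by rewrite -[ph_ip x x]/(ph_form x x) ph_q_form h ltxx.
Qed.

Definition ph_norm x : R := Num.sqrt (ph_q x).

Lemma ph_cauchy_schwarz x y :
  complex.Re (ph_form x y) <= ph_norm x * ph_norm y.
Proof.
have [/ph_q0 ->|q0] := eqVneq (ph_q y) 0.
  by rewrite ph_formC ph_form0l rmorph0 mulr_ge0 ?sqrtr_ge0.
have qy : 0 < ph_q y by rewrite lt_def q0 ph_q_ge0.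
(* This t minimises the quadratic polynomial [ph_q] (x - t y) in the real variable t. *)
set r := complex.Re _; pose t := r / ph_q y.
have := ph_q_ge0 (x + (- t)%:C%C *: y).
rewrite ph_qD ph_qZ -[cabs _ ^+ 2 * _]mul1r.
have -> : cabs (- t)%:C%C ^+ 2 = t ^+ 2.
  by rewrite cabs_real normrN -normrX ger0_norm // sqr_ge0.
have -> : complex.Re (ph_form x ((- t)%:C%C *: y)) = - (t * r).
  rewrite ph_formZr; have -> : ((- t)%:C%C : R[i])^* = (- t)%:C%C by exact: conjc_real.
  by rewrite ReM_real mulNr.
have tq : t * ph_q y = r by rewrite divfK.
move=> h.
have : r ^+ 2 <= ph_q x * ph_q y.
  have : 0 <= (ph_q x - t * r) * ph_q y.
    apply: mulr_ge0; last exact: ltW.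
    move: h; rewrite mul1r expr2 -mulrA tq; lra.
  by rewrite mulrBl -mulrA (mulrC r) mulrA tq subr_ge0 expr2.
move=> le; apply: le_trans (ler_norm _) _.
rewrite -sqrtr_sqr /ph_norm -sqrtrM ?ph_q_ge0 //.
by rewrite ler_wsqrtr.
Qed.

Lemma ph_normX2 x : ph_norm x ^+ 2 = ph_q x.
Proof. by rewrite sqr_sqrtr // ph_q_ge0. Qed.

Definition ph_cnorm x : R[i] := (ph_norm x)%:C%C.

Lemma ph_normD x y : ph_cnorm (x + y) <= ph_cnorm x + ph_cnorm y.
Proof.
rewrite /ph_cnorm -rmorphD lecR /= -(@ler_pXn2r _ 2) // ?nnegrE ?addr_ge0 ?sqrtr_ge0 //.
rewrite sqrrD !ph_normX2 ph_qD -addrA [X in _ + X]addrC addrA.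
by rewrite lerD2r lerD2l lerMn2r ph_cauchy_schwarz orbT.
Qed.
Lemma ph_normZ a x : ph_cnorm (a *: x) = `|a| * ph_cnorm x.
Proof.
rewrite /ph_cnorm -cabsE -rmorphM /= /ph_norm ph_qZ sqrtrM ?sqr_ge0 //.
by rewrite sqrtr_sqr ger0_norm // cabs_ge0.
Qed.
Lemma ph_norm_eq0 x : ph_cnorm x = 0 -> x = 0.
Proof.
move=> /(@complexI R _ 0) h; apply: ph_q0.
by rewrite -ph_normX2 h expr0n.
Qed.

HB.instance Definition _ := @Lmodule_isNormed.Build R[i] ph_type ph_cnorm
  ph_normD ph_normZ ph_norm_eq0.

Lemma ph_normE x : `|x| = (ph_norm x)%:C%C. Proof. by []. Qed.

Lemma inv_small (e : R) : 0 < e ->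
  exists N, forall k, (N <= k)%N -> k.+1%:R^-1 < e.
Proof.
move=> e0; exists (Num.truncn e^-1) => k Nk.
rewrite invf_plt ?posrE ?ltr0n //; apply: lt_le_trans (truncnS_gt _) _.
by rewrite ler_nat ltnS.
Qed.

(** Reduction from filters to sequences: F contains balls of radius 1/(k+1), and their centres u_k
    form a Cauchy sequence because any two members of F meet. F converges to the limit of u. *)
Lemma ph_cauchy_cvg (F : set_system ph_type) :
  ProperFilter F -> cauchy F -> cvg F.
Proof.
move=> FF /cauchyP cF.
have /choice [u hu] : forall k : nat, exists x, F (ball x (k.+1%:R^-1)%:C%C).
  by move=> k; apply: cF; rewrite ltcR invr_gt0 ltr0n.
have uu p q : ph_norm (u p - u q) < p.+1%:R^-1 + q.+1%:R^-1.
  have [z [zp zq]] := filter_ex (filterI (hu p) (hu q)).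
  move: zp zq; rewrite -!ball_normE /= !ph_normE !ltcR => zp zq.
  rewrite -ltcR -ph_normE; apply: le_lt_trans (ler_distD z _ _) _.
  by rewrite (distrC z) !ph_normE -rmorphD ltcR /= ltrD.
have sq (x : ph_type) (e : R) : 0 < e -> (complex.Re (ph_ip x x) < e ^+ 2) = (ph_norm x < e).
  move=> e0; rewrite -[complex.Re _]/(ph_q x) -ph_normX2.
  by rewrite ltr_pXn2r // nnegrE ?sqrtr_ge0 // ltW.
have sqe (e : R) : 0 < e -> exists2 d, 0 < d & e = d ^+ 2.
  by move=> e0; exists (Num.sqrt e); rewrite ?sqrtr_gt0 // sqr_sqrtr // ltW.
have [|x hx] := @ph_complete R P u.
  move=> e /sqe [d d0 ->]; have [N hN] := inv_small (e := d / 2) ltac:(by rewrite divr_gt0).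
  exists N => p q Np Nq; rewrite sq //; apply: lt_trans (uu p q) _.
  by rewrite [ltRHS]splitr ltrD // hN.
apply/cvg_ex; exists x; apply/cvgrPdist_lt => e e0.
have [r r0 ->] := realC_gt0 e0.
have [N1 h1] := inv_small (e := r / 2) ltac:(by rewrite divr_gt0).
have [N2 h2] := hx ((r / 2) ^+ 2) ltac:(by rewrite exprn_gt0 // divr_gt0).
pose k := maxn N1 N2; have := hu k; apply: filterS => y.
have := h2 k (leq_maxr _ _); rewrite sq ?divr_gt0 // => xk.
rewrite -ball_normE /= !ph_normE !ltcR => ky.
rewrite -ltcR -ph_normE; apply: le_lt_trans (ler_distD (u k) _ _) _.
rewrite !ph_normE -rmorphD ltcR /=.
by rewrite [ltRHS]splitr ltrD // (lt_trans ky) // h1 // leq_maxl.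
Qed.

HB.instance Definition _ := Uniform_isComplete.Build ph_type ph_cauchy_cvg.

Lemma ph_inner_norm x : ph_form x x = `|x| ^+ 2.
Proof. by rewrite ph_normE -rmorphXn /= ph_normX2 ph_q_form. Qed.

HB.instance Definition _ := @isHilbert.Build R ph_type ph_form ph_inner_norm.

Definition hilbert_of_form : hilbertType R := ph_type.

End Hilbert_of_form.

(** * Closed subspaces as Hilbert spaces *)

Record closedSub (R : realType) (H : hilbertType R) := ClosedSub {
  cs_set : set H;
  cs_closed : closed_subspace cs_set
}.

Section Subspace_Hilbert.
Variables (R : realType) (H : hilbertType R) (V : closedSub H).

Definition sub_pred : {pred H} := fun x => x \in cs_set V.

Let sV := closed_subspace_subspace (cs_closed V).

Lemma sub_submod : submod_closed sub_pred.
Proof.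
split; first by rewrite unfold_in inE; exact: subspace0.
by move=> a x y; rewrite !unfold_in !inE; exact: sV.2.
Qed.
HB.instance Definition _ := GRing.isSubmodClosed.Build R[i] H sub_pred sub_submod.

Definition sub_carrier : Type := {x : H | sub_pred x}.
HB.instance Definition _ := [isSub of sub_carrier for @sval H sub_pred].
HB.instance Definition _ := [Choice of sub_carrier by <:].
HB.instance Definition _ := [SubChoice_isSubLmodule of sub_carrier by <:].

Definition sub_ip (x y : sub_carrier) : R[i] := inner (val x) (val y).

Lemma sub_ipl a x y z : sub_ip (a *: x + y) z = a * sub_ip x z + sub_ip y z.
Proof. by rewrite /sub_ip linearP ipDl ipZl. Qed.
Lemma sub_ipC x y : sub_ip x y = (sub_ip y x)^*.
Proof. exact: ipC. Qed.
Lemma sub_ip_gt0 x : x != 0 -> 0 < sub_ip x x.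
Proof.
move=> x0; rewrite /sub_ip inner_norm exprn_gt0 // normr_gt0.
by apply: contra_neq x0 => h; apply: val_inj; rewrite h linear0.
Qed.
Lemma sub_complete (u : nat -> sub_carrier) :
  (forall e : R, 0 < e -> exists N, forall p q, (N <= p)%N -> (N <= q)%N ->
     complex.Re (sub_ip (u p - u q) (u p - u q)) < e) ->
  exists x, forall e : R, 0 < e -> exists N, forall k, (N <= k)%N ->
     complex.Re (sub_ip (x - u k) (x - u k)) < e.
Proof.
have sqE (x y : sub_carrier) : complex.Re (sub_ip (x - y) (x - y)) = hnorm (val x - val y) ^+ 2.
  by rewrite hnorm_ip /sub_ip linearB.
have sq (x : H) (e : R) : 0 < e -> (hnorm x ^+ 2 < e ^+ 2) = (hnorm x < e).
  by move=> e0; rewrite ltr_pXn2r // nnegrE ?hnorm_ge0 // ltW.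
move=> h; have [|x hx] := @cauchy_hnorm R H (fun k => val (u k)).
  move=> e e0; have [|N hN] := h (e ^+ 2); first by rewrite exprn_gt0.
  by exists N => p q Np Nq; have := hN p q Np Nq; rewrite sqE sq.
have Vx : sub_pred x.
  rewrite /sub_pred inE; have [_ _ /closedE_hnorm] := cs_closed V; apply => e.
  move=> /hx [N hN]; exists (val (u N)); last exact: hN.
  exact: (set_mem (valP (u N))).
exists (exist _ x Vx) => e e0.
have [N hN] := hx (Num.sqrt e) ltac:(by rewrite sqrtr_gt0).
exists N => k Nk; rewrite sqE -[ltRHS](sqr_sqrtr (ltW e0)) sq ?sqrtr_gt0 //.
exact: hN.
Qed.

Definition sub_preHilbert := PreHilbert sub_ipl sub_ipC sub_ip_gt0 sub_complete.
Lemma sub_hilbert_ex : {K : hilbertType R & {f : 'B(K, H) |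
  (forall x y, inner (f x) (f y) = inner x y) /\
  (forall x, cs_set V x <-> exists y, f y = x)}}.
Proof.
pose K := hilbert_of_form sub_preHilbert.
pose f (x : K) : H := @sval H sub_pred x.
have lin : linear f.
  by move=> a x y; exact: (@linearP _ _ _ _ (val : sub_carrier -> H)).
have bd : exists c : R, forall x, hnorm (f x) <= c * hnorm x.
  exists 1 => x; rewrite mul1r le_eqVlt; apply/orP; left.
  by rewrite -(@eqrXn2 _ 2) ?hnorm_ge0 // !hnorm_ip.
exists K, (mkop lin bd); split=> // x; split=> [|[y <-]].
  by rewrite -inE => Vx; exists (exist _ x Vx).
exact: (set_mem (@valP _ _ sub_carrier y)).
Qed.

(* Kept behind an opaque proof so that simplification never exposes the
   construction of the Hilbert space structure. *)
Definition sub_hilbert : hilbertType R := projT1 sub_hilbert_ex.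
Definition incl : 'B(sub_hilbert, H) := sval (projT2 sub_hilbert_ex).

Lemma incl_ip (x y : sub_hilbert) : inner (incl x) (incl y) = inner x y.
Proof. by rewrite /incl; case: (projT2 sub_hilbert_ex) => f [/= ->]. Qed.
Lemma incl_onto x : cs_set V x -> exists y : sub_hilbert, incl y = x.
Proof. by rewrite /incl; case: (projT2 sub_hilbert_ex) => f [/= _ h] /h. Qed.
Lemma incl_mem (x : sub_hilbert) : cs_set V (incl x).
Proof. by rewrite /incl; case: (projT2 sub_hilbert_ex) => f [/= _ h]; apply/h; exists x. Qed.
Lemma incl_hnorm (x : sub_hilbert) : hnorm (incl x) = hnorm x.
Proof. by apply: op_isom_hnorm; exact: incl_ip. Qed.
Lemma incl_inj : injective incl.
Proof.
move=> x y h; apply/eqP; rewrite -subr_eq0; apply/eqP/hnorm_eq0.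
by rewrite -incl_hnorm opB h subrr hnorm0.
Qed.

(** The orthogonal projection with values in the abstract space [sub_hilbert]; as a vector of H, the
    projection of x is [incl (proj x)]. *)
Definition proj : 'B(H, sub_hilbert) := adj incl.
Lemma projK (x : sub_hilbert) : proj (incl x) = x.
Proof. by apply: ip_inj => y; rewrite adjPl incl_ip. Qed.
Lemma proj_orth x y : cs_set V y -> inner (x - incl (proj x)) y = 0.
Proof. by move=> /incl_onto [z <-]; rewrite ipBl incl_ip adjPl subrr. Qed.
Lemma proj_mem x : cs_set V x -> incl (proj x) = x.
Proof. by move=> /incl_onto [z <-]; rewrite projK. Qed.

Lemma restrict_ex (A : 'B(H, H)) : (forall x, cs_set V x -> cs_set V (A x)) ->
  exists B : 'B(sub_hilbert, sub_hilbert), forall x, incl (B x) = A (incl x).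
Proof.
move=> VA; exists (comp_op proj (comp_op A incl)) => x.
exact: (proj_mem (VA _ (incl_mem x))).
Qed.
End Subspace_Hilbert.

(** * The Drury-Arveson space as a symmetric Fock space *)

Definition clim (R : realType) (s : nat -> R[i]) (l : R[i]) :=
  forall e : R, 0 < e -> exists N, forall k, (N <= k)%N -> cabs (s k - l) < e.

Section Complex_limits.
Variable R : realType.
Implicit Types (s t : nat -> R[i]) (l m : R[i]).

Lemma clim_unique s l m : clim s l -> clim s m -> l = m.
Proof.
move=> sl sm; apply/eqP; rewrite -subr_eq0; apply/eqP/cabs_eq0/eqP.
rewrite eq_le cabs_ge0 andbT; apply/ler_addgt0Pr => e e0; rewrite add0r.
have [N hN] := sl (e / 2) ltac:(by rewrite divr_gt0).
have [M hM] := sm (e / 2) ltac:(by rewrite divr_gt0).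
have -> : l - m = (s (maxn N M) - m) + - (s (maxn N M) - l).
  by rewrite opprB [RHS]addrC subrKA.
apply: le_trans (cabsD _ _) _; rewrite cabsN [e]splitr lerD // ltW //.
  by apply: hM; exact: leq_maxr.
by apply: hN; exact: leq_maxl.
Qed.

Lemma climD s t l m : clim s l -> clim t m -> clim (fun k => s k + t k) (l + m).
Proof.
move=> sl tm e e0.
have [N hN] := sl (e / 2) ltac:(by rewrite divr_gt0).
have [M hM] := tm (e / 2) ltac:(by rewrite divr_gt0).
exists (maxn N M) => k; rewrite geq_max => /andP[Nk Mk].
rewrite opprD addrACA; apply: le_lt_trans (cabsD _ _) _.
by rewrite [ltRHS]splitr ltrD ?hN ?hM.
Qed.

Lemma climZ a s l : clim s l -> clim (fun k => a * s k) (a * l).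
Proof.
move=> sl e e0; have a0 : 0 < cabs a + 1 by rewrite ltr_wpDl ?cabs_ge0.
have [N hN] := sl (e / (cabs a + 1)) ltac:(by rewrite divr_gt0).
exists N => k /hN; rewrite ltr_pdivlMr // -mulrBr cabsM => h.
by apply: le_lt_trans h; rewrite mulrC ler_wpM2l ?cabs_ge0 // lerDl.
Qed.

Lemma climJ s l : clim s l -> clim (fun k => (s k)^*) l^*.
Proof.
by move=> sl e /sl [N hN]; exists N => k /hN; rewrite -rmorphB /= cabsJ.
Qed.

Lemma clim_cst (a : R[i]) : clim (fun _ => a) a.
Proof. by move=> e e0; exists 0%N => k _; rewrite subrr cabs0. Qed.

Lemma clim_sum (I : Type) (r : seq I) (s : I -> nat -> R[i]) (l : I -> R[i]) :
  (forall i, clim (s i) (l i)) ->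
  clim (fun k => \sum_(i <- r) s i k) (\sum_(i <- r) l i).
Proof.
move=> h; elim: r => [|i r IH].
  by rewrite big_nil => e e0; exists 0%N => k _; rewrite big_nil subrr cabs0.
move=> e e0; have [N hN] := climD (h i) IH e0; exists N => k /hN.
by rewrite !big_cons.
Qed.

Lemma clim_shift s l : clim s l -> clim (fun k => s k.+1) l.
Proof. by move=> sl e /sl [N hN]; exists N => k Nk; apply: hN; exact: leqW. Qed.

Lemma clim_ext s t l : s =1 t -> clim s l -> clim t l.
Proof. by move=> /funext ->. Qed.

Lemma clim_mono (s : nat -> R) (c : R) : (forall k, s k <= s k.+1) ->
  (forall k, s k <= c) -> clim (fun k => (s k)%:C%C) (sup (range s))%:C%C.
Proof.
move=> inc bd e e0.
have hs : has_sup (range s).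
  by split; [exists (s 0%N), 0%N|exists c => _ [k _ <-]].
have [_ [N _ <-] hN] := sup_adherent e0 hs.
exists N => k Nk.
have mono : s N <= s k.
  by elim: k Nk => [|k IH]; [case: N {hN}|rewrite leq_eqVlt => /predU1P[->//|/IH/le_trans]; apply].
have le : s k <= sup (range s) by apply: sup_upper_bound => //; exists k.
rewrite -rmorphB /= cabs_real ler0_norm ?subr_le0 //; lra.
Qed.
End Complex_limits.

(** * Sums over words *)

Section Word_sums.
Variables (n : nat).
Implicit Type w : seq 'I_n.

(* The sum of f over the words of length < N. *)
Fixpoint wsum (V : nmodType) (N : nat) (f : seq 'I_n -> V) : V :=
  if N is N'.+1 then f [::] + \sum_i wsum N' (fun w => f (i :: w)) else 0.

Lemma wsumD (V : nmodType) N (f g : seq 'I_n -> V) :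
  wsum N (fun w => f w + g w) = wsum N f + wsum N g.
Proof.
elim: N f g => [|N IH] f g /=; first by rewrite addr0.
by rewrite addrACA -big_split /=; congr (_ + _); apply: eq_bigr => i _; exact: IH.
Qed.
Lemma wsum_additive (V W : nmodType) (h : V -> W) N (f : seq 'I_n -> V) :
  h 0 = 0 -> {morph h : x y / x + y} -> wsum N (fun w => h (f w)) = h (wsum N f).
Proof.
move=> h0 hD; elim: N f => [|N IH] f /=; first by rewrite h0.
rewrite hD (big_morph h hD h0); congr (_ + _).
by apply: eq_bigr => i _; exact: IH.
Qed.
Lemma wsumZ (R : pzRingType) N (a : R) (f : seq 'I_n -> R) :
  wsum N (fun w => a * f w) = a * wsum N f.
Proof. by apply: (wsum_additive (h := fun x => a * x)); [rewrite mulr0|exact: mulrDr]. Qed.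

Lemma eq_wsum (V : nmodType) N (f g : seq 'I_n -> V) : f =1 g -> wsum N f = wsum N g.
Proof. by move=> /funext ->. Qed.

Section Real.
Variable R : realType.
Implicit Types f g : seq 'I_n -> R.

Lemma wsum_le N f g : (forall w, f w <= g w) -> wsum N f <= wsum N g.
Proof.
elim: N f g => [//|N IH] f g fg /=; apply: lerD => //.
by apply: ler_sum => i _; exact: IH.
Qed.
Lemma wsum_ge0 N f : (forall w, 0 <= f w) -> 0 <= wsum N f.
Proof.
elim: N f => [//|N IH] f f0 /=; apply: addr_ge0 => //.
by apply: sumr_ge0 => i _; exact: IH.
Qed.
Lemma wsum_mono N f : (forall w, 0 <= f w) -> wsum N f <= wsum N.+1 f.
Proof.
elim: N f => [|N IH] f f0.
  by apply: (@wsum_ge0 1).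
by rewrite [wsum N.+1 f]/= [wsum N.+2 f]/= lerD2l; apply: ler_sum => i _; exact: IH.
Qed.
Lemma le_wsum f w : (forall w, 0 <= f w) -> f w <= wsum (size w).+1 f.
Proof.
elim: w f => [|i w IH] f f0.
  by rewrite /= lerDl; apply: sumr_ge0.
rewrite [size _]/= [wsum _.+2 f]/=; apply: ler_wpDl => //.
rewrite (bigD1 i) //=; apply: ler_wpDr; last exact: (IH (fun w => f (i :: w))).
by apply: sumr_ge0 => j _; apply: (@wsum_ge0 (size w).+1 (fun w => f (j :: w))).
Qed.
Lemma wsum_cons_le N f i : (forall w, 0 <= f w) ->
  wsum N (fun w => f (i :: w)) <= wsum N.+1 f.
Proof.
move=> f0; rewrite /=; apply: ler_wpDl => //.
rewrite (bigD1 i) //=; apply: ler_wpDr => //.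
by apply: sumr_ge0 => j _; exact: wsum_ge0.
Qed.

(** For fixed N only finitely many words occur, so smallness at each word is uniform. *)
Lemma wsum_small (F : nat -> seq 'I_n -> R) :
  (forall w e, 0 < e -> exists Q, forall q, (Q <= q)%N -> F q w < e) ->
  forall N e, 0 < e -> exists Q, forall q, (Q <= q)%N -> wsum N (F q) < e.
Proof.
move=> h N; elim: N F h => [|N IH] F h e e0; first by exists 0%N.
have [Q0 h0] := h [::] (e / 2) ltac:(by rewrite divr_gt0).
(* n + 1 instead of n keeps the bound positive for n = 0. *)
have d0 : 0 < e / 2 / n.+1%:R by rewrite !divr_gt0.
have /choice [Q hQ] : forall i : 'I_n, exists Q, forall q, (Q <= q)%N ->
    wsum N (fun w => F q (i :: w)) < e / 2 / n.+1%:R.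
  by move=> i; apply: (IH (fun q w => F q (i :: w))) => // w; exact: h.
exists (maxn Q0 (\max_i Q i)) => q; rewrite geq_max => /andP[q0 /bigmax_leqP qi].
rewrite /= [ltRHS]splitr; apply: ltr_leD; first exact: h0.
apply: (@le_trans _ _ (\sum_(i < n) (e / 2 / n.+1%:R))).
  by apply: ler_sum => i _; apply/ltW/hQ/qi.
rewrite sumr_const card_ord -[leLHS]mulr_natr -[leRHS]mulr1 -mulrA ler_wpM2l //.
  by rewrite ltW // divr_gt0.
by rewrite mulrC ler_pdivrMr // mul1r ler_nat.
Qed.
End Real.
End Word_sums.

(** * Square-summable symmetric families and their completeness *)

Section Fock_carrier.
Variables (R : realType) (n : nat) (E : hilbertType R).
Local Notation word := (seq 'I_n).
Implicit Types a b : word -> E.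

Definition sqw a : word -> R := fun w => hnorm (a w) ^+ 2.
(** Adjacent transpositions generate the symmetric groups, so a symmetric family depends only on the
    multi-index of the word. *)
Definition wsym (T : Type) (a : word -> T) :=
  forall u i j v, a (u ++ [:: i, j & v]) = a (u ++ [:: j, i & v]).
Definition fock_bounded a (c : R) := forall N, wsum N (sqw a) <= c.
Definition fock_set : set (word -> E) :=
  [set a | (exists c : R, fock_bounded a c) /\ wsym a].

Lemma sqw_ge0 a w : 0 <= sqw a w. Proof. exact: sqr_ge0. Qed.

Lemma sqw_lin t a b w :
  sqw (t *: a + b) w <= (cabs t ^+ 2) *+ 2 * sqw a w + 2 * sqw b w.
Proof.
rewrite /sqw fctE /=.
have := parallelogram (t *: a w) (b w); rewrite hnormZ exprMn => h.
have := sqr_ge0 (hnorm (t *: a w - b w)).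
rewrite -[X in _ -> hnorm X ^+ 2 <= _]/(t *: a w + b w); lra.
Qed.

Definition fock_pred : {pred word -> E} := fun a => a \in fock_set.

Lemma fock_submod : submod_closed fock_pred.
Proof.
split; first (rewrite unfold_in inE; split=> //).
  exists 0 => N; have -> : sqw 0 = (fun w => 0 * sqw 0 w).
    by apply/funext => w; rewrite /sqw hnorm0 expr0n mul0r.
  by rewrite wsumZ mul0r.
move=> t a b; rewrite !unfold_in !inE => -[[c ac] sa] [[d bd] sb]; split.
  exists (cabs t ^+ 2 *+ 2 * c + 2 * d) => N.
  apply: le_trans (wsum_le N (sqw_lin t a b)) _.
  by rewrite wsumD !wsumZ lerD // ler_wpM2l // mulrn_wge0 // sqr_ge0.
move=> u i j v; by have := sa u i j v; have := sb u i j v; rewrite !fctE => -> ->.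
Qed.
HB.instance Definition _ :=
  GRing.isSubmodClosed.Build R[i] (word -> E) fock_pred fock_submod.

Definition fock_carrier : Type := {a : word -> E | fock_pred a}.
HB.instance Definition _ := [isSub of fock_carrier for @sval (word -> E) fock_pred].
HB.instance Definition _ := [Choice of fock_carrier by <:].
HB.instance Definition _ := [SubChoice_isSubLmodule of fock_carrier by <:].

Implicit Types x y z : fock_carrier.

Lemma fockP x : fock_set (val x). Proof. exact: (set_mem (valP x)). Qed.

Definition fipw a b : word -> R[i] := fun w => inner (a w) (b w).
Definition fq a : R := sup (range (fun N => wsum N (sqw a))).

Lemma fq_clim x : clim (fun N => wsum N (fipw (val x) (val x))) (fq (val x))%:C%C.
Proof.
have [[c xc] _] := fockP x.
apply: clim_ext (clim_mono (c := c) _ xc) => [N|N]; last first.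
  by apply: wsum_mono => w; exact: sqw_ge0.
rewrite -(wsum_additive (h := real_complex R)) ?rmorph0 //; last exact: rmorphD.
by apply: eq_wsum => w; rewrite /fipw ip_hnorm.
Qed.

Lemma fipw_lin t x y b w :
  fipw (val (t *: x + y)) b w = t * fipw (val x) b w + fipw (val y) b w.
Proof. by rewrite /fipw linearP fctE ipDl ipZl. Qed.
Lemma fipwC a b w : fipw a b w = (fipw b a w)^*.
Proof. exact: ipC. Qed.
Lemma ip_polar (u v : E) : inner u v =
  4^-1 * inner (1 *: v + u) (1 *: v + u)
  + (- 4^-1 * inner ((-1) *: v + u) ((-1) *: v + u)
  + ('i%C / 4 * inner ('i%C *: v + u) ('i%C *: v + u)
  + - 'i%C / 4 * inner ((- 'i%C) *: v + u) ((- 'i%C) *: v + u))).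
Proof.
have ci : ('i%C : R[i])^* = - 'i%C by apply/eqP; rewrite eq_complex /= oppr0 !eqxx.
have ii : 'i%C * 'i%C = -1 :> R[i] by rewrite -expr2 sqr_i.
rewrite !(ipDl, ipDr, ipZl, ipZr) !rmorphN !rmorph1 /= ci.
move: (inner u u) (inner u v) (inner v u) (inner v v) 'i%C ii => a b c d j jj.
(* [field] treats j as a free variable, so the multiple of j^2 + 1 by which the two sides differ is
   written out. *)
transitivity (b + (j * j + 1) * ((c - b) / 2)); last by field.
by rewrite jj addNr mul0r addr0.
Qed.
Lemma fipw_polar x y w : fipw (val x) (val y) w =
  4^-1 * (fipw (val (1 *: y + x)) (val (1 *: y + x)) w)
  + (- 4^-1 * (fipw (val ((-1) *: y + x)) (val ((-1) *: y + x)) w)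
  + ('i%C / 4 * (fipw (val ('i%C *: y + x)) (val ('i%C *: y + x)) w)
  + - 'i%C / 4 * (fipw (val ((- 'i%C) *: y + x)) (val ((- 'i%C) *: y + x)) w))).
Proof.
rewrite /fipw ip_polar.
have vE t : val (t *: y + x) w = t *: val y w + val x w by rewrite linearP.
by rewrite !vE.
Qed.

(** Polarisation reduces convergence to four series with nonnegative terms and bounded partial
    sums. *)
Lemma fip_ex x y : exists l, clim (fun N => wsum N (fipw (val x) (val y))) l.
Proof.
pose L t (s : R[i]) := climZ s (fq_clim (t *: y + x)).
have := climD (L 1 4^-1) (climD (L (-1) (- 4^-1)) (climD (L 'i%C ('i%C / 4))
  (L (- 'i%C) (- 'i%C / 4)))).
move=> h; eexists; apply: clim_ext h.
move=> N /=; rewrite -!wsumZ -!wsumD; apply: eq_wsum => w.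
by rewrite -fipw_polar.
Qed.
Definition fip x y := sval (cid (fip_ex x y)).
Lemma fipP x y : clim (fun N => wsum N (fipw (val x) (val y))) (fip x y).
Proof. by rewrite /fip; case: cid. Qed.
Lemma fip_fq x : fip x x = (fq (val x))%:C%C.
Proof. exact: clim_unique (fipP x x) (fq_clim x). Qed.
Lemma fip_lin t x y z : fip (t *: x + y) z = t * fip x z + fip y z.
Proof.
apply: clim_unique (fipP _ _) _.
apply: clim_ext (climD (climZ t (fipP x z)) (fipP y z)) => N.
by rewrite -wsumZ -wsumD; apply: eq_wsum => w; rewrite fipw_lin.
Qed.
Lemma fipC x y : fip x y = (fip y x)^*.
Proof.
apply: clim_unique (fipP _ _) _; apply: clim_ext (climJ (fipP y x)) => N.
rewrite -(wsum_additive (h := fun z : R[i] => z^*)) ?rmorph0 //; last exact: rmorphD.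
by apply: eq_wsum => w; rewrite -fipwC.
Qed.
Lemma wsum_le_fq x N : wsum N (sqw (val x)) <= fq (val x).
Proof.
have [[c xc] _] := fockP x.
apply: sup_upper_bound; last by exists N.
by split; [exists (wsum 0 (sqw (val x))), 0%N|exists c => _ [k _ <-]].
Qed.
Lemma fq_le x (c : R) : fock_bounded (val x) c -> fq (val x) <= c.
Proof.
by move=> h; apply: ge_sup => [|_ [N _ <-]//]; exists (wsum 0 (sqw (val x))), 0%N.
Qed.
Lemma sqw_le_fq x w : sqw (val x) w <= fq (val x).
Proof. by apply: le_trans (wsum_le_fq x (size w).+1); apply: le_wsum => v; exact: sqw_ge0. Qed.
Lemma fip_gt0 x : x != 0 -> 0 < fip x x.
Proof.
move=> x0; rewrite fip_fq ltcR; apply: contraPT x0; rewrite -leNgt => h.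
apply/negP; rewrite negbK; apply/eqP/val_inj/funext => w.
rewrite linear0; apply: hnorm_eq0; apply/eqP; rewrite -sqrf_eq0 eq_le sqr_ge0 andbT.
exact: le_trans (sqw_le_fq x w) h.
Qed.
Lemma fock_complete (u : nat -> fock_carrier) :
  (forall e : R, 0 < e -> exists N, forall p q, (N <= p)%N -> (N <= q)%N ->
     complex.Re (fip (u p - u q) (u p - u q)) < e) ->
  exists x, forall e : R, 0 < e -> exists N, forall k, (N <= k)%N ->
     complex.Re (fip (x - u k) (x - u k)) < e.
Proof.
move=> h.
have sq (y : E) (e : R) : 0 < e -> (hnorm y ^+ 2 < e ^+ 2) = (hnorm y < e).
  by move=> e0; rewrite ltr_pXn2r // nnegrE ?hnorm_ge0 // ltW.
have /choice [a ha] : forall w, exists y : E, forall e : R, 0 < e ->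
    exists N, forall k, (N <= k)%N -> hnorm (y - val (u k) w) < e.
  move=> w; apply: cauchy_hnorm => e e0.
  have [N hN] := h (e ^+ 2) ltac:(by rewrite exprn_gt0).
  exists N => p q Np Nq; rewrite -sq //.
  apply: le_lt_trans (hN p q Np Nq); rewrite fip_fq /=.
  by have := sqw_le_fq (u p - u q) w; rewrite /sqw linearB.
have lim0 w e : 0 < e -> exists Q, forall q, (Q <= q)%N -> sqw (a - val (u q)) w < e.
  move=> e0; have [N hN] := ha w (Num.sqrt e) ltac:(by rewrite sqrtr_gt0).
  by exists N => k Nk; rewrite -[ltRHS](sqr_sqrtr (ltW e0)) sq ?sqrtr_gt0 // hN.
(* For fixed K choose q so large that a - u_q is small on the finitely many words of length below K,
   while u_q - u_p is small uniformly in K. Each part contributes at most 2 (e / 4). *)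
have key e : 0 < e -> exists N, forall p, (N <= p)%N -> fock_bounded (a - val (u p)) e.
  move=> e0; have [N hN] := h (e / 4) ltac:(by rewrite divr_gt0).
  exists N => p Np K.
  have [Q hQ] := wsum_small (F := fun q => sqw (a - val (u q))) lim0 K
     (e := e / 4) ltac:(by rewrite divr_gt0).
  have := hQ (maxn N Q) (leq_maxr _ _); set q := maxn N Q => hq.
  have := hN q p (leq_maxl _ _) Np; rewrite fip_fq /= => hqp.
  have hK := wsum_le_fq (u q - u p) K.
  apply: le_trans (wsum_le K (g := fun w => (cabs 1 ^+ 2) *+ 2 * sqw (a - val (u q)) w
      + 2 * sqw (val (u q - u p)) w) _) _.
    move=> w; rewrite [a - val (u p)](_ : _ = 1 *: (a - val (u q)) + val (u q - u p)).
      exact: sqw_lin.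
    by rewrite scale1r linearB addrA subrK.
  by rewrite wsumD !wsumZ cabs1 expr1n; move: hq hqp hK; lra.
have fa : fock_set a.
  have [N hN] := key 1 ltr01; have [[c uc] us] := fockP (u N).
  have bN := hN N (leqnn N).
  split.
    exists (cabs 1 ^+ 2 *+ 2 * 1 + 2 * c) => K.
    apply: (@le_trans _ _ (wsum K (fun w => (cabs 1 ^+ 2) *+ 2 * sqw (a - val (u N)) w
      + 2 * sqw (val (u N)) w))).
      apply: wsum_le => w; have := sqw_lin 1 (a - val (u N)) (val (u N)) w.
      by rewrite scale1r subrK.
    by rewrite wsumD !wsumZ lerD // ler_wpM2l // mulrn_wge0 // sqr_ge0.
  move=> v i j w; apply/eqP; rewrite -subr_eq0; apply/eqP/hnorm_eq0/eqP.
  rewrite eq_le hnorm_ge0 andbT; apply/ler_addgt0Pr => e e0; rewrite add0r.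
  have [N1 h1] := ha (v ++ [:: i, j & w]) (e / 2) ltac:(by rewrite divr_gt0).
  have [N2 h2] := ha (v ++ [:: j, i & w]) (e / 2) ltac:(by rewrite divr_gt0).
  have := h1 _ (leq_maxl N1 N2); have := h2 _ (leq_maxr N1 N2).
  have [_ ->] := fockP (u (maxn N1 N2)).
  set y := val _ _; move=> h3 h4.
  apply: le_trans (hnorm_triangle y _ _) _; rewrite (hnorm_subC y).
  by rewrite [e]splitr lerD // ltW.
pose y : fock_carrier := exist _ a (mem_set fa).
exists y => e e0.
have [N hN] := key (e / 2) ltac:(by rewrite divr_gt0).
exists N => k Nk; rewrite fip_fq -[complex.Re _]/(fq (val (y - u k))).
apply: (@le_lt_trans _ _ (e / 2)); last by rewrite ltr_pdivrMr // ltr_pMr // ltr1n.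
by apply: fq_le; rewrite linearB; exact: hN.
Qed.

Definition fock_preHilbert := PreHilbert fip_lin fipC fip_gt0 fock_complete.

Lemma fock_ex : {X : hilbertType R & {c : X -> word -> E |
  [/\ forall w, linear (fun f => c f w), forall f, fock_set (c f),
      forall a, fock_set a -> exists f, c f = a, injective c &
      forall f g, clim (fun N => wsum N (fipw (c f) (c g))) (inner f g) /\
        hnorm f ^+ 2 = fq (c f)]}}.
Proof.
pose X := hilbert_of_form fock_preHilbert.
exists X, (fun x => @sval (word -> E) fock_pred x); split.
- by move=> w a x y; exact: (congr1 (@^~ w) (@linearP _ _ _ _ (val : fock_carrier -> _) a x y)).
- exact: fockP.
- by move=> a /mem_set fa; exists (exist _ a fa).
- by move=> x y h; apply: val_inj.
- move=> x y; split; first exact: fipP.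
  by rewrite hnorm_ip -[inner x x]/(fip x x) fip_fq.
Qed.
(* Opaque for the same reason as [sub_hilbert]. *)
Definition fock : hilbertType R := projT1 fock_ex.
Definition fcoef : fock -> word -> E := sval (projT2 fock_ex).
End Fock_carrier.

(** * Neumann series of a strict contraction *)

Section Neumann.
Variables (R : realType) (H : hilbertType R) (B : 'B(H, H)) (c : R).
Hypotheses (c0 : 0 <= c) (c1 : c < 1) (Bc : forall x, hnorm (B x) <= c * hnorm x).

Lemma neumann_bound y : hnorm y <= hnorm (y - B y) / (1 - c).
Proof.
rewrite ler_pdivlMr ?subr_gt0 //; have := Bc y.
have := ler_hnormD (y - B y) (B y); rewrite subrK; lra.
Qed.

Lemma neumann_inj y z : y - B y = z - B z -> y = z.
Proof.
move=> h; apply/eqP; rewrite -subr_eq0; apply/eqP/hnorm_eq0/eqP.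
rewrite eq_le hnorm_ge0 andbT; have := neumann_bound (y - z).
have -> : y - z - B (y - z) = 0.
  have -> : y - z - B (y - z) = (y - B y) - (z - B z).
    by rewrite opB !opprD !opprK addrACA.
  by rewrite h subrr.
by rewrite hnorm0 mul0r.
Qed.

Lemma expr_small (M e : R) : 0 < e -> exists N, forall k, (N <= k)%N -> c ^+ k * M < e.
Proof.
move=> e0; have M1 : 0 < `|M| + 1 by rewrite ltr_wpDl.
have : (fun k => c ^+ k) @ \oo --> (0 : R) by apply: cvg_expr; rewrite ger0_norm.
move=> /cvgrPdist_lt /(_ (e / (`|M| + 1))) []; first by rewrite divr_gt0.
move=> N _ hN; exists N => k /hN /=; rewrite sub0r normrN ger0_norm ?exprn_ge0 //.
rewrite ltr_pdivlMr // => h; apply: le_lt_trans h.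
by rewrite ler_wpM2l ?exprn_ge0 // (le_trans (ler_norm M)) // lerDl.
Qed.

Lemma neumann_ex f : exists y, y - B y = f.
Proof.
pose u := fix u k := if k is k'.+1 then f + B (u k') else 0.
(* M is the solution of |f| + c M = M and therefore bounds all iterates u_k. *)
pose M := hnorm f / (1 - c); have d0 : 0 < 1 - c by rewrite subr_gt0.
have ME : hnorm f + c * M = M.
  by rewrite -[hnorm f in LHS](divfK (lt0r_neq0 d0)) -/M; ring.
have uM k : hnorm (u k) <= M.
  elim: k => [|k IH] /=; first by rewrite hnorm0 divr_ge0 ?hnorm_ge0 // ltW.
  apply: le_trans (ler_hnormD _ _) _; rewrite -ME lerD2l.
  by apply: le_trans (Bc _) _; rewrite ler_wpM2l.
have uk k m : hnorm (u (k + m)%N - u k) <= c ^+ k * M.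
  elim: k => [|k IH]; first by rewrite add0n /= subr0 expr0 mul1r.
  rewrite addSn /= opprD addrACA subrr add0r -opB.
  by apply: le_trans (Bc _) _; rewrite exprS -mulrA ler_wpM2l.
have [|y hy] := @cauchy_hnorm R H u.
  move=> e e0; have [N hN] := expr_small M (e := e / 2) ltac:(by rewrite divr_gt0).
  have h := hN N (leqnn N).
  exists N => p q /subnKC <- /subnKC <-.
  have h1 := uk N (p - N)%N; have h2 := uk N (q - N)%N.
  apply: le_lt_trans (hnorm_triangle (u N) _ _) _; rewrite (hnorm_subC (u N)).
  by rewrite [ltRHS]splitr ltrD // (le_lt_trans _ h).
exists y; apply/eqP; rewrite subr_eq -subr_eq0; apply/eqP/hnorm_eq0/eqP.
rewrite eq_le hnorm_ge0 andbT; apply/ler_addgt0Pr => e e0; rewrite add0r.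
have [N hN] := hy (e / 2) ltac:(by rewrite divr_gt0).
apply: le_trans (hnorm_triangle (u N.+1) _ _) _; rewrite [e]splitr lerD //.
  by apply/ltW/hN; exact: leqW.
rewrite /= opprD addrACA subrr add0r -opB.
apply: le_trans (Bc _) _; rewrite hnorm_subC; apply: le_trans (ltW (hN N (leqnn N))).
by rewrite ler_piMl ?hnorm_ge0 // ltW.
Qed.
End Neumann.

(** * Backward shifts, kernels and constants in the Fock space *)

Section Fock_operators.
Variables (R : realType) (n : nat) (E : hilbertType R).
Local Notation X := (fock n E).
Local Notation word := (seq 'I_n).
Implicit Types x y : X.

Lemma fcoef_lin w : linear (fun x => fcoef x w).
Proof. by rewrite /fcoef; case: (projT2 _) => c []. Qed.
Lemma fcoef_mem x : fock_set (fcoef x).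
Proof. by rewrite /fcoef; case: (projT2 _) => c []. Qed.
Lemma fcoef_sym x : wsym (fcoef x).
Proof. by have [] := fcoef_mem x. Qed.
Lemma fcoef_bounded x : exists c : R, fock_bounded (fcoef x) c.
Proof. by have [] := fcoef_mem x. Qed.
Lemma fcoefI x y : (forall w, fcoef x w = fcoef y w) -> x = y.
Proof.
move=> /funext; rewrite /fcoef; case: (projT2 _) => c [_ _ _ inj _] /=; exact: inj.
Qed.
Lemma mkfock (a : word -> E) : fock_set a -> exists x, forall w, fcoef x w = a w.
Proof.
rewrite /fcoef; case: (projT2 _) => c [_ _ onto _ _] /= /onto [x <-]; by exists x.
Qed.
Lemma fcoef_ip x y : clim (fun N => wsum N (fipw (fcoef x) (fcoef y))) (inner x y).
Proof. by have [_ _ _ _ /(_ x y) []] := svalP (projT2 (fock_ex n E)). Qed.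
Lemma hnorm_fq x : hnorm x ^+ 2 = fq (fcoef x).
Proof. by have [_ _ _ _ /(_ x x) []] := svalP (projT2 (fock_ex n E)). Qed.
Lemma fock_hnorm_le x (c : R) : fock_bounded (fcoef x) c -> hnorm x ^+ 2 <= c.
Proof.
move=> h; rewrite hnorm_fq; apply: ge_sup => [|_ [N _ <-]//].
by exists (wsum 0 (sqw (fcoef x))), 0%N.
Qed.
Lemma wsum_le_hnorm x N : wsum N (sqw (fcoef x)) <= hnorm x ^+ 2.
Proof.
have [c xc] := fcoef_bounded x; rewrite hnorm_fq.
apply: sup_upper_bound; last by exists N.
by split; [exists (wsum 0 (sqw (fcoef x))), 0%N|exists c => _ [k _ <-]].
Qed.
Lemma hnorm_fcoef x w : hnorm (fcoef x w) <= hnorm x.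
Proof.
apply: hnorm_le; rewrite ?hnorm_ge0 //.
apply: le_trans (wsum_le_hnorm x (size w).+1).
by apply: (@le_wsum _ _ (sqw (fcoef x))) => v; exact: sqw_ge0.
Qed.
Lemma fcoef_bd w : exists c : R, forall x, hnorm (fcoef x w) <= c * hnorm x.
Proof. by exists 1 => x; rewrite mul1r hnorm_fcoef. Qed.
Definition coef_op w : 'B(X, E) := mkop (fcoef_lin w) (fcoef_bd w).
Arguments coef_op : simpl never.
Lemma fcoef0 w : fcoef (0 : X) w = 0. Proof. exact: (op0 (coef_op w)). Qed.

Lemma bshift_ex i x : exists y, forall w, fcoef y w = fcoef x (i :: w).
Proof.
apply: mkfock; split.
  have [c xc] := fcoef_bounded x; exists c => N; apply: le_trans (xc N.+1).
  by apply: wsum_cons_le => w; exact: sqw_ge0.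
by move=> u j k v; exact: (fcoef_sym x (i :: u)).
Qed.
Definition bshiftf i x : X := sval (cid (bshift_ex i x)).
Lemma bshiftfE i x w : fcoef (bshiftf i x) w = fcoef x (i :: w).
Proof. by rewrite /bshiftf; case: cid. Qed.
Lemma bshift_lin i : linear (bshiftf i).
Proof. by move=> a x y; apply: fcoefI => w; rewrite !(bshiftfE, fcoef_lin). Qed.
Lemma bshift_bd i : exists c : R, forall x, hnorm (bshiftf i x) <= c * hnorm x.
Proof.
exists 1 => x; rewrite mul1r; apply: hnorm_le; rewrite ?hnorm_ge0 //.
apply: fock_hnorm_le => N; apply: le_trans (wsum_le_hnorm x N.+1).
rewrite (@eq_wsum _ _ _ _ (fun w => sqw (fcoef x) (i :: w))); last first.
  by move=> w; rewrite /sqw bshiftfE.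
by apply: wsum_cons_le => w; exact: sqw_ge0.
Qed.
Definition bshift i : 'B(X, X) := mkop (bshift_lin i) (bshift_bd i).
Arguments bshift : simpl never.
Lemma fcoef_bshift i x w : fcoef (bshift i x) w = fcoef x (i :: w).
Proof. exact: bshiftfE. Qed.
Lemma bshiftC i j x : bshift i (bshift j x) = bshift j (bshift i x).
Proof. by apply: fcoefI => w; rewrite !fcoef_bshift; exact: (fcoef_sym x [::]). Qed.

(** Words are sorted by their first letter. This recursion takes the place of the series in what
    follows. *)
Lemma fock_ipE x y : inner x y =
  inner (fcoef x [::]) (fcoef y [::]) + \sum_i inner (bshift i x) (bshift i y).
Proof.
have h := clim_shift (fcoef_ip x y).
apply: (clim_unique h); apply: (@clim_ext _ (fun N =>
  inner (fcoef x [::]) (fcoef y [::]) +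
  \sum_(i <- index_enum 'I_n) wsum N (fipw (fcoef (bshift i x)) (fcoef (bshift i y))))).
  move=> N /=; congr (_ + _); apply: eq_bigr => i _; apply: eq_wsum => w.
  by rewrite /fipw !fcoef_bshift.
apply: climD; first exact: clim_cst.
by apply: clim_sum => i; exact: fcoef_ip.
Qed.

Lemma fock_hnormE x :
  hnorm x ^+ 2 = hnorm (fcoef x [::]) ^+ 2 + \sum_i hnorm (bshift i x) ^+ 2.
Proof.
rewrite hnorm_ip fock_ipE ReD -hnorm_ip Re_sum; congr (_ + _).
by apply: eq_bigr => i _; rewrite -hnorm_ip.
Qed.

Definition wmon (z : 'rV[R[i]]_n) (w : word) : R[i] := \prod_(i <- w) z 0 i.

Lemma sum_cabs2 (z : 'rV[R[i]]_n) : (\sum_i cabs (z 0 i) ^+ 2)%:C%C = cdot z z.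
Proof.
rewrite raddf_sum; apply: eq_bigr => i _ /=.
by rewrite -[(_ ^+ 2)%:C%C]/((cabs (z 0 i) ^+ 2)%:C%C) cabsX2.
Qed.
Lemma ballP (z : 'rV[R[i]]_n) : unit_ball z <-> \sum_i cabs (z 0 i) ^+ 2 < 1.
Proof. by rewrite /unit_ball /= -sum_cabs2 ltcR. Qed.

Lemma fker_ex (z : 'rV[R[i]]_n) (e : E) : unit_ball z ->
  exists x, forall w, fcoef x w = (wmon z w)^* *: e.
Proof.
move=> /ballP zb; apply: mkfock; split; last first.
  move=> u i j v; congr (_^* *: _); rewrite /wmon !big_cat !big_cons /=.
  by rewrite (mulrCA (z 0 i)).
set r := \sum_i _ in zb; have d0 : 0 < 1 - r by rewrite subr_gt0.
exists (hnorm e ^+ 2 / (1 - r)) => N.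
(* The scalar s collects the monomial of the letters already split off, as the induction on N
   requires. *)
suff h (s : R[i]) : wsum N (sqw (fun w => (s * wmon z w)^* *: e))
    <= cabs s ^+ 2 * (hnorm e ^+ 2 / (1 - r)).
  have := h 1; rewrite cabs1 expr1n mul1r.
  by under [X in wsum N (sqw X)]funext do rewrite mul1r.
elim: N s => [|N IH] s /=.
  by rewrite mulr_ge0 ?divr_ge0 ?sqr_ge0 // ltW.
set M := hnorm e ^+ 2 / (1 - r).
have ME : M = hnorm e ^+ 2 + r * M.
  by rewrite -[hnorm e ^+ 2](divfK (lt0r_neq0 d0)) -/M; ring.
rewrite [leRHS](_ : _ = cabs s ^+ 2 * hnorm e ^+ 2 + \sum_i (cabs (s * z 0 i) ^+ 2 * M)).
  rewrite /sqw /wmon big_nil mulr1 hnormZ cabsJ exprMn lerD2l.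
  apply: ler_sum => i _; have := IH (s * z 0 i); rewrite -/M => h.
  apply: le_trans h; rewrite le_eqVlt; apply/orP; left; apply/eqP.
  by apply: eq_wsum => w; rewrite /sqw /wmon big_cons mulrA.
rewrite {1}ME mulrDr; congr (_ + _); rewrite mulrA mulr_sumr mulr_suml.
by apply: eq_bigr => i _; rewrite cabsM exprMn.
Qed.
Definition fker (z : 'rV[R[i]]_n) (e : E) (zb : unit_ball z) : X :=
  sval (cid (fker_ex e zb)).
Lemma fcoef_fker z e (zb : unit_ball z) w : fcoef (fker e zb) w = (wmon z w)^* *: e.
Proof. by rewrite /fker; case: cid. Qed.
(** Kernels are joint eigenvectors of the backward shifts; their values, the reproducing property
    and the formula for M_z all rest on this. *)
Lemma bshift_fker z e (zb : unit_ball z) i :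
  bshift i (fker e zb) = (z 0 i)^* *: fker e zb.
Proof.
apply: fcoefI => w; rewrite fcoef_bshift -[fcoef (_ *: _) _]/((coef_op w) _) opZ.
by rewrite [coef_op w _]fcoef_fker fcoef_fker /wmon big_cons scalerA rmorphM.
Qed.

Lemma fcst_ex (e : E) : exists x, forall w, fcoef x w = if w is [::] then e else 0.
Proof.
apply: mkfock; split; last first.
  by move=> [|k u] i j v.
exists (hnorm e ^+ 2) => -[|N] /=; first exact: sqr_ge0.
rewrite big1 ?addr0 // => i _.
rewrite (@eq_wsum _ _ _ _ (fun _ => 0 * 0)) ?wsumZ ?mul0r // => w.
by rewrite /sqw hnorm0 expr0n.
Qed.
Definition fcstf (e : E) : X := sval (cid (fcst_ex e)).
Lemma fcoef_fcstf e w : fcoef (fcstf e) w = if w is [::] then e else 0.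
Proof. by rewrite /fcstf; case: cid. Qed.
Lemma bshift_fcstf e i : bshift i (fcstf e) = 0.
Proof.
by apply: fcoefI => w; rewrite fcoef_bshift fcoef_fcstf fcoef0.
Qed.
Lemma fcstf_lin : linear fcstf.
Proof.
by move=> a e f; apply: fcoefI => -[|i w]; rewrite fcoef_lin !fcoef_fcstf ?scaler0 ?addr0.
Qed.
Lemma fcstf_hnorm e : hnorm (fcstf e) = hnorm e.
Proof.
apply/eqP; rewrite -(@eqrXn2 _ 2) ?hnorm_ge0 // fock_hnormE fcoef_fcstf.
by rewrite big1 ?addr0 // => i _; rewrite bshift_fcstf hnorm0 expr0n.
Qed.
Lemma fcstf_bd : exists c : R, forall e, hnorm (fcstf e) <= c * hnorm e.
Proof. by exists 1 => e; rewrite mul1r fcstf_hnorm. Qed.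
Definition fcst : 'B(E, X) := mkop fcstf_lin fcstf_bd.
Arguments fcst : simpl never.
Lemma bshift_fcst e i : bshift i (fcst e) = 0. Proof. exact: bshift_fcstf. Qed.
Lemma fcst_ipr x e : inner x (fcst e) = inner (fcoef x [::]) e.
Proof.
rewrite fock_ipE [fcoef (fcst e) _]fcoef_fcstf big1 ?addr0 // => i _.
by rewrite bshift_fcst ip0r.
Qed.
Lemma fcoef_fcst0 e : fcoef (fcst e) [::] = e. Proof. by rewrite [LHS]fcoef_fcstf. Qed.

Definition fshift i : 'B(X, X) := adj (bshift i).
Lemma fshiftP i x y : inner (fshift i x) y = inner x (bshift i y).
Proof. exact: adjPl. Qed.

Definition brow_f (z : 'rV[R[i]]_n) x : X := \sum_i z 0 i *: bshift i x.
Lemma brow_lin z : linear (brow_f z).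
Proof.
move=> a x y; rewrite /brow_f scaler_sumr -big_split; apply: eq_bigr => i _.
by rewrite opP scalerDr !scalerA mulrC.
Qed.

Lemma sum_cauchy_schwarz (I : finType) (a b : I -> R) :
  (\sum_i a i * b i) ^+ 2 <= (\sum_i a i ^+ 2) * (\sum_i b i ^+ 2).
Proof.
rewrite expr2 !mulr_suml -subr_ge0 -sumrB.
under eq_bigr do rewrite !mulr_sumr -sumrB.
(* Lagrange's identity: twice the difference is the double sum of (a_i b_j - a_j b_i)^2. *)
rewrite -(pmulr_lge0 _ (ltr0Sn R 1)) mulr2n mulrDr mulr1.
rewrite {2}exchange_big /= -big_split /=; apply: sumr_ge0 => i _.
rewrite -big_split /=; apply: sumr_ge0 => j _.
have := sqr_ge0 (a i * b j - a j * b i); lra.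
Qed.

(** The column of all B_i is a contraction by [fock_hnormE]. Hence sum_i z_i B_i is a strict
    contraction for z in the ball and the Neumann series applies. *)
Lemma brow_hnorm z x : hnorm (brow_f z x) <= Num.sqrt (\sum_i cabs (z 0 i) ^+ 2) * hnorm x.
Proof.
apply: (@le_trans _ _ (\sum_i cabs (z 0 i) * hnorm (bshift i x))).
  rewrite /brow_f; elim/big_ind2: _ => [|a b c d h1 h2|i _]; first by rewrite hnorm0.
    by apply: le_trans (ler_hnormD _ _) _; exact: lerD.
  by rewrite hnormZ.
have s0 : 0 <= \sum_i cabs (z 0 i) ^+ 2 by apply: sumr_ge0 => i _; exact: sqr_ge0.
rewrite -(@ler_pXn2r _ 2) // ?nnegrE ?mulr_ge0 ?hnorm_ge0 ?sqrtr_ge0 //; last first.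
  by apply: sumr_ge0 => i _; rewrite mulr_ge0 ?cabs_ge0 ?hnorm_ge0.
apply: le_trans (sum_cauchy_schwarz _ _) _.
rewrite exprMn sqr_sqrtr // ler_wpM2l // fock_hnormE lerDr; exact: sqr_ge0.
Qed.
Lemma brow_bd z : exists c : R, forall x, hnorm (brow_f z x) <= c * hnorm x.
Proof. by eexists; exact: brow_hnorm. Qed.
Definition brow z : 'B(X, X) := mkop (brow_lin z) (brow_bd z).
Arguments brow : simpl never.

(** The Euclidean norm; the norm that row vectors carry, and that differentiability refers to, is
    the maximum norm. *)
Definition rad (z : 'rV[R[i]]_n) : R := Num.sqrt (\sum_i cabs (z 0 i) ^+ 2).
Lemma rad_ge0 z : 0 <= rad z. Proof. exact: sqrtr_ge0. Qed.
Lemma rad_lt1 z : unit_ball z <-> rad z < 1.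
Proof. by rewrite ballP /rad -[1 in X in _ <-> X]sqrtr1 ltr_sqrt. Qed.
Lemma brow_rad z x : hnorm (brow z x) <= rad z * hnorm x.
Proof. exact: brow_hnorm. Qed.
End Fock_operators.
Arguments coef_op {R n E} w : simpl never.
Arguments bshift {R n E} i : simpl never.
Arguments fcst {R} n {E} : simpl never.
Arguments fshift {R n E} i : simpl never.
Arguments brow {R n E} z : simpl never.

Lemma differentiable_quadratic (K : numFieldType) (V W : normedModType K)
    (f : V -> W) (df : {linear V -> W}) (z : V) (M C d : K) :
  0 <= M -> 0 <= C -> 0 < d -> (forall h, `|df h| <= M * `|h|) ->
  (forall h, `|h| < d -> `|f (h + z) - (f z + df h)| <= C * `|h| ^+ 2) ->
  differentiable f z.
Proof.
move=> M0 C0 d0 hM hC.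
have dc : continuous df.
  apply/linear_bounded_continuous/linear_boundedP.
  exists M; split; first exact: ger0_real.
  by move=> r rM h; apply: le_trans (hM h) _; rewrite ler_wpM2r // ltW.
have exp : f \o shift z = cst (f z) + df +o_ (0 : V) id.
  apply/eqaddoP => e e0; have C1 : 0 < C + 1 by rewrite ltr_wpDl.
  (* This radius is below both d and e / (C + 1); a minimum is avoided since the order of K is only
     partial. *)
  apply/nbhs_ballP; exists (d * (e / (C + 1)) / (d + e / (C + 1))).
    rewrite /=; apply: divr_gt0; [apply: mulr_gt0|apply: addr_gt0] => //; exact: divr_gt0.
  move=> h; rewrite -ball_normE /= sub0r normrN => hd.
  have ec : 0 < e / (C + 1) by rewrite divr_gt0.
  have s0 : 0 < d + e / (C + 1) by rewrite addr_gt0.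
  have hd1 : `|h| < d.
    apply: lt_trans hd _; rewrite ltr_pdivrMr // ltr_pM2l //.
    by rewrite ltrDr.
  have hd2 : `|h| < e / (C + 1).
    apply: lt_trans hd _; rewrite ltr_pdivrMr // mulrC ltr_pM2l //.
    by rewrite ltrDl.
  apply: le_trans (hC h hd1) _; rewrite expr2 mulrA ler_wpM2r //.
  move: hd2; rewrite ltr_pdivlMr // => /ltW; apply: le_trans.
  by rewrite mulrC ler_wpM2l // lerDl.
by apply/diff_locallyP; rewrite (diff_unique dc exp); split.
Qed.

(** * The Fock space as a space of analytic functions *)

Section Fock_DruryArveson.
Variables (R : realType) (n : nat) (E : hilbertType R).
Local Notation X := (fock n E).
Implicit Types (x y f : X) (z w : 'rV[R[i]]_n) (e : E).

(** The resolvent (1 - sum_i z_i B_i)^-1 f. It is total in z: where the equation has no solution,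
    which can happen only outside the ball, the value is 0. *)
Definition fres_fun (z : 'rV[R[i]]_n) (f : X) : X :=
  xget 0 [set y | y - brow z y = f].

Section In_ball.
Variable z : 'rV[R[i]]_n.
Hypothesis zb : unit_ball z.
Let r1 : rad z < 1. Proof. exact/rad_lt1. Qed.

Lemma fresP f : fres_fun z f - brow z (fres_fun z f) = f.
Proof.
rewrite /fres_fun; case: xgetP => [y -> //|h].
by have [y hy] := neumann_ex (rad_ge0 z) r1 (@brow_rad _ _ E z) f; case: (h y).
Qed.
Lemma fres_unique f y : y - brow z y = f -> fres_fun z f = y.
Proof.
move=> h; apply: (neumann_inj r1 (@brow_rad _ _ E z)).
by rewrite fresP h.
Qed.
Lemma fres_lin : linear (fres_fun z).
Proof.
move=> a f g; apply: fres_unique.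
by rewrite opP opprD addrACA -scalerBr !fresP.
Qed.
Lemma fres_hnorm f : hnorm (fres_fun z f) <= (1 - rad z)^-1 * hnorm f.
Proof.
have := neumann_bound r1 (@brow_rad _ _ E z) (fres_fun z f).
by rewrite fresP mulrC.
Qed.
Lemma fres_bd : exists c : R, forall f, hnorm (fres_fun z f) <= c * hnorm f.
Proof. by eexists; exact: fres_hnorm. Qed.
Definition fres : 'B(X, X) := mkop fres_lin fres_bd.
Arguments fres : simpl never.
End In_ball.

Lemma fresE z (zb : unit_ball z) f : fres zb f = fres_fun z f. Proof. by []. Qed.

Lemma browC z w f : brow z (brow w f) = brow w (brow z f).
Proof.
rewrite [LHS]mkopE [RHS]mkopE /brow_f.
under eq_bigr do rewrite [brow w f]mkopE /brow_f op_sum scaler_sumr.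
under [RHS]eq_bigr do rewrite [brow z f]mkopE /brow_f op_sum scaler_sumr.
rewrite exchange_big; apply: eq_bigr => i _; apply: eq_bigr => j _.
by rewrite !opZ !scalerA mulrC bshiftC.
Qed.


Lemma fres_commute z (zb : unit_ball z) (A : 'B(X, X)) f :
  (forall g, brow z (A g) = A (brow z g)) -> fres zb (A f) = A (fres zb f).
Proof. by move=> h; apply: fres_unique => //; rewrite h -opB [_ - _]fresP. Qed.


Lemma browB z w f : brow (z - w) f = brow z f - brow w f.
Proof.
rewrite !mkopE /brow_f -sumrB; apply: eq_bigr => i _.
by rewrite !mxE scalerBl.
Qed.

Lemma resolvent z w (zb : unit_ball z) (wb : unit_ball w) f :
  fres wb f - fres zb f = fres wb (brow (w - z) (fres zb f)).
Proof.
apply/esym/fres_unique => //; rewrite opB browB.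
have h1 := fresP wb f; have h2 := fresP zb f; move: h1 h2.
rewrite -!fresE; set u := fres wb f; set v := fres zb f => h1 h2.
have -> : u - v - (brow w u - brow w v) = (u - brow w u) - (v - brow w v).
  by rewrite !opprD !opprK addrACA.
by rewrite h1 -[f]h2 opprB addrC subrKA.
Qed.

(* The sum of the z^w f_w, in the form ((1 - sum_i z_i B_i)^-1 f)_[::]. *)
Definition feval (f : X) z : E := fcoef (fres_fun z f) [::].

Lemma feval_lin a f g z : unit_ball z -> feval (a *: f + g) z = a *: feval f z + feval g z.
Proof. by move=> zb; rewrite /feval fres_lin // fcoef_lin. Qed.

Lemma brow_fker z w e (wb : unit_ball w) : brow z (fker e wb) = cdot z w *: fker e wb.
Proof.
rewrite mkopE /brow_f /cdot scaler_suml; apply: eq_bigr => i _.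
by rewrite bshift_fker scalerA.
Qed.

Lemma cdot_lt1 z w : unit_ball z -> unit_ball w -> 1 - cdot z w != 0.
Proof.
move=> /ballP zb /ballP wb; rewrite subr_eq0; apply/eqP => h.
have c1 : cabs (cdot z w) = 1 by rewrite -h cabs1.
have : cabs (cdot z w) <= \sum_i cabs (z 0 i) * cabs (w 0 i).
  rewrite /cdot; elim/big_ind2: _ => [|a b c d h1 h2|i _]; first by rewrite cabs0.
    by apply: le_trans (cabsD _ _) _; exact: lerD.
  by rewrite cabsM cabsJ.
rewrite c1; set s := \sum_i _ => s1.
have := sum_cauchy_schwarz (fun i => cabs (z 0 i)) (fun i => cabs (w 0 i)).
rewrite -/s => h2.
have : 1 <= s ^+ 2 by rewrite exprn_ege1.
have zge : 0 <= \sum_i cabs (z 0 i) ^+ 2 by apply: sumr_ge0 => i _; exact: sqr_ge0.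
move: h2 zb wb; nra.
Qed.

Lemma feval_fker z w e (wb : unit_ball w) : unit_ball z ->
  feval (fker e wb) z = (1 - cdot z w)^-1 *: e.
Proof.
move=> zb; have cd := cdot_lt1 zb wb.
rewrite /feval (@fres_unique _ zb _ ((1 - cdot z w)^-1 *: fker e wb)).
  rewrite -[fcoef _ _]/(coef_op [::] _) opZ [coef_op _ _]fcoef_fker.
  by rewrite /wmon big_nil rmorph1 scale1r.
rewrite opZ brow_fker -scalerBr -[X in _ *: (X - _)]scale1r -scalerBl.
by rewrite scalerA mulVf // scale1r.
Qed.

(** With f = y - sum_i w_i B_i y, the eigenvector property and [fock_ipE] cancel everything but the
    term of the empty word. *)
Lemma fker_ip w e (wb : unit_ball w) f : inner f (fker e wb) = inner (feval f w) e.
Proof.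
rewrite -[in LHS](fresP wb f) ipBl /feval; set y := fres_fun w f.
rewrite fock_ipE fcoef_fker /wmon big_nil rmorph1 scale1r -addrA.
rewrite [X in _ + X](_ : _ = 0) ?addr0 //; apply/eqP; rewrite subr_eq0; apply/eqP.
rewrite mkopE /brow_f ip_suml; apply: eq_bigr => i _.
by rewrite bshift_fker ipZr conjCK ipZl.
Qed.

Lemma feval_fshift i f z : unit_ball z -> feval (fshift i f) z = z 0 i *: feval f z.
Proof.
move=> zb; apply: ip_inj => e; rewrite -(fker_ip e zb) fshiftP bshift_fker.
by rewrite ipZr conjCK (fker_ip e zb) ipZl.
Qed.

Lemma rad_triangle z w : rad (z + w) <= rad z + rad w.
Proof.
have s0 (v : 'rV[R[i]]_n) : 0 <= \sum_i cabs (v 0 i) ^+ 2.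
  by apply: sumr_ge0 => i _; exact: sqr_ge0.
have r2 (v : 'rV[R[i]]_n) : rad v ^+ 2 = \sum_i cabs (v 0 i) ^+ 2.
  by rewrite sqr_sqrtr.
rewrite -(@ler_pXn2r _ 2) // ?nnegrE ?addr_ge0 ?rad_ge0 //.
pose t := \sum_i cabs (z 0 i) * cabs (w 0 i).
have tle : t <= rad z * rad w.
  rewrite -(@ler_pXn2r _ 2) // ?nnegrE ?mulr_ge0 ?rad_ge0 //.
    by rewrite exprMn !r2; exact: sum_cauchy_schwarz.
  by apply: sumr_ge0 => i _; rewrite mulr_ge0 ?cabs_ge0.
have : rad (z + w) ^+ 2 <= rad z ^+ 2 + t *+ 2 + rad w ^+ 2.
  rewrite !r2 /t -sumrMnl -!big_split; apply: ler_sum => i _.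
  rewrite mxE; apply: (@le_trans _ _ ((cabs (z 0 i) + cabs (w 0 i)) ^+ 2)).
    by rewrite ler_pXn2r ?nnegrE ?addr_ge0 ?cabs_ge0 ?cabsD.
  by rewrite sqrrD.
move=> /le_trans; apply; rewrite sqrrD; lra.
Qed.

Lemma radZ a z : rad (a *: z) = cabs a * rad z.
Proof.
rewrite /rad -[cabs a in RHS]ger0_norm ?cabs_ge0 // -sqrtr_sqr -sqrtrM ?sqr_ge0 //.
by rewrite mulr_sumr; congr Num.sqrt; apply: eq_bigr => i _; rewrite mxE cabsM exprMn.
Qed.

Lemma brow_iter_fres z (zb : unit_ball z) h k f :
  brow h (iter k (fres zb) f) = iter k (fres zb) (brow h f).
Proof.
elim: k => // k IH; rewrite !iterS -IH.
by rewrite (fres_commute zb (A := brow h)) // => g; exact: browC.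
Qed.

(** First-order expansion of the k-th power of the resolvent. The case k = 1 gives analyticity;
    higher powers recover the coefficients of f from its values. *)
Lemma fres_deriv z (zb : unit_ball z) (rho : R) f k : rad z <= rho -> rho < 1 ->
  exists2 C : R, 0 <= C & forall w (wb : unit_ball w), rad w <= rho ->
    hnorm (iter k (fres wb) f - iter k (fres zb) f
           - k%:R *: iter k.+1 (fres zb) (brow (w - z) f)) <= C * rad (w - z) ^+ 2.
Proof.
move=> zr r1; pose M := (1 - rho)^-1.
have M0 : 0 <= M by rewrite invr_ge0 subr_ge0 ltW.
have RM w (wb : unit_ball w) y : rad w <= rho -> hnorm (fres wb y) <= M * hnorm y.
  move=> wr; apply: le_trans (fres_hnorm wb y) _.
  rewrite ler_wpM2r ?hnorm_ge0 // lef_pV2 ?posrE ?subr_gt0 ?lerD2l ?lerN2 //.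
  exact: le_lt_trans wr r1.
elim: k => [|k [C C0 hC]].
  by exists 0 => // w wb _; rewrite /= subrr scale0r subr0 hnorm0 mul0r.
pose K := hnorm (iter k.+1 (fres zb) f).
have K0 : 0 <= K by exact: hnorm_ge0.
(* M * C comes from one more resolvent applied to the remainder for k, the second term from k + 1
   copies of the difference of the two resolvents at c. *)
exists (M * C + M * M * K * k.+1%:R); first by rewrite addr_ge0 // ?mulr_ge0 // mulr_ge0.
move=> w wb wr; set d := rad (w - z); have d0 : 0 <= d by exact: rad_ge0.
pose a := iter k (fres wb) f; pose b := iter k (fres zb) f.
pose c := iter k.+1 (fres zb) (brow (w - z) f).
have diff y : hnorm (fres wb y - fres zb y) <= M * (d * (M * hnorm y)).
  rewrite (resolvent zb); apply: le_trans (RM _ wb _ wr) _; rewrite ler_wpM2l //.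
  by apply: le_trans (brow_rad _ _) _; rewrite ler_wpM2l // RM.
have cE : c = brow (w - z) (iter k.+1 (fres zb) f) by rewrite brow_iter_fres.
have cK : hnorm c <= d * K by rewrite cE; exact: brow_rad.
(* Writing R_w and R_z for the resolvents, the resolvent identity gives R_w b - R_z b = R_w c. *)
have -> : iter k.+1 (fres wb) f - iter k.+1 (fres zb) f
    - k.+1%:R *: iter k.+2 (fres zb) (brow (w - z) f)
  = fres wb (a - b - k%:R *: c) + (k.+1%:R *: (fres wb c - fres zb c)).
  have h : fres wb b - fres zb b = fres wb c by rewrite (resolvent zb) cE.
  rewrite -[iter k.+1 (fres wb) f]/(fres wb a) -[iter k.+1 (fres zb) f]/(fres zb b).
  rewrite -[iter k.+2 (fres zb) _]/(fres zb c) !opB opZ.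
  rewrite [X in X - _ = _](_ : _ = fres wb a - fres wb b + fres wb c); last first.
    by rewrite -h subrKA.
  rewrite scalerBr -natr1 scalerDl scale1r -!addrA; congr (_ + (_ + _)).
  by rewrite scalerDl scale1r -addrA addKr.
apply: le_trans (ler_hnormD _ _) _; rewrite mulrDl lerD //.
  by apply: le_trans (RM _ wb _ wr) _; rewrite -mulrA ler_wpM2l // hC.
rewrite hnormZ cabs_nat.
rewrite mulrAC [leRHS]mulrC ler_wpM2l //; apply: le_trans (diff c) _.
have -> : M * M * K * d ^+ 2 = M * (d * (M * (d * K))) by ring.
by rewrite !ler_wpM2l.
Qed.

Lemma linear_le_quadratic (a C r : R) : 0 < r -> 0 <= a ->
  (forall t, 0 < t -> t <= r -> t * a <= C * t ^+ 2) -> a = 0.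
Proof.
move=> r0 a0 h; apply/eqP; rewrite eq_le a0 andbT; apply/ler_addgt0Pr => e e0.
rewrite add0r; have C1 : 0 < `|C| + 1 by rewrite ltr_wpDl.
pose t := Num.min r (e / (`|C| + 1)).
have t0 : 0 < t by rewrite lt_min r0 divr_gt0.
have tr : t <= r by rewrite ge_min lexx.
have te : t * (`|C| + 1) <= e by rewrite -ler_pdivlMr // ge_min lexx orbT.
have := h t t0 tr; rewrite expr2 mulrCA ler_pM2l // => /le_trans; apply.
apply: le_trans te; rewrite mulrC ler_pM2l // (le_trans (ler_norm C)) //.
by rewrite lerDl.
Qed.

Lemma room z : unit_ball z -> exists2 r : R, 0 < r &
  forall h, rad h <= r -> rad (h + z) <= (1 + rad z) / 2 /\ unit_ball (h + z).
Proof.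
move=> /rad_lt1 z1; exists ((1 - rad z) / 2); first by rewrite divr_gt0 ?subr_gt0.
move=> h hr; have := rad_triangle h z => tr.
by split; [lra|apply/rad_lt1; lra].
Qed.

(* The derivative of (1 - sum_i z_i B_i)^-k f in the direction e_i is
   k (1 - sum_i z_i B_i)^-(k+1) B_i f; hence all coefficients of a function
   vanishing on the ball are zero. *)
Lemma coef_iter_fres_step k f i :
  (forall z (zb : unit_ball z), fcoef (iter k.+1 (fres zb) f) [::] = 0) ->
  forall z (zb : unit_ball z), fcoef (iter k.+2 (fres zb) (bshift i f)) [::] = 0.
Proof.
move=> h z zb; have [r r0 hr] := room zb.
have z1 : rad z < 1 by exact/rad_lt1.
have z2 : rad z <= (1 + rad z) / 2 by lra.
have z3 : (1 + rad z) / 2 < 1 by lra.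
have [C C0 hC] := @fres_deriv z zb _ f k.+1 z2 z3.
apply: hnorm_eq0; set y := iter k.+2 _ _.
apply: (@linear_le_quadratic _ (C / k.+1%:R) r r0 (hnorm_ge0 _)) => t t0 tr.
pose v : 'rV[R[i]]_n := t%:C%C *: delta_mx 0 i.
have vr : rad v = t.
  rewrite radZ cabsR ?ltW // /rad (bigD1 i) //= mxE !eqxx big1 => [|j ji].
    by rewrite addr0 cabs1 expr1n sqrtr1 mulr1.
  by rewrite mxE (negPf ji) andbF cabs0 expr0n.
have [|wr wb] := hr v; first by rewrite vr.
have bv : brow v f = t%:C%C *: bshift i f.
  rewrite mkopE /brow_f (bigD1 i) //= big1 => [|j ji].
    by rewrite !mxE !eqxx addr0 mulr1.
  by rewrite !mxE (negPf ji) andbF mulr0 scale0r.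
have := hC _ wb wr; rewrite addrK vr bv => le.
have itZ j (a : R[i]) g : iter j (fres zb) (a *: g) = a *: iter j (fres zb) g.
  by elim: j => // j IHj; rewrite !iterS IHj opZ.
move: le; rewrite itZ => le.
have := hnorm_fcoef (iter k.+1 (fres wb) f - iter k.+1 (fres zb) f
  - k.+1%:R *: iter k.+2 (fres zb) (t%:C%C *: bshift i f)) [::].
rewrite -[fcoef _ _]/(coef_op [::] _) !opB itZ !opZ.
rewrite [coef_op _ (iter _ (fres wb) f)]h [coef_op _ (iter _ (fres zb) f)]h.
rewrite subrr add0r -scaleN1r scalerA scalerA hnormZ !cabsM.
rewrite cabsN cabs1 mul1r.
rewrite (cabsR (ltW t0)) cabs_nat.
move=> /le_trans /(_ le) le2.
by rewrite mulrAC ler_pdivlMr ?ltr0n // mulrC mulrA.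
Qed.

Lemma feval_inj f g : (forall z, unit_ball z -> feval f z = feval g z) -> f = g.
Proof.
move=> h; apply/eqP; rewrite -subr_eq0; apply/eqP.
(* The power is existentially quantified because it grows by one with each letter of the word; at z
   = 0 all powers are the identity and the coefficient itself remains. *)
have : exists k, forall z (zb : unit_ball z), fcoef (iter k.+1 (fres zb) (f - g)) [::] = 0.
  exists 0%N => z zb; rewrite -[iter 1 _ _]/(fres zb (f - g)) opB -[fcoef _ _]/(coef_op [::] _) opB.
  by apply/eqP; rewrite subr_eq0; apply/eqP/h.
move: (f - g) => {h g} {}f; have b0 : unit_ball (0 : 'rV[R[i]]_n).
  by apply/ballP; rewrite big1 // => i _; rewrite mxE cabs0 expr0n.
have B0 y : brow 0 y = 0.
  by rewrite mkopE /brow_f big1 // => i _; rewrite mxE scale0r.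
have R0 y : fres b0 y = y by apply: fres_unique => //; rewrite B0 subr0.
move=> H; apply: fcoefI => w; rewrite fcoef0.
elim: w f H => [|i w IH] f [k hk].
  have := hk 0 b0; rewrite (_ : iter k.+1 _ f = f) //.
  by elim: k.+1 => // j IHj; rewrite iterS IHj R0.
rewrite -fcoef_bshift; apply: IH; exists k.+1; exact: coef_iter_fres_step.
Qed.

Definition fdiff_fun z (zb : unit_ball z) f (h : 'rV[R[i]]_n) : E :=
  fcoef (fres zb (fres zb (brow h f))) [::].

Lemma brow_linl f : linear (fun h => brow h f).
Proof.
move=> a h k; rewrite !mkopE /brow_f scaler_sumr -big_split; apply: eq_bigr => i _.
by rewrite !mxE scalerDl scalerA.
Qed.

Lemma fdiff_lin z (zb : unit_ball z) f : linear (fdiff_fun zb f).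
Proof. by move=> a h k; rewrite /fdiff_fun brow_linl !opP fcoef_lin. Qed.

Definition fdiff z (zb : unit_ball z) f : {linear 'rV[R[i]]_n -> E} :=
  HB.pack_for {linear 'rV[R[i]]_n -> E} (fdiff_fun zb f)
    (GRing.isLinear.Build R[i] 'rV[R[i]]_n E *:%R (fdiff_fun zb f) (fdiff_lin zb f)).

Definition rvnorm (h : 'rV[R[i]]_n) : R := complex.Re `|h|.
Lemma rvnormE h : (rvnorm h)%:C%C = `|h|. Proof. exact: Re_norm. Qed.
Lemma rvnorm_ge0 h : 0 <= rvnorm h. Proof. by rewrite -lecR rvnormE normr_ge0. Qed.
(** The constant n + 1 is crude, but positive also for n = 0, so that it can be divided by. *)
Lemma rad_le_rvnorm h : rad h <= n.+1%:R * rvnorm h.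
Proof.
have ci i : cabs (h 0 i) <= rvnorm h.
  rewrite -lecR cabsE rvnormE.
  rewrite -[leRHS]/(mx_norm h) mx_normE -[leLHS]nngE num_le.
  exact: (le_bigmax _ (fun ij => `|h ij.1 ij.2|%:nng) (0, i)).
rewrite -(@ler_pXn2r _ 2) // ?nnegrE ?mulr_ge0 ?rad_ge0 ?rvnorm_ge0 //.
rewrite sqr_sqrtr; last by apply: sumr_ge0 => i _; exact: sqr_ge0.
apply: (@le_trans _ _ (\sum_(i < n) rvnorm h ^+ 2)).
  by apply: ler_sum => i _; rewrite ler_pXn2r ?nnegrE ?cabs_ge0 ?rvnorm_ge0.
rewrite sumr_const card_ord exprMn -[leLHS]mulr_natl ler_wpM2r ?sqr_ge0 //.
by rewrite -natrX ler_nat (leq_trans (leqnSn n)) // expnS expn1 leq_pmulr.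
Qed.

Lemma feval_holomorphic f : holomorphic_on (@unit_ball R n) (feval f).
Proof.
move=> z zb; set N : R := n.+1%:R; have N0 : 0 < N by rewrite ltr0n.
have z1 : rad z < 1 by exact/rad_lt1.
pose M := (1 - rad z)^-1; have M0 : 0 <= M by rewrite invr_ge0 subr_ge0 ltW.
have [r r0 hr] := room zb.
have z2 : rad z <= (1 + rad z) / 2 by lra.
have z3 : (1 + rad z) / 2 < 1 by lra.
have [C C0 hC] := @fres_deriv z zb _ f 1%N z2 z3.
apply: (@differentiable_quadratic _ _ _ _ (fdiff zb f) _
  (M * (M * (N * hnorm f)))%:C%C (C * N ^+ 2)%:C%C (r / N)%:C%C).
- by rewrite lecR !mulr_ge0 ?hnorm_ge0 // ltW.
- by rewrite lecR mulr_ge0 // exprn_ge0 // ltW.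
- by rewrite ltcR divr_gt0.
- move=> h; rewrite -hnormE -rvnormE -rmorphM lecR /=.
  apply: le_trans (hnorm_fcoef _ _) _; apply: le_trans (fres_hnorm zb _) _.
  rewrite -!mulrA ler_wpM2l //; apply: le_trans (fres_hnorm zb _) _.
  rewrite ler_wpM2l //; apply: le_trans (brow_rad _ _) _.
  by rewrite [hnorm f * _]mulrC mulrA ler_wpM2r ?hnorm_ge0 // rad_le_rvnorm.
- move=> h; rewrite -rvnormE ltcR => hd.
  have hrr : rad h <= r.
    apply: le_trans (rad_le_rvnorm h) _; rewrite mulrC -ler_pdivlMr //.
    exact: ltW.
  have [wr wb] := hr h hrr.
  have := hC _ wb wr; rewrite addrK scale1r => le.
  have -> : (C * N ^+ 2)%:C%C * (rvnorm h)%:C%C ^+ 2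
      = (C * N ^+ 2 * rvnorm h ^+ 2)%:C%C by rewrite [RHS]rmorphM rmorphXn.
  rewrite -hnormE lecR.
  have -> : feval f (h + z) - (feval f z + fdiff zb f h) =
      coef_op [::] (iter 1 (fres wb) f - iter 1 (fres zb) f
        - iter 2 (fres zb) (brow h f)).
    by rewrite !opB opprD addrA.
  apply: le_trans (hnorm_fcoef _ _) _; apply: le_trans le _.
  rewrite -mulrA ler_wpM2l // -exprMn.
  by rewrite ler_pXn2r ?nnegrE ?rad_ge0 ?mulr_ge0 ?rvnorm_ge0 ?rad_le_rvnorm // ltW.
Qed.

Lemma fshiftC i j f : fshift i (fshift j f) = fshift j (fshift i f).
Proof. by apply: ip_inj => g; rewrite !fshiftP bshiftC. Qed.

Definition fockDA : druryArveson n E :=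
  @DruryArveson R n E X feval feval_lin feval_inj
    feval_holomorphic
    (fun w e wb => ex_intro _ (fker e wb)
       (conj (fun z => @feval_fker z w e wb) (fker_ip e wb)))
    (fun i => fshift i) feval_fshift.
End Fock_DruryArveson.

(** * Uniqueness of weak resolutions *)

Section Isometric_extension.
Variable R : realType.
Implicit Types H K : hilbertType R.

Definition isometric H K (U : 'B(H, K)) :=
  forall x y, inner (U x) (U y) = inner x y.

Lemma isometric_hnorm H K (U : 'B(H, K)) x : isometric U -> hnorm (U x) = hnorm x.
Proof. by move=> iU; apply: op_isom_hnorm; exact: iU. Qed.
Lemma isometric_inj H K (U : 'B(H, K)) : isometric U -> injective U.
Proof.
move=> iU x y h; apply/eqP; rewrite -subr_eq0; apply/eqP/hnorm_eq0.
by rewrite -(isometric_hnorm _ iU) opB h subrr hnorm0.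
Qed.

Lemma isometric_extension H K (I : Type) (k : I -> H) (l : I -> K) :
  (forall i j, inner (k i) (k j) = inner (l i) (l j)) ->
  (forall x, (forall i, inner x (k i) = 0) -> x = 0) ->
  exists2 U : 'B(H, K), isometric U & forall i, U (k i) = l i.
Proof.
move=> gram tot.
pose comb (V : lmodType R[i]) (v : I -> V) (s : seq (R[i] * I)) :=
  \sum_(c <- s) c.1 *: v c.2.
have combZD (V : lmodType R[i]) (v : I -> V) a s t :
    comb V v ([seq (a * c.1, c.2) | c <- s] ++ t) = a *: comb V v s + comb V v t.
  rewrite /comb big_cat big_map scaler_sumr; congr (_ + _).
  by apply: eq_bigr => c _; rewrite scalerA.
have comb_hnorm s : hnorm (comb H k s) = hnorm (comb K l s).
  apply/eqP; rewrite -(@eqrXn2 _ 2) ?hnorm_ge0 // !hnorm_ip /comb.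
  rewrite !ip_suml; apply/eqP; congr complex.Re; apply: eq_bigr => c _.
  by rewrite !ip_sumr; apply: eq_bigr => d _; rewrite !ipZl !ipZr gram.
pose D := [set x | exists s, x = comb H k s].
have sD : subspace D.
  split; first by exists [::]; rewrite /comb big_nil.
  by move=> a _ _ [s ->] [t ->]; eexists; rewrite -combZD.
have dD x (e : R) : 0 < e -> exists s, hnorm (x - comb H k s) < e.
  have : closure D x.
    rewrite total_dense // => y hy; apply: tot => i; apply: hy.
    by exists [:: (1, i)]; rewrite /comb big_seq1 scale1r.
  by move=> /closureE_hnorm h /h [_ [s ->] hs]; exists s.
(* The closure of the graph that pairs a combination of the k_i with the same combination of the
   l_i. Equality of the Gram matrices makes it isometric, hence single-valued; totality of the k_i
   makes it everywhere defined. *)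
pose G x y := forall e : R, 0 < e ->
  exists s, hnorm (x - comb H k s) < e /\ hnorm (y - comb K l s) < e.
have comb_sub s t : comb H k s - comb H k t = comb H k ([seq (-1 * c.1, c.2) | c <- t] ++ s).
  by rewrite combZD scaleN1r addrC.
have comb_subl s t : comb K l s - comb K l t = comb K l ([seq (-1 * c.1, c.2) | c <- t] ++ s).
  by rewrite combZD scaleN1r addrC.
have Gex x : exists y, G x y.
  have /choice [s hs] : forall m : nat, exists s, hnorm (x - comb H k s) < m.+1%:R^-1.
    by move=> m; apply: dD; rewrite invr_gt0 ltr0n.
  have [|y hy] := @cauchy_hnorm R K (fun m => comb K l (s m)).
    move=> e e0; have [N hN] := inv_small (e := e / 2) ltac:(by rewrite divr_gt0).
    exists N => p q Np Nq; rewrite comb_subl -comb_hnorm -comb_sub.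
    apply: le_lt_trans (hnorm_triangle x _ _) _; rewrite (hnorm_subC _ x).
    by rewrite [ltRHS]splitr ltrD // (lt_trans (hs _)) // hN.
  exists y => e e0; have [N hN] := hy e e0; have [M hM] := inv_small e0.
  exists (s (maxn N M)); split; last by apply: hN; exact: leq_maxl.
  by apply: (lt_trans (hs _)); apply: hM; exact: leq_maxr.
have Glin a x y x' y' : G x y -> G x' y' -> G (a *: x + x') (a *: y + y').
  move=> h h' e e0; have c0 : 0 < cabs a + 1 by rewrite ltr_wpDl ?cabs_ge0.
  have [s [s1 s2]] := h (e / 2 / (cabs a + 1)) ltac:(by rewrite !divr_gt0).
  have [t [t1 t2]] := h' (e / 2) ltac:(by rewrite !divr_gt0).
  have key (V : hilbertType R) (v v' w w' : V) :
      hnorm (v - w) < e / 2 / (cabs a + 1) -> hnorm (v' - w') < e / 2 ->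
      hnorm (a *: v + v' - (a *: w + w')) < e.
    move=> h1 h2; rewrite opprD addrACA -scalerBr.
    apply: le_lt_trans (ler_hnormD _ _) _; rewrite hnormZ [ltRHS]splitr ler_ltD //.
    move: h1; rewrite ltr_pdivlMr // => /ltW; apply: le_trans.
    by rewrite mulrC ler_wpM2l ?hnorm_ge0 // lerDl.
  by exists ([seq (a * c.1, c.2) | c <- s] ++ t); rewrite !combZD; split; exact: key.
have Gnorm x y : G x y -> hnorm y = hnorm x.
  move=> h; apply/eqP; rewrite eq_le; apply/andP.
  have two (V V' : hilbertType R) (v w : V) (v' w' : V') (e : R) :
      hnorm w = hnorm w' -> hnorm (v - w) < e / 2 -> hnorm (v' - w') < e / 2 ->
      hnorm v <= hnorm v' + e.
    move=> ww h1 h2; have := ler_hnormD (v - w) w; rewrite subrK ww.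
    have := ler_hnormD (v' - (v' - w')) (v' - w'); rewrite subrK.
    have := ler_hnormB v' (v' - w'); rewrite opprB addrC subrK; lra.
  split; apply/ler_addgt0Pr => e e0; have [s [s1 s2]] := h (e / 2) ltac:(by rewrite !divr_gt0).
    by apply: two s2 s1; rewrite comb_hnorm.
  by apply: two s1 s2; rewrite comb_hnorm.
have Guniq x y y' : G x y -> G x y' -> y = y'.
  move=> h h'; apply/eqP; rewrite -subr_eq0; apply/eqP/hnorm_eq0.
  have := Gnorm _ _ (Glin (-1) _ _ _ _ h' h).
  by rewrite !scaleN1r addNr hnorm0 addrC.
have /choice [U hU] := Gex.
have lin : linear U by move=> a x y; apply: Guniq (hU _) _; exact: Glin.
have bd : exists c : R, forall x, hnorm (U x) <= c * hnorm x.
  by exists 1 => x; rewrite mul1r (Gnorm _ _ (hU x)).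
exists (mkop lin bd).
  move=> x y; rewrite ip_polar [RHS]ip_polar -!opP !ip_hnorm.
  by rewrite !(Gnorm _ _ (hU _)).
move=> i; apply: Guniq (hU _) _ => e e0; exists [:: (1, i)].
by rewrite /comb !big_seq1 !scale1r !subrr !hnorm0.
Qed.

(** Exchanging the two families gives an isometry V in the other direction, and U V = 1 on the total
    family l. *)
Lemma isometric_equiv H K (I : Type) (k : I -> H) (l : I -> K) :
  (forall i j, inner (k i) (k j) = inner (l i) (l j)) ->
  (forall x, (forall i, inner x (k i) = 0) -> x = 0) ->
  (forall x, (forall i, inner x (l i) = 0) -> x = 0) ->
  exists U : 'B(H, K),
    [/\ isometric U, forall y, exists x, U x = y & forall i, U (k i) = l i].
Proof.
move=> gram totk totl; have [U iU Uk] := isometric_extension gram totk.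
have [|V iV Vl] := isometric_extension (k := l) (l := k) _ totl.
  by move=> i j; rewrite gram.
exists U; split=> // y; exists (V y).
have := closed_eq_op (comp_op U V) (id_op K) => /total_closed_subspace h.
suff : [set x | comp_op U V x = id_op K x] y by [].
rewrite h // => x hx; apply: totl => i; apply: hx => /=.
by rewrite Vl Uk.
Qed.
End Isometric_extension.

(** * Kernels and constants in an arbitrary Drury-Arveson space *)

Section DruryArveson.
Variables (R : realType) (n : nat) (E : hilbertType R) (X : druryArveson n E).
Implicit Types (f g : X) (z w : 'rV[R[i]]_n) (e : E).

Lemma da_eval0 z : unit_ball z -> da_eval (0 : X) z = 0.
Proof.
move=> zb; have := da_eval_linear 1 (0 : X) 0 zb.
by rewrite !scale1r !addr0 => /eqP; rewrite -subr_eq0 opprD addNKr oppr_eq0 => /eqP.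
Qed.
Lemma da_evalD f g z : unit_ball z -> da_eval (f + g) z = da_eval f z + da_eval g z.
Proof. by move=> zb; have := da_eval_linear 1 f g zb; rewrite !scale1r. Qed.
Lemma da_evalZ a f z : unit_ball z -> da_eval (a *: f) z = a *: da_eval f z.
Proof. by move=> zb; have := da_eval_linear a f 0 zb; rewrite da_eval0 // !addr0. Qed.
Lemma da_evalB f g z : unit_ball z -> da_eval (f - g) z = da_eval f z - da_eval g z.
Proof. by move=> zb; rewrite da_evalD // -scaleN1r da_evalZ // scaleN1r. Qed.
Lemma da_eval_sum I (r : seq I) (P : pred I) (F : I -> X) z : unit_ball z ->
  da_eval (\sum_(i <- r | P i) F i) z = \sum_(i <- r | P i) da_eval (F i) z.
Proof.
by move=> zb; elim/big_rec2: _ => [|i x y _ <-]; rewrite ?da_eval0 ?da_evalD.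
Qed.

Definition dker w e : X := xget 0 [set k |
  (forall z, unit_ball z -> da_eval k z = (1 - cdot z w)^-1 *: e) /\
  (forall f : X, inner f k = inner (da_eval f w) e)].
Lemma dkerP w e : unit_ball w ->
  (forall z, unit_ball z -> da_eval (dker w e) z = (1 - cdot z w)^-1 *: e) /\
  (forall f : X, inner f (dker w e) = inner (da_eval f w) e).
Proof.
move=> wb; rewrite /dker; case: xgetP => [y -> //|h].
by have [k hk] := da_kernel X e wb; case: (h k).
Qed.
Lemma da_eval_dker z w e : unit_ball z -> unit_ball w ->
  da_eval (dker w e) z = (1 - cdot z w)^-1 *: e.
Proof. by move=> zb wb; exact: (dkerP e wb).1. Qed.
Lemma dker_ip w e f : unit_ball w -> inner f (dker w e) = inner (da_eval f w) e.
Proof. by move=> wb; exact: (dkerP e wb).2. Qed.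
Lemma dker_total f : (forall w e, unit_ball w -> inner f (dker w e) = 0) -> f = 0.
Proof.
move=> h; apply: da_eval_inj => z zb; rewrite da_eval0 //.
by apply: ip_eq0; rewrite -(dker_ip _ f zb) h.
Qed.

Lemma unit_ball0 : unit_ball (0 : 'rV[R[i]]_n).
Proof. by apply/ballP; rewrite big1 // => i _; rewrite mxE cabs0 expr0n. Qed.

Definition dcst e : X := dker 0 e.
Lemma dcst_eval e z : unit_ball z -> da_eval (dcst e) z = e.
Proof.
move=> zb; rewrite da_eval_dker //; last exact: unit_ball0.
rewrite /cdot big1 ?subr0 ?invr1 ?scale1r // => i _.
by rewrite mxE rmorph0 mulr0.
Qed.
Lemma dcst_ipr f e : inner f (dcst e) = inner (da_eval f 0) e.
Proof. by rewrite dker_ip //; exact: unit_ball0. Qed.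
Lemma dcst_ip e e' : inner (dcst e) (dcst e') = inner e e'.
Proof. by rewrite dcst_ipr dcst_eval //; exact: unit_ball0. Qed.

(** This turns the unitarity conditions of a weak resolution into statements about constants. A
    wandering f differs from its value at 0 by a vector orthogonal to all kernels. *)
Lemma dcst_wandering f :
  wandering (da_Mz X) setT f <-> exists e, f = dcst e.
Proof.
have Mz0 i g : da_eval (da_Mz X i g) 0 = 0.
  by rewrite da_MzE ?mxE ?scale0r //; exact: unit_ball0.
have cw e : wandering (da_Mz X) setT (dcst e).
  split=> // _ [u [_ ->]]; rewrite ip_sumr big1 // => i _.
  by apply: orthC; rewrite dcst_ipr Mz0 ip0l.
split=> [[_ hf]|[e -> //]]; exists (da_eval f 0).
apply/eqP; rewrite -subr_eq0; apply/eqP; set c := dcst _.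
apply: dker_total => w e wb.
(* This is 1 / (1 - t) = 1 + t / (1 - t) with t = <z, w>. *)
have -> : dker w e = dcst e + \sum_i da_Mz X i ((w 0 i)^* *: dker w e).
  apply: da_eval_inj => z zb; rewrite da_evalD // da_eval_sum // dcst_eval //.
  rewrite (eq_bigr (fun i => (z 0 i * (w 0 i)^*) *: da_eval (dker w e) z)); last first.
    by move=> i _; rewrite da_MzE // da_evalZ // scalerA.
  rewrite -scaler_suml -/(cdot z w) da_eval_dker // scalerA -[X in _ = X + _]scale1r.
  rewrite -scalerDl; congr (_ *: _); have := cdot_lt1 zb wb => h.
  by field.
rewrite ipDr [X in X + _](_ : _ = 0) ?add0r; last first.
  by rewrite dcst_ipr da_evalB ?dcst_eval ?subrr ?ip0l //; exact: unit_ball0.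
rewrite ipBl hf ?sub0r; last by eexists; split; last reflexivity.
by have [_ ->] := cw (da_eval f 0); rewrite ?oppr0 //; eexists; split; last reflexivity.
Qed.

End DruryArveson.

(** * Maps between Drury-Arveson spaces *)

Section DruryArveson_maps.
Variables (R : realType) (n : nat).

(** U is composition with [phi], hence commutes with multiplication by the coordinates. It is
    constructed from the kernels, whose Gram matrix involves D only through inner products. *)
Lemma da_equiv (D E : hilbertType R) (X : druryArveson n D) (Y : druryArveson n E)
    (phi : D -> E) :
  (forall a b, inner (phi a) (phi b) = inner a b) ->
  (forall e, exists d, phi d = e) ->
  exists U : 'B(X, Y),
    [/\ isometric U, forall y, exists x, U x = y,
        intertwines U (da_Mz X) (da_Mz Y) & forall d, U (dcst X d) = dcst Y (phi d)].
Proof.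
move=> iphi sphi.
pose I := ({w : 'rV[R[i]]_n | unit_ball w} * D)%type.
have [|||U [iU sU Uk]] := @isometric_equiv R X Y I
    (fun i => dker X (sval i.1) i.2) (fun i => dker Y (sval i.1) (phi i.2)).
- move=> [[w wb] d] [[v vb] c] /=; rewrite !dker_ip // !da_eval_dker //.
  by rewrite !ipZl iphi.
- by move=> x h; apply: dker_total => w e wb; exact: (h (exist _ w wb, e)).
- move=> x h; apply: dker_total => w e wb; have [d <-] := sphi e.
  exact: (h (exist _ w wb, d)).
have phiE a b : (forall d, inner a (phi d) = inner b (phi d)) -> a = b.
  by move=> h; apply: ip_inj => e; have [d <-] := sphi e.
have Uker w d : unit_ball w -> U (dker X w d) = dker Y w (phi d).
  by move=> wb; exact: (Uk (exist _ w wb, d)).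
have Ueval f z : unit_ball z -> da_eval (U f) z = phi (da_eval f z).
  move=> zb; apply: phiE => d; rewrite iphi -!dker_ip // -Uker //; exact: iU.
exists U; split=> // [j f|d]; last by rewrite Uker //; exact: unit_ball0.
apply: da_eval_inj => z zb; rewrite Ueval // !da_MzE // Ueval //.
by apply: phiE => d; rewrite iphi !ipZl iphi.
Qed.

Lemma fock_word_ip (E : hilbertType R) (x : fock n E) w e :
  inner (fcoef x w) e = inner x (foldr (fun i y => fshift i y) (fcst n e) w).
Proof.
elim: w x => [|i w IH] x; first by apply/esym; exact: fcst_ipr.
transitivity (inner x (fshift i (foldr (fun i y => fshift i y) (fcst n e) w))) => //.
by rewrite [RHS]ipC fshiftP -ipC -IH fcoef_bshift.
Qed.

Lemma dcst_fockDA (D : hilbertType R) (d : D) : dcst (fockDA n D) d = fcst n d.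
Proof.
apply: ip_inj => y; rewrite ipC dcst_ipr [RHS]ipC fcst_ipr; congr (_^*).
congr (inner _ _); rewrite [LHS](_ : _ = fcoef (fres_fun 0 y) [::]) //.
congr (fcoef _ _); apply: fres_unique; first exact: unit_ball0.
by rewrite mkopE /brow_f big1 ?subr0 // => i _; rewrite mxE scale0r.
Qed.

(** Constants generate the space under M_z. An abstract Drury-Arveson space carries no power series,
    so the claim is moved to the Fock model, where a coefficient is an inner product with a shifted
    constant. *)
Lemma da_cyclic (D : hilbertType R) (X : druryArveson n D) (N : set X) :
  closed_subspace N -> (forall d, N (dcst X d)) ->
  (forall i x, N x -> N (da_Mz X i x)) -> N = setT.
Proof.
move=> cN cst inv; apply: total_closed_subspace => // f hf.
have [|U [iU sU wU cU]] := @da_equiv D D X (fockDA n D) id (fun _ _ => erefl _).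
  by move=> e; exists e.
apply: (isometric_inj iU); rewrite op0; apply: fcoefI => w.
rewrite fcoef0; apply: ip_eq0; rewrite fock_word_ip.
move: (fcoef (U f) w) => e; rewrite -dcst_fockDA -cU.
have -> : foldr (fun i y => fshift i y) (U (dcst X e)) w =
    U (foldr (fun i y => da_Mz X i y) (dcst X e) w).
  by elim: w => //= i w ->; rewrite wU.
rewrite iU; apply: hf; elim: w => [|i w IH] /=; [exact: cst|exact: inv].
Qed.

(** The inductive step of uniqueness: V is the unitary already found, and M, N are the kernels to be
    covered (the whole space at the start). V P and G U agree on constants, hence everywhere. *)
Lemma da_lift (D E : hilbertType R) (X : druryArveson n D) (Y : druryArveson n E)
    (K L : hilbertType R) (S : 'I_n -> 'B(K, K)) (T : 'I_n -> 'B(L, L))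
    (M : set K) (N : set L) (V : 'B(K, L)) (P : 'B(X, K)) (G : 'B(Y, L)) :
  isometric V -> intertwines V S T -> V @` M = N ->
  intertwines P (da_Mz X) S ->
  restricts_to_unitary P (wandering (da_Mz X) setT) (wandering S M) ->
  intertwines G (da_Mz Y) T ->
  restricts_to_unitary G (wandering (da_Mz Y) setT) (wandering T N) ->
  exists U : 'B(X, Y), [/\ isometric U, forall y, exists x, U x = y,
    intertwines U (da_Mz X) (da_Mz Y) & forall x, V (P x) = G (U x)].
Proof.
move=> iV wV VM wP [PW iP] wG [GW iG].
have VS (u : 'I_n -> K) : V (\sum_i S i (u i)) = \sum_i T i (V (u i)).
  by rewrite op_sum; apply: eq_bigr => i _; rewrite wV.
have VW y : M y -> wandering S M y <-> wandering T N (V y).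
  move=> My; split=> [[_ h]|[_ h]]; split=> //.
  - by rewrite -VM; exists y.
  - move=> _ [u' [Nu ->]].
    have /choice [u hu] : forall i, exists x, M x /\ V x = u' i.
      by move=> i; have := Nu i; rewrite -VM => -[x Mx <-]; exists x.
    rewrite (eq_bigr (fun i => T i (V (u i)))); last by move=> i _; rewrite (hu i).2.
    rewrite -VS iV; apply: h; exists u; split=> // i; exact: (hu i).1.
  - move=> _ [u [Mu ->]]; rewrite -iV VS; apply: h; exists (fun i => V (u i)).
    by split=> // i; rewrite -VM; exists (u i).
have cX d : wandering (da_Mz X) setT (dcst X d) by apply/dcst_wandering; exists d.
have cY d : wandering (da_Mz Y) setT (dcst Y d) by apply/dcst_wandering; exists d.
(* V carries the wandering subspace of M to that of N, which is the image of the constants under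
   G. *)
have /choice [phi hphi] : forall d, exists e, G (dcst Y e) = V (P (dcst X d)).
  move=> d; have : wandering S M (P (dcst X d)) by rewrite -PW; exists (dcst X d).
  move=> h; have := h; rewrite VW; last by case: h.
  by rewrite -GW => -[y /dcst_wandering [e ->] <-]; exists e.
have iphi a b : inner (phi a) (phi b) = inner a b.
  by rewrite -(dcst_ip Y) -iG // !hphi iV iP // dcst_ip.
have sphi e : exists d, phi d = e.
  have : wandering T N (G (dcst Y e)) by rewrite -GW; exists (dcst Y e).
  move=> h; have [] := h; rewrite -VM => -[y My yE] _.
  move: h; rewrite -yE -VW // -PW => -[x /dcst_wandering [d ->] dE].
  exists d; apply: ip_inj => e'; rewrite -!(dcst_ip Y) -!iG // hphi dE.
  by rewrite yE.
have [U [iU sU wU cU]] := da_equiv X Y iphi sphi.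
exists U; split=> // x.
have cs := closed_eq_op (comp_op V P) (comp_op G U).
suff : [set x | comp_op V P x = comp_op G U x] x by [].
rewrite (da_cyclic cs) // => [d|i y] /=.
  by rewrite cU hphi.
by move=> h; rewrite wU wP wV wG h.
Qed.
End DruryArveson_maps.

Theorem weak_resolution_unique (R : realType) (n : nat) (H : hilbertType R)
    (T : 'I_n -> 'B(H, H)) (D : nat -> hilbertType R)
    (X : forall i : nat, druryArveson n (D i))
    (P0 : 'B(X 0%N, H)) (P : forall i : nat, 'B(X i.+1, X i))
    (E : nat -> hilbertType R)
    (Y : forall i : nat, druryArveson n (E i))
    (G0 : 'B(Y 0%N, H)) (G : forall i : nat, 'B(Y i.+1, Y i)) :
  weak_resolution T (fun i : nat => da_Mz (X i)) P0 P ->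
  weak_resolution T (fun i : nat => da_Mz (Y i)) G0 G ->
  isomorphic_resolutions (fun i : nat => da_Mz (X i)) P0 P
    (fun i : nat => da_Mz (Y i)) G0 G.
Proof.
move=> rP rG.
pose kP i : set (X i) := map_ker (Hs := fun i => X i) P0 P i.
pose kG i : set (Y i) := map_ker (Hs := fun i => Y i) G0 G i.
(* Mapping kernel onto kernel is what [da_lift] requires at the next index. *)
pose Q i (U : 'B(X i, Y i)) := [/\ isometric U, forall y, exists x, U x = y,
   intertwines U (da_Mz (X i)) (da_Mz (Y i)) & U @` kP i = kG i].
have [U0 Q0 U0E] : exists2 U0, Q 0%N U0 & forall x, P0 x = G0 (U0 x).
  have [|||U [iU sU wU UE]] := @da_lift R n _ _ (X 0%N) (Y 0%N) H H T T setT setT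
      (id_op H) P0 G0 _ _ _ (wr_intertwines0 rP) (wr_unitary0 rP)
      (wr_intertwines0 rG) (wr_unitary0 rG) => //.
    by apply/seteqP; split=> // x _; exists x.
  exists U => //; split=> //; apply/seteqP; split=> [_ [x /= Px <-]|y /= Gy].
    by rewrite /kG /= /ker_op /= -UE mkopE Px.
  have [x xE] := sU y; exists x => //.
  by rewrite /kP /= /ker_op /= -[P0 x]/(id_op H (P0 x)) UE xE.
have step i (U : 'B(X i, Y i)) : Q i U ->
    exists2 U' : 'B(X i.+1, Y i.+1), Q i.+1 U' & forall x, U (P i x) = G i (U' x).
  move=> [iU sU wU kU].
  have [V [iV sV wV VE]] := da_lift iU wU kU
    (@wr_intertwines _ _ _ _ _ _ _ _ rP i) (@wr_unitary _ _ _ _ _ _ _ _ rP i)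
    (@wr_intertwines _ _ _ _ _ _ _ _ rG i) (@wr_unitary _ _ _ _ _ _ _ _ rG i).
  exists V => //; split=> //; apply/seteqP; split=> [_ [x /= Px <-]|y /= Gy].
    by rewrite /kG /= /ker_op /= -VE Px op0.
  have [x xE] := sV y; exists x => //.
  by rewrite /kP /= /ker_op /=; apply: (isometric_inj iU); rewrite VE xE op0.
pose next i (u : {U | Q i U}) : {U | Q i.+1 U} :=
  let s := cid2 (step i (sval u) (svalP u)) in exist _ (s2val s) (s2valP s).
pose u := nat_rect (fun i => {U | Q i U}) (exist _ U0 Q0) next.
exists (fun i => sval (u i)); split.
- move=> i; have [iU sU wU kU] := svalP (u i).
  split; last by move=> x y _ _; exact: iU.
  by apply/seteqP; split=> // y _; have [x <-] := sU y; exists x.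
- by move=> i; have [] := svalP (u i).
- exact: U0E.
- move=> i x; rewrite -[u i.+1]/(next i (u i)) /next /=.
  by case: cid2.
Qed.

(** * Existence of finite weak resolutions *)

Section Finite_dimension.
Variable R : realType.
Implicit Types H K : hilbertType R.

Fixpoint lspan H (s : seq H) (x : H) : Prop :=
  if s is a :: s' then exists c : R[i], lspan s' (x - c *: a) else x = 0.

(** The spanning vectors need not lie in V, so that the property passes to subsets at once. *)
Definition findim H (V : set H) := exists s, forall x, V x -> lspan s x.

Lemma lspan_subspace H (s : seq H) : subspace (lspan s).
Proof.
elim: s => [|a s [IH0 IH]] /=; split=> //.
- by move=> c x y /= -> ->; rewrite scaler0 addr0.
- by exists 0; rewrite scale0r subr0.
- move=> c x y /= [d hd] [e he]; exists (c * d + e).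
  by rewrite scalerDl -scalerA opprD addrACA -scalerBr; apply: IH.
Qed.
Lemma lspan_cat H (s t : seq H) x y : lspan s x -> lspan t y -> lspan (s ++ t) (x + y).
Proof.
elim: s x => [|a s IH] x /=; first by move=> ->; rewrite add0r.
by move=> [c hc] ht; exists c; rewrite addrAC; apply: IH.
Qed.
Lemma lspan_map H K (A : 'B(H, K)) s x : lspan s x -> lspan (map A s) (A x).
Proof.
elim: s x => [|a s IH] x /=; first by move=> ->; rewrite op0.
by move=> [c hc]; exists c; rewrite -opZ -opB; apply: IH.
Qed.
Lemma lspan_mem H (s : seq H) x : x \in s -> lspan s x.
Proof.
elim: s => [//|a s IH]; rewrite inE => /orP[/eqP ->|/IH h] /=.
  by exists 1; rewrite scale1r subrr; exact: subspace0 (lspan_subspace s).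
by exists 0; rewrite scale0r subr0.
Qed.

Lemma findim_sub H (V W : set H) : (forall x, V x -> W x) -> findim W -> findim V.
Proof. by move=> VW [s hs]; exists s => x /VW /hs. Qed.
Lemma findim_img H K (A : 'B(H, K)) (V : set H) : findim V -> findim (A @` V).
Proof. by move=> [s hs]; exists (map A s) => _ [x /hs h <-]; exact: lspan_map. Qed.
Lemma findim_add H (V W : set H) : findim V -> findim W ->
  findim [set z | exists x y, [/\ V x, W y & z = x + y]].
Proof.
by move=> [s hs] [t ht]; exists (s ++ t) => _ [x [y [/hs hx /ht hy ->]]]; exact: lspan_cat.
Qed.
Lemma findim_sum H (I : eqType) (r : seq I) (V : I -> set H) : (forall i, findim (V i)) ->
  findim [set z | exists u : I -> H, (forall i, V i (u i)) /\ z = \sum_(i <- r) u i].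
Proof.
move=> hV; elim: r => [|i r IH].
  by exists [::] => _ [u [_ ->]]; rewrite big_nil.
apply: findim_sub (findim_add (hV i) IH) => _ [u [hu ->]].
by exists (u i), (\sum_(j <- r) u j); split=> //; [exists u|rewrite big_cons].
Qed.

(** Gram-Schmidt along the spanning list; V is not known to be closed beforehand. *)
Lemma findim_proj H (V : set H) : subspace V -> findim V ->
  forall x, exists2 p, V p & forall v, V v -> inner (x - p) v = 0.
Proof.
move=> sV [s]; elim: s V sV => [|a s IH] V sV hs x.
  exists 0; first exact: subspace0.
  by move=> v /hs /= ->; rewrite ip0r.
pose V' := [set y | V y /\ lspan s y].
have sV' : subspace V'.
  split; first by split; [exact: subspace0|exact: subspace0 (lspan_subspace s)].
  by move=> c y z [Vy ly] [Vz lz]; split; [exact: sV.2|exact: (lspan_subspace s).2].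
have proj' := IH V' sV' (fun y (h : V' y) => h.2).
have [p [Vp lp] hp] := proj' x.
have [sub|nsub] := pselect (forall y, V y -> lspan s y).
  by exists p => // v Vv; apply: hp; split=> //; exact: sub.
have [v [Vv nv]] : exists v, V v /\ ~ lspan s v.
  apply: contrapT => h; apply: nsub => y Vy; apply: contrapT => ny; apply: h.
  by exists y.
have [q [Vq lq] hq] := proj' v.
pose v1 := v - q; have Vv1 : V v1 by exact: subspaceB.
have v10 : inner v1 v1 != 0.
  apply/eqP => /ip_eq0 h; apply: nv; rewrite -(subrK q v) -/v1 h add0r //.
have [c hc] := hs v1 Vv1.
have c0 : c != 0.
  apply/eqP => c0; apply: nv; rewrite -(subrK q v) -/v1.
  by apply: subspaceD lq; [exact: lspan_subspace|rewrite -[v1]subr0 -[0](scale0r a) -c0].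
(* V is V' plus the line of v1: the coefficient of a in y is cancelled by a multiple of v1, whose
   own coefficient c is nonzero. *)
have red y : V y -> exists t, V' (y - t *: v1).
  move=> Vy; have [d hd] := hs y Vy; exists (d / c); split.
    by apply: subspaceB => //; exact: subspaceZ.
  have -> : y - (d / c) *: v1 = (y - d *: a) - (d / c) *: (v1 - c *: a).
    by rewrite [in RHS]scalerBr [in RHS]scalerA divfK // opprB addrA subrK.
  apply: subspaceB => //; first exact: lspan_subspace.
  by apply: subspaceZ => //; exact: lspan_subspace.
pose t := inner x v1 / inner v1 v1.
exists (p + t *: v1); first by apply: subspaceD => //; exact: subspaceZ.
have o1 y : V' y -> inner (x - (p + t *: v1)) y = 0.
  by move=> hy; rewrite opprD addrA ipBl hp // ipZl hq // mulr0 subr0.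
have o2 : inner (x - (p + t *: v1)) v1 = 0.
  rewrite opprD addrA !ipBl ipZl divfK // [inner p v1](_ : _ = 0) ?subr0 ?subrr //.
  by apply: orthC; exact: hq.
move=> y Vy; have [e he] := red y Vy.
by rewrite -(subrK (e *: v1) y) ipDr o1 // ipZr o2 mulr0 addr0.
Qed.
End Finite_dimension.

(* Finite generation is replaced by finite-dimensionality of the homogeneous
   components, which passes to the kernel of P without appeal to Hilbert's
   basis theorem. *)
Record gsys (R : realType) (n : nat) (gam : 'I_n -> nat) := GSys {
  gH : hilbertType R;
  gHk : nat -> set gH;
  gT : 'I_n -> 'B(gH, gH);
  g_comm : commuting_tuple gT;
  g_sub : forall k, subspace (gHk k);
  g_fin : forall k, findim (gHk k);
  g_orth : forall k l x y, k <> l -> gHk k x -> gHk l y -> inner x y = 0;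
  g_total : forall x, (forall k y, gHk k y -> inner x y = 0) -> x = 0;
  g_deg : forall k i x, gHk k x -> gHk (k + gam i)%N (gT i x);
  g_rc : forall x, \sum_i hnorm (adj (gT i) x) ^+ 2 <= hnorm x ^+ 2
}.
Arguments gHk {R n gam} g k _.
Arguments gT {R n gam} g i.

(** * Graded row contractions *)

Section Graded_system.
Variables (R : realType) (n : nat) (gam : 'I_n -> nat) (s : gsys R gam).
Local Notation H := (gH s).
Local Notation T := (gT s).
Implicit Types x y : H.

Lemma gproj_ex k x : exists p, gHk s k p /\ forall v, gHk s k v -> inner (x - p) v = 0.
Proof. by have [p] := findim_proj (g_sub s k) (g_fin s k) x; exists p. Qed.
Definition gproj k x : H := sval (cid (gproj_ex k x)).
Lemma gproj_mem k x : gHk s k (gproj k x).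
Proof. by rewrite /gproj; case: cid => p []. Qed.
Lemma gproj_ip k x v : gHk s k v -> inner (gproj k x) v = inner x v.
Proof.
move=> hv; apply/esym/eqP; rewrite -subr_eq0 -ipBl; apply/eqP.
by rewrite /gproj; case: cid => p [] /= _; exact.
Qed.

Lemma g_homog k x : (forall l y, l <> k -> gHk s l y -> inner x y = 0) -> gHk s k x.
Proof.
move=> h; suff -> : x = gproj k x by exact: gproj_mem.
apply/eqP; rewrite -subr_eq0; apply/eqP; apply: (g_total (g := s)) => l y hy.
have [lk|/eqP lk] := eqVneq l k; first by rewrite lk in hy; rewrite ipBl gproj_ip // subrr.
by rewrite ipBl (h l y lk hy) (g_orth (nesym lk) (gproj_mem k x) hy) subr0.
Qed.

(* The homogeneous component of degree k - gam i; truncated subtraction is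
   guarded against, as the component is zero for k < gam i. *)
Definition hsub k i : set H := fun u => if (gam i <= k)%N then gHk s (k - gam i) u else u = 0.

Lemma hsub_subspace k i : subspace (hsub k i).
Proof.
rewrite /hsub; case: (gam i <= k)%N; first exact: g_sub.
by split=> // a x y -> ->; rewrite scaler0 addr0.
Qed.
Lemma hsub_T k i u : hsub k i u -> gHk s k (T i u).
Proof.
rewrite /hsub; case: ifP => [le h|_ ->]; last by rewrite op0; exact: subspace0 (g_sub s k).
by rewrite -(subnK le); exact: g_deg.
Qed.
Lemma hsub_shift k i u : gHk s k u -> hsub (k + gam i) i u.
Proof. by rewrite /hsub leq_addl addnK. Qed.
Lemma hsubD k i j u : hsub k i u -> hsub (k + gam j)%N i (T j u).
Proof.
rewrite /hsub; case: ifP => [le h|_ ->].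
  by rewrite (leq_trans le (leq_addr _ _)) -addnBAC //; exact: g_deg.
by case: ifP => _; rewrite op0 //; exact: subspace0 (g_sub s _).
Qed.
Lemma hsub_adj k i x : gHk s k x -> hsub k i (adj (T i) x).
Proof.
move=> hx; rewrite /hsub; case: leqP => le.
  apply: g_homog => l y lk hy; rewrite adjPl; apply: (g_orth (g := s)) hx (g_deg i hy).
  by move=> kE; apply: lk; rewrite kE addnK.
apply: (g_total (g := s)) => l y hy; rewrite adjPl.
apply: (g_orth (g := s)) hx (g_deg i hy) => kE; move: le.
by rewrite kE ltnNge leq_addl.
Qed.

Definition gW : set H := [set x | forall i, adj (T i) x = 0].

Lemma gW_closed : closed_subspace gW.
Proof.
rewrite (_ : gW = [set x | forall y, [set y | exists i u, y = T i u] y -> inner x y = 0]).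
  exact: orth_closed_subspace.
apply/seteqP; split=> x /= hx.
  by move=> _ [i [u ->]]; rewrite -adjPl hx ip0l.
by move=> i; apply: ip_eq0; rewrite adjPl hx //; exists i, (adj (T i) x).
Qed.

Lemma gW_wandering : wandering T setT = gW.
Proof.
apply/seteqP; split=> [x [_ hx] i|x hx].
  apply: ip_eq0; rewrite adjPl; apply: hx.
  exists (fun j => if j == i then adj (T i) x else 0); split=> //.
  rewrite (bigD1 i) //= eqxx big1 ?addr0 // => j /negPf ->; exact: op0.
split=> // _ [u [_ ->]]; rewrite ip_sumr big1 // => i _.
by rewrite -adjPl hx ip0l.
Qed.

(** The wandering subspace is graded: against T_i y of degree k the projection has the same inner
    product as x, namely 0, and against other degrees it vanishes. *)
Lemma gproj_W k x : gW x -> gW (gproj k x).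
Proof.
move=> hx i; apply: (g_total (g := s)) => l y hy; rewrite adjPl.
have [kE|/eqP kl] := eqVneq k (l + gam i)%N.
  by rewrite gproj_ip ?kE; [rewrite -adjPl hx ip0l|exact: g_deg].
exact: (g_orth kl (gproj_mem k x) (g_deg i hy)).
Qed.

(* The component of degree k of the submodule (z_1, .., z_l) H; the ordinal i
   stands for the index i + 1. *)
Definition gideal (l k : nat) (x : H) : Prop := exists u : 'I_n -> H,
  (forall i, hsub k i (u i)) /\ x = \sum_(i < n | (i < l)%N) T i (u i).

Lemma gideal_subspace l k : subspace (gideal l k).
Proof.
split.
  exists (fun _ => 0); split=> [i|]; first exact: subspace0 (hsub_subspace k i).
  by rewrite big1 // => i _; rewrite op0.
move=> a _ _ [u [hu ->]] [v [hv ->]]; exists (fun i => a *: u i + v i); split.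
  by move=> i; exact: (hsub_subspace k i).2.
by rewrite scaler_sumr -big_split; apply: eq_bigr => i _; rewrite opP.
Qed.
Lemma gideal_mem l k x : gideal l k x -> gHk s k x.
Proof.
move=> [u [hu ->]]; apply: (subspace_sum (g_sub s k)) => i _; exact: hsub_T.
Qed.
Lemma gideal_T l k (i : 'I_n) (u : H) : (i < l)%N -> hsub k i u -> gideal l k (T i u).
Proof.
move=> il hu; exists (fun j => if j == i then u else 0); split=> [j|].
  by case: eqP => [->//|_]; exact: subspace0 (hsub_subspace k j).
rewrite (bigD1 i) //= eqxx big1 ?addr0 // => j /andP[_ /negPf ->]; exact: op0.
Qed.
Lemma gideal_proj l k x : exists2 p, gideal l k p &
  forall v, gideal l k v -> inner (x - p) v = 0.
Proof.
apply: findim_proj; first exact: gideal_subspace.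
exact: findim_sub (@gideal_mem l k) (g_fin s k).
Qed.

(** The graded Nakayama argument: the part w of x orthogonal to (z_1, .., z_n) H in degree k is
    orthogonal to T_i T_i^* w, hence T_i^* w = 0. *)
Lemma g_decomp k x : gHk s k x ->
  exists w y, [/\ gW w, gHk s k w, gideal n k y & x = w + y].
Proof.
move=> hx; have [p hp orth] := gideal_proj n k x.
have hw : gHk s k (x - p) by apply: subspaceB => //; [exact: g_sub|exact: gideal_mem hp].
exists (x - p), p; split=> //; last by rewrite subrK.
move=> i; apply: ip_eq0; rewrite adjPl; apply: orth; apply: gideal_T => //.
exact: hsub_adj.
Qed.

(* z_1, .., z_l is a regular sequence, tested on homogeneous elements. *)
Definition greg (l : nat) := forall (j : 'I_n), (j < l)%N -> forall k x,
  gHk s k x -> gideal j (k + gam j) (T j x) -> gideal j k x.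
End Graded_system.
Arguments gW {R n gam} s _.
Arguments hsub {R n gam} s k i _.
Arguments gideal {R n gam} s l k x.

(** * The grading of the Fock space *)

Section Fock_graded.
Variables (R : realType) (n : nat) (gam : 'I_n -> nat).
Hypothesis gam_gt0 : forall i, (0 < gam i)%N.
Variable (s : gsys R gam).
Local Notation H := (gH s).
Local Notation T := (gT s).

Definition gWs : closedSub H := ClosedSub (gW_closed s).
Definition gD : hilbertType R := sub_hilbert gWs.
Local Notation gincl := (incl gWs).
Definition gDk k : set gD := [set d | gHk s k (gincl d)].
Local Notation X := (fock n gD).
Local Notation word := (seq 'I_n).

Lemma gincl_ip (d e : gD) : inner (gincl d) (gincl e) = inner d e. Proof. exact: incl_ip. Qed.
Lemma gincl_W (d : gD) : gW s (gincl d).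
Proof. exact: (incl_mem (V := gWs) d). Qed.

Lemma gDproj_ex k d : exists p : gD, gDk k p /\ forall e, gDk k e -> inner (d - p) e = 0.
Proof.
have [p pE] := incl_onto (V := gWs) (gproj_W k (gincl_W d)).
exists p; split; first by rewrite -[gDk k p]/(gHk s k (gincl p)) pE; exact: gproj_mem.
by move=> e he; rewrite -gincl_ip opB [gincl p]pE ipBl gproj_ip // subrr.
Qed.
Lemma gD_total d : (forall k e, gDk k e -> inner d e = 0) -> d = 0.
Proof.
move=> h; apply: (incl_inj (V := gWs)); rewrite op0; apply: (g_total (g := s)) => k y hy.
rewrite -[incl gWs d]/(gincl d).
have [q qE] := incl_onto (V := gWs) (gproj_W k (gincl_W d)).
have hq : gDk k q by rewrite -[gDk k q]/(gHk s k (gincl q)) qE; exact: gproj_mem.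
have p0 : gproj k (gincl d) = 0.
  by apply: ip_eq0; rewrite gproj_ip; [rewrite -qE [LHS]gincl_ip (h k)|exact: gproj_mem].
by rewrite -(gproj_ip _ hy) p0 ip0l.
Qed.

Fixpoint degw (w : word) : nat := if w is i :: w' then (gam i + degw w')%N else 0%N.
Lemma degw_swap u i j v : degw (u ++ [:: i, j & v]) = degw (u ++ [:: j, i & v]).
Proof. by elim: u => [|a u IH] /=; [rewrite addnCA|rewrite IH]. Qed.

(* The coefficient of w has degree k - degw w. *)
Definition gXk k : set X := [set a | forall w l y, gDk l y -> (l + degw w)%N <> k ->
  inner (fcoef a w) y = 0].

Lemma gXk_sub k : subspace (gXk k).
Proof.
split=> [w l y _ _|c a b ha hb w l y hy kl].
  by rewrite fcoef0 ip0l.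
by rewrite fcoef_lin ipDl ipZl (ha _ l) // (hb _ l) // mulr0 addr0.
Qed.

Lemma fock_ip_ext (a b c d : X) :
  (forall w, inner (fcoef a w) (fcoef b w) = inner (fcoef c w) (fcoef d w)) ->
  inner a b = inner c d.
Proof.
move=> h; apply: clim_unique (fcoef_ip a b) _; apply: clim_ext (fcoef_ip c d) => N.
by apply: eq_wsum => w; rewrite /fipw h.
Qed.

Lemma gDk_homog k d : (forall l e, l <> k -> gDk l e -> inner d e = 0) -> gDk k d.
Proof.
move=> h; have [p [hp op]] := gDproj_ex k d.
suff -> : d = p by [].
apply/eqP; rewrite -subr_eq0; apply/eqP/gD_total => l e he.
have [lk|/eqP lk] := eqVneq l k; first by rewrite lk in he; exact: op.
by rewrite ipBl (h l e lk he) -[inner p e]gincl_ip (g_orth (nesym lk) hp he) subr0.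
Qed.

Lemma gXk_orth k l a b : k <> l -> gXk k a -> gXk l b -> inner a b = 0.
Proof.
move=> kl ha hb; rewrite -(ip0l (0 : X)); apply: fock_ip_ext => w.
rewrite fcoef0 ip0l.
have [le|gt] := leqP (degw w) l.
  apply: ha (l - degw w)%N _ _ _; last by rewrite subnK // => /esym.
  apply: gDk_homog => m e ml he; apply: hb he _ => h; apply: ml.
  by rewrite -h addnK.
rewrite (_ : fcoef b w = 0) ?ip0r //; apply: gD_total => m e he.
by apply: hb he _ => h; move: gt; rewrite -h ltnNge leq_addl.
Qed.

(** b is the component of a of degree k, obtained by projecting every coefficient. It is built by
    hand because [gproj] presupposes finite-dimensional components. *)
Lemma gXcomp_ex k a : exists b : X, [/\ gXk k b,
  forall w, inner (fcoef b w) (fcoef b w) = inner (fcoef a w) (fcoef b w) &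
  forall w l e, (l + degw w)%N = k -> gDk l e ->
    inner (fcoef b w) e = inner (fcoef a w) e].
Proof.
have /choice [pr hpr] : forall kd : nat * gD, exists p : gD, gDk kd.1 p /\
    forall e, gDk kd.1 e -> inner (kd.2 - p) e = 0.
  by move=> [m d]; exact: gDproj_ex.
have prip m d e : gDk m e -> inner (pr (m, d)) e = inner d e.
  move=> he; apply/esym/eqP; rewrite -subr_eq0 -ipBl; apply/eqP.
  exact: (hpr (m, d)).2.
pose f (w : word) : gD := if (degw w <= k)%N then pr ((k - degw w)%N, fcoef a w) else 0.
have [|b hb] := @mkfock R n gD f.
  split; last by move=> u i j v; rewrite /f degw_swap (fcoef_sym a).
  have [c hc] := fcoef_bounded a; exists c => N; apply: le_trans (hc N).
  apply: wsum_le => w; rewrite /sqw /f; case: ifP => _; last first.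
    by rewrite hnorm0 expr0n sqr_ge0.
  set d := fcoef a w; set m := (k - _)%N.
  have o : inner (d - pr (m, d)) (pr (m, d)) = 0 by apply: (hpr (m, d)).2; exact: (hpr (m, d)).1.
  by have := pythagoras o; rewrite subrK => ->; rewrite lerDr sqr_ge0.
exists b; split.
- move=> w l e he lk; rewrite hb /f; case: leqP => le; last by rewrite ip0l.
  rewrite -gincl_ip; apply: (g_orth (g := s)) ((hpr _).1) he => /= h.
  by apply: lk; rewrite -h subnK.
- move=> w; rewrite hb /f; case: leqP => le; last by rewrite ip0l ip0r.
  by rewrite prip //; exact: (hpr (_, _)).1.
- move=> w l e lk he; rewrite hb /f -lk leq_addl addnK; exact: prip.
Qed.

Lemma gX_homog k a : (forall l b, l <> k -> gXk l b -> inner a b = 0) -> gXk k a.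
Proof.
move=> h w l e he lk; have [b [hb bb be]] := gXcomp_ex (l + degw w) a.
have b0 : b = 0.
  apply: ip_eq0; rewrite -(h _ _ lk hb); exact: fock_ip_ext.
by rewrite -(be w l) // b0 fcoef0 ip0l.
Qed.
Lemma gX_total a : (forall k b, gXk k b -> inner a b = 0) -> a = 0.
Proof.
move=> h; apply: fcoefI => w; rewrite fcoef0.
apply: gD_total => l e he; have [b [hb bb be]] := gXcomp_ex (l + degw w) a.
have b0 : b = 0.
  by apply: ip_eq0; rewrite -(h _ _ hb); exact: fock_ip_ext.
by rewrite -(be w l) // b0 fcoef0 ip0l.
Qed.

Lemma gXk_bshift k i a : gXk (k + gam i)%N a -> gXk k (bshift i a).
Proof.
move=> ha w l e he lk; rewrite fcoef_bshift; apply: ha he _ => /= h; apply: lk.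
by apply: (@addnI (gam i)); rewrite addnCA h addnC.
Qed.
Lemma gXk_bshift0 k i a : (k < gam i)%N -> gXk k a -> bshift i a = 0.
Proof.
move=> ki ha; apply: fcoefI => w; rewrite fcoef_bshift fcoef0.
apply: gD_total => l e he; apply: ha he _ => /= h; move: ki.
by rewrite -h addnCA ltnNge leq_addr.
Qed.
(** By duality with [gXk_bshift]: the coefficients of [fshift i a] itself involve weights. *)
Lemma gXk_fshift k i a : gXk k a -> gXk (k + gam i)%N (fshift i a).
Proof.
move=> ha; apply: gX_homog => l b lk hb; rewrite fshiftP.
have [le|gt] := leqP (gam i) l.
  apply: gXk_orth ha (gXk_bshift (k := (l - gam i)%N) _); last by rewrite subnK.
  by move=> h; apply: lk; rewrite h subnK.
by rewrite (gXk_bshift0 gt hb) ip0r.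
Qed.
Lemma gXk_fcst k d : gDk k d -> gXk k (fcst n d).
Proof.
move=> hd [|i w] l e he lk; last first.
  by rewrite -fcoef_bshift bshift_fcst fcoef0 ip0l.
rewrite fcoef_fcst0 -gincl_ip; apply: (g_orth (g := s)) hd he.
by move=> h; apply: lk; rewrite addn0.
Qed.
Lemma fcst_ker_bshift (a : X) : (forall i, bshift i a = 0) -> a = fcst n (fcoef a [::]).
Proof.
move=> h; apply: fcoefI => -[|i w]; first by rewrite fcoef_fcst0.
by rewrite -!fcoef_bshift h bshift_fcst.
Qed.

Lemma gDk_findim k : findim (gDk k).
Proof.
have [t ht] := g_fin s k; exists (map (proj gWs) t) => d hd.
by rewrite -[d](projK (V := gWs)); apply: lspan_map; exact: ht.
Qed.
Lemma gDk_sub k : subspace (gDk k).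
Proof.
split; first by rewrite -[gDk k 0]/(gHk s k (gincl 0)) op0; exact: subspace0 (g_sub s k).
move=> a x y hx hy; rewrite -[gDk k _]/(gHk s k (gincl (a *: x + y))) opP.
exact: (g_sub s k).2.
Qed.

Definition gXhsub k i : set X := fun u => if (gam i <= k)%N then gXk (k - gam i) u else u = 0.

(** Degree k consists of constants and of the z_i multiples of lower degrees: what is orthogonal to
    these is killed by all backward shifts, hence constant. *)
Lemma gXk_findim k : findim (gXk k).
Proof.
elim/ltn_ind: k => k IH.
have hf i : findim [set fshift i u | u in gXhsub k i].
  apply: findim_img; rewrite /gXhsub; case: leqP => le; last first.
    by exists [::] => x ->.
  by apply: IH; rewrite ltn_subrL gam_gt0 (leq_trans (gam_gt0 i)).
have := findim_add (findim_img (fcst n) (gDk_findim k)) (findim_sum (index_enum 'I_n) hf).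
set V := [set z | _] => fV.
have sX i : subspace (gXhsub k i).
  rewrite /gXhsub; case: (gam i <= k)%N; first exact: gXk_sub.
  by split=> // a x y -> ->; rewrite scaler0 addr0.
have hF i u : gXhsub k i u -> gXk k (fshift i u).
  rewrite /gXhsub; case: leqP => [le|_ ->]; last by rewrite op0; exact: subspace0 (gXk_sub k).
  by move=> /(@gXk_fshift _ i); rewrite subnK.
have sV : subspace V.
  split.
    exists 0, 0; split; last by rewrite addr0.
      by exists 0; [exact: subspace0 (gDk_sub k)|rewrite op0].
    exists (fun _ => 0); split; last by rewrite big1.
    by move=> i; exists 0; [exact: subspace0 (sX i)|rewrite op0].
  move=> c _ _ [_ [_ [[d hd <-] [u [hu ->]] ->]]] [_ [_ [[e he <-] [v [hv ->]] ->]]].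
  exists (fcst n (c *: d + e)), (\sum_i (c *: u i + v i)); split.
  - by exists (c *: d + e) => //; exact: (gDk_sub k).2.
  - exists (fun i => c *: u i + v i); split=> // i.
    have [x hx <-] := hu i; have [y hy <-] := hv i.
    by exists (c *: x + y); [exact: (sX i).2|rewrite opP].
  - by rewrite opP big_split -scaler_sumr /= scalerDr addrACA.
have VX x : V x -> gXk k x.
  move=> [_ [_ [[d hd <-] [u [hu ->]] ->]]].
  apply: (subspaceD (gXk_sub k)); first exact: gXk_fcst.
  by apply: (subspace_sum (gXk_sub k)) => i _; have [y hy <-] := hu i; exact: hF.
apply: (findim_sub _ fV) => x hx; have [p Vp op] := findim_proj sV fV x.
have hy : gXk k (x - p) by apply: (subspaceB (gXk_sub k)) => //; exact: VX.
have B0 i : bshift i (x - p) = 0.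
  have hb : gXhsub k i (bshift i (x - p)).
    rewrite /gXhsub; case: leqP => le; last exact: (gXk_bshift0 le).
    by apply: gXk_bshift; rewrite subnK.
  apply: ip_eq0; rewrite ipC -fshiftP -ipC; apply: op.
  exists 0, (fshift i (bshift i (x - p))); split; last by rewrite add0r.
    by exists 0; [exact: subspace0 (gDk_sub k)|rewrite op0].
  exists (fun j => if j == i then fshift i (bshift i (x - p)) else 0); split.
    move=> j; case: eqP => [->|_]; first by exists (bshift i (x - p)).
    by exists 0; [exact: subspace0 (sX j)|rewrite op0].
  by rewrite (bigD1 i) //= eqxx big1 ?addr0 // => j /negPf ->.
have yE := fcst_ker_bshift B0.
have Vy : V (x - p).
  exists (x - p), 0; split; last by rewrite addr0.
    exists (fcoef (x - p) [::]) => //; apply: gDk_homog => l e lk he.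
    by apply: hy he _; rewrite addn0.
  exists (fun _ => 0); split; last by rewrite big1.
  by move=> i; exists 0; [exact: subspace0 (sX i)|rewrite op0].
have : x - p = 0 by apply: ip_eq0; exact: op.
by move=> /eqP; rewrite subr_eq0 => /eqP ->.
Qed.

Lemma adj_fshift i x : adj (fshift i) x = bshift i x :> X.
Proof. by apply: ip_inj => y; rewrite adjPl ipC fshiftP -ipC. Qed.
Lemma gX_rc (x : X) : \sum_i hnorm (adj (fshift i) x) ^+ 2 <= hnorm x ^+ 2.
Proof.
under eq_bigr do rewrite adj_fshift.
by rewrite [leRHS]fock_hnormE lerDr sqr_ge0.
Qed.
Definition gF : gsys R gam :=
  @GSys R n gam X gXk (@fshift R n gD) (@fshiftC R n gD) gXk_sub gXk_findim gXk_orth gX_total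
    (fun k i x => @gXk_fshift k i x) gX_rc.
End Fock_graded.
Arguments gDk {R n gam} s k _.
Arguments gXk {R n gam} s k _.

(** * A right inverse of the backward shift *)

Section Backward_shift_section.
Variables (R : realType) (n : nat) (E : hilbertType R) (j : 'I_n).
Local Notation X := (fock n E).

(* Deletes the first j from w.  This is multiplication by z_j on coefficients
   taken without the multinomial weights: a right inverse of B_j which, unlike
   the adjoint of B_j, preserves the kernels of the other B_i. *)
Fixpoint beta (a : X) (w : seq 'I_n) : E :=
  if w is i :: w' then (if i == j then fcoef a w' else beta (bshift i a) w') else 0.

Lemma beta_cons a i w :
  beta a (i :: w) = if i == j then fcoef a w else beta (bshift i a) w.
Proof. by []. Qed.

Lemma beta0 w : beta 0 w = 0.
Proof.
elim: w => // i w IH; rewrite beta_cons op0 IH; case: ifP => // _; exact: fcoef0.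
Qed.

(** [beta] need not be bounded on the whole space. If only words shorter than m carry coefficients,
    those starting with j contribute at most |a|^2, and the others reduce to the B_i a, with m
    lowered by one. *)
Lemma beta_bound m a : (forall w, (m <= size w)%N -> fcoef a w = 0) ->
  forall N, wsum N (sqw (beta a)) <= m%:R * hnorm a ^+ 2.
Proof.
elim: m a => [|m IH] a ha N.
  have -> : a = 0 by apply: fcoefI => w; rewrite ha // fcoef0.
  rewrite mul0r (@eq_wsum _ _ _ _ (fun _ => 0 * 0)) ?wsumZ ?mul0r // => w.
  by rewrite /sqw beta0 hnorm0 expr0n.
case: N => [|N]; first by rewrite mulr_ge0 // sqr_ge0.
have -> : wsum N.+1 (sqw (beta a)) = \sum_i wsum N (sqw (fun w => beta a (i :: w))).
  by rewrite [LHS]/= /sqw hnorm0 expr0n add0r.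
rewrite (bigD1 j) //= eqxx.
rewrite -[m.+1]add1n natrD mulrDl mul1r lerD ?wsum_le_hnorm //.
apply: (@le_trans _ _ (\sum_(i < n | i != j) m%:R * hnorm (bshift i a) ^+ 2)).
  apply: ler_sum => i /negPf ij; rewrite ij; apply: (IH (bshift i a)) => w hw.
  by rewrite fcoef_bshift ha.
rewrite -mulr_sumr ler_wpM2l // fock_hnormE.
apply: ler_wpDl; first exact: sqr_ge0.
by rewrite [leRHS](bigD1 j) //= lerDr sqr_ge0.
Qed.

Lemma beta_sym a : wsym (beta a).
Proof.
move=> u; elim: u a => [|i u IH] a p q v; last first.
  by rewrite !cat_cons !beta_cons; case: ifP => _; [exact: fcoef_sym|exact: IH].
rewrite !cat0s !beta_cons.
case: (eqVneq p j) => [pj|pj]; case: (eqVneq q j) => [qj|qj].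
- by rewrite pj qj.
- by rewrite fcoef_bshift.
- by rewrite fcoef_bshift.
- by rewrite bshiftC.
Qed.

Lemma bshift_section m a : (forall w, (m <= size w)%N -> fcoef a w = 0) ->
  exists b : X, bshift j b = a /\
    forall i, i != j -> bshift i a = 0 -> bshift i b = 0.
Proof.
move=> ha; have [|b hb] := @mkfock R n E (beta a).
  by split; [exists (m%:R * hnorm a ^+ 2); exact: beta_bound|exact: beta_sym].
exists b; split; first by apply: fcoefI => w; rewrite fcoef_bshift hb /= eqxx.
move=> i ij hi; apply: fcoefI => w.
by rewrite fcoef_bshift hb beta_cons (negPf ij) hi beta0 fcoef0.
Qed.
End Backward_shift_section.

(** * One step of the resolution *)

Section Step.
Variables (R : realType) (n : nat) (gam : 'I_n -> nat).
Hypothesis gam_gt0 : forall i, (0 < gam i)%N.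
Variable (s : gsys R gam).
Local Notation H := (gH s).
Local Notation T := (gT s).
Local Notation X := (fock n (gD s)).
Local Notation F := (gF gam_gt0 s).
Local Notation gincl := (incl (gWs s)).

Lemma size_le_degw w : (size w <= degw gam w)%N.
Proof. by elim: w => //= i w IH; rewrite -add1n leq_add. Qed.

(** Let a be the part of x orthogonal to the ideal, so that B_i a = 0 for i < j. Lifting a to b with
    B_j b = a and B_i b = 0 gives |a|^2 = <x, B_j b> = <z_j x, b> = 0. *)
Lemma gF_greg : greg F n.
Proof.
move=> j _ k x hx hj; have [p hp op] := gideal_proj (s := F) j k x.
suff : x - p = 0 by move=> /eqP; rewrite subr_eq0 => /eqP ->.
set a : X := x - p.
have ha : gXk s k a.
  by apply: (subspaceB (gXk_sub s k)) => //; exact: (gideal_mem (s := F) hp).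
have B0 (i : 'I_n) : (i < j)%N -> bshift i a = 0.
  move=> ij; apply: ip_eq0; rewrite ipC -fshiftP -ipC; apply: op.
  apply: (@gideal_T _ _ _ F) => //.
  rewrite -adj_fshift; exact: (hsub_adj (s := F) i ha).
(* Each letter has degree at least 1, so a has no coefficients at words longer than k. *)
have [|b [Bb Bb0]] := @bshift_section R n (gD s) j k.+1 a.
  move=> w hw; apply: gD_total => l e he; apply: ha he _ => h.
  have := size_le_degw w; rewrite leqNgt => /negP; apply.
  by apply: leq_trans hw; rewrite ltnS -h leq_addl.
apply: ip_eq0; rewrite -/a {1}/a ipBl [X in _ - X](_ : _ = 0) ?subr0; last first.
  by apply: orthC; exact: op.
rewrite -Bb -fshiftP; have [u [hu ->]] := hj.
rewrite ip_suml big1 // => i ij; rewrite [inner _ _]fshiftP Bb0 ?ip0r //.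
  by apply: contraTneq ij => ->; rewrite ltnn.
exact: B0.
Qed.

Fixpoint phi (h : H) (w : seq 'I_n) : gD s :=
  if w is i :: w' then phi (adj (T i) h) w' else proj (gWs s) h.

Lemma phi_nil h : phi h [::] = proj (gWs s) h. Proof. by []. Qed.
Lemma phi_cons h i w : phi h (i :: w) = phi (adj (T i) h) w. Proof. by []. Qed.

Lemma adj_comm i j h : adj (T i) (adj (T j) h) = adj (T j) (adj (T i) h).
Proof. by apply: ip_inj => y; rewrite !adjPl g_comm. Qed.

(** The T_i^* annihilate the wandering part of h, so the row contraction inequality may be applied
    to the rest; iterating bounds the family [phi]. *)
Lemma phi_rc h : hnorm (proj (gWs s) h) ^+ 2 + \sum_i hnorm (adj (T i) h) ^+ 2
  <= hnorm h ^+ 2.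
Proof.
set d := proj (gWs s) h; set h' := h - gincl d.
have o : inner h' (gincl d) = 0 by apply: proj_orth; exact: incl_mem.
have := pythagoras o; rewrite subrK incl_hnorm => ->.
rewrite addrC lerD2r; apply: le_trans (g_rc (g := s) h').
rewrite le_eqVlt; apply/orP; left; apply/eqP; apply: eq_bigr => i _.
by rewrite /h' opB (gincl_W d i) subr0.
Qed.

Lemma phi_bound N h : wsum N (sqw (phi h)) <= hnorm h ^+ 2.
Proof.
elim: N h => [|N IH] h; first exact: sqr_ge0.
apply: le_trans (phi_rc h); rewrite [wsum _ _]/= lerD2l; apply: ler_sum => i _; exact: IH.
Qed.
Lemma phi_sym h : wsym (phi h).
Proof.
move=> u; elim: u h => [|i u IH] h p q v; first by rewrite !cat0s !phi_cons adj_comm.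
by rewrite !cat_cons !phi_cons; exact: IH.
Qed.
Lemma phi_lin w : linear (phi ^~ w).
Proof.
by elim: w => [|i w IH] a x y; rewrite ?phi_nil ?phi_cons opP // IH.
Qed.
Lemma psi_ex h : exists a : X, forall w, fcoef a w = phi h w.
Proof.
apply: mkfock; split; last exact: phi_sym.
by exists (hnorm h ^+ 2) => N; exact: phi_bound.
Qed.
Definition psif h : X := sval (cid (psi_ex h)).
Lemma fcoef_psif h w : fcoef (psif h) w = phi h w.
Proof. by rewrite /psif; case: cid. Qed.
Lemma psif_lin : linear psif.
Proof. by move=> a x y; apply: fcoefI => w; rewrite fcoef_lin !fcoef_psif phi_lin. Qed.
Lemma psif_bd : exists c : R, forall h, hnorm (psif h) <= c * hnorm h.
Proof.
exists 1 => h; rewrite mul1r; apply: hnorm_le; rewrite ?hnorm_ge0 //.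
apply: fock_hnorm_le => N; rewrite (@eq_wsum _ _ _ _ (sqw (phi h))); last first.
  by move=> w; rewrite /sqw fcoef_psif.
exact: phi_bound.
Qed.
Definition psi : 'B(H, X) := mkop psif_lin psif_bd.
Arguments psi : simpl never.
Lemma fcoef_psi h w : fcoef (psi h) w = phi h w. Proof. exact: fcoef_psif. Qed.
Definition gP : 'B(X, H) := adj psi.
Lemma gP_ip a h : inner (gP a) h = inner a (psi h). Proof. exact: adjPl. Qed.

Lemma bshift_psi i h : bshift i (psi h) = psi (adj (T i) h).
Proof. by apply: fcoefI => w; rewrite fcoef_bshift !fcoef_psi. Qed.
Lemma gP_T i a : gP (fshift i a) = T i (gP a).
Proof. by apply: ip_inj => h; rewrite gP_ip fshiftP bshift_psi -gP_ip -adjP. Qed.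
Lemma gP_fcst d : gP (fcst n d) = gincl d.
Proof.
by apply: ip_inj => h; rewrite gP_ip ipC fcst_ipr fcoef_psi phi_nil /proj adjPl -ipC.
Qed.

(** m is the degree of the letters already read. *)
Lemma phi_deg k m h : (forall l y, gHk s l y -> (l + m)%N <> k -> inner h y = 0) ->
  forall w l d, gDk s l d -> (l + degw gam w + m)%N <> k -> inner (phi h w) d = 0.
Proof.
move=> hh w; elim: w m h hh => [|i w IH] m h hh l d hd lk; first rewrite phi_nil.
  by rewrite /proj adjPl; apply: hh hd _; rewrite addn0 in lk.
rewrite phi_cons.
apply: (IH (m + gam i)%N _ _ l) => //.
  by move=> l' y hy lk'; rewrite adjPl; apply: hh (g_deg i hy) _; rewrite -addnA [(gam i + m)%N]addnC.
move=> h'; apply: lk; rewrite -h' [degw _ _]/= [(gam i + _)%N]addnC.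
by rewrite -!addnA [(gam i + m)%N]addnC.
Qed.
Lemma psi_deg k h : gHk s k h -> gXk s k (psi h).
Proof.
move=> hh w l d hd lk; rewrite fcoef_psi.
apply: (@phi_deg k 0 h) hd _; last by rewrite addn0.
by move=> l' y hy; rewrite addn0 => lk'; apply: (g_orth (g := s)) hh hy; exact/nesym.
Qed.
Lemma gP_deg k a : gXk s k a -> gHk s k (gP a).
Proof.
move=> ha; apply: g_homog => l y lk hy; rewrite gP_ip.
exact: (gXk_orth (nesym lk) ha (psi_deg hy)).
Qed.

(** On each component P is exactly onto: x is a wandering vector plus T_i multiples of vectors of
    lower degree, which are lifted by induction. *)
Lemma gP_onto k x : gHk s k x -> exists2 a, gXk s k a & gP a = x.
Proof.
elim/ltn_ind: k x => k IH x /g_decomp [w [_ [hw wk [u [hu ->]] ->]]].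
have [d dE] := incl_onto (V := gWs s) hw.
have /choice [v hv] : forall i, exists v, hsub F k i v /\ gP v = u i.
  move=> i; have := hu i; rewrite /hsub; case: leqP => le; last first.
    by move=> ->; exists 0; rewrite op0.
  move=> /IH []; last by move=> v hv vE; exists v.
  by rewrite ltn_subrL gam_gt0 (leq_trans (gam_gt0 i)).
exists (fcst n d + \sum_i fshift i (v i)).
  apply: (subspaceD (gXk_sub s k)).
    by apply: gXk_fcst; rewrite -[gDk _ _ _]/(gHk s k (gincl d)) dE.
  apply: (subspace_sum (gXk_sub s k)) => i _.
  exact: (hsub_T (s := F) (hv i).1).
rewrite opD gP_fcst dE op_sum; congr (_ + _).
rewrite [RHS](eq_bigl xpredT); last by move=> i; exact: ltn_ord.
by apply: eq_bigr => i _; rewrite gP_T (hv i).2.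
Qed.
Lemma gP_total x : (forall a, inner x (gP a) = 0) -> x = 0.
Proof.
move=> h; apply: (g_total (g := s)) => k y /gP_onto [a _ <-]; exact: h.
Qed.
(** Ker P is graded: for the component b of a, |P b|^2 = <b, psi (P b)> = <a, psi (P b)> = <P a, P
    b>. *)
Lemma gP_gproj k a : gP a = 0 -> gP (gproj (s := F) k a) = 0.
Proof.
move=> ha; have hk := gproj_mem (s := F) k a.
apply: ip_eq0; rewrite gP_ip (gproj_ip (s := F)); first by rewrite -gP_ip ha ip0l.
by apply: psi_deg; exact: gP_deg.
Qed.

Definition gK : closedSub X := ClosedSub (ker_closed_subspace gP).
Definition gKH : hilbertType R := sub_hilbert gK.
Lemma gKT_ex i : exists B : 'B(gKH, gKH), forall x, incl gK (B x) = fshift i (incl gK x).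
Proof.
apply: restrict_ex => x; rewrite /= /ker_op /= gP_T => ->; exact: op0.
Qed.
Definition gKT i : 'B(gKH, gKH) := sval (cid (gKT_ex i)).
Lemma gKTE i x : incl gK (gKT i x) = fshift i (incl gK x).
Proof. by rewrite /gKT; case: cid. Qed.
Definition gKk k : set gKH := [set x | gXk s k (incl gK x)].

Lemma gK_comm : commuting_tuple gKT.
Proof. by move=> i j x; apply: (incl_inj (V := gK)); rewrite !gKTE fshiftC. Qed.
Lemma gK_sub k : subspace (gKk k).
Proof.
split; first by rewrite -[gKk k 0]/(gXk s k (incl gK 0)) op0; exact: subspace0 (gXk_sub s k).
move=> a x y hx hy; rewrite -[gKk k _]/(gXk s k (incl gK (a *: x + y))) opP.
exact: (gXk_sub s k).2.
Qed.
Lemma gK_fin k : findim (gKk k).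
Proof.
have [t ht] := gXk_findim gam_gt0 s k; exists (map (proj gK) t) => d hd.
by rewrite -[d](projK (V := gK)); apply: lspan_map; exact: ht.
Qed.
Lemma gK_orth k l x y : k <> l -> gKk k x -> gKk l y -> inner x y = 0.
Proof. by move=> kl hx hy; rewrite -(incl_ip (V := gK)); exact: gXk_orth kl hx hy. Qed.
Lemma gK_total x : (forall k y, gKk k y -> inner x y = 0) -> x = 0.
Proof.
move=> h; apply: (incl_inj (V := gK)); rewrite op0; apply: (gX_total (s := s)) => k b hb.
have : gP (gproj (s := F) k (incl gK x)) = 0.
  by apply: gP_gproj; exact: (incl_mem (V := gK) x).
move=> /(incl_onto (V := gK)) [y yE].
have hy : gKk k y.
  by rewrite -[gKk k y]/(gXk s k (incl gK y)) yE; exact: (gproj_mem (s := F)).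
have y0 : gproj (s := F) k (incl gK x) = 0.
  apply: ip_eq0; rewrite gproj_ip; last exact: gproj_mem.
  by rewrite -yE [LHS](incl_ip (V := gK)); exact: h hy.
by rewrite -(gproj_ip (s := F) _ hb) y0 ip0l.
Qed.
Lemma gK_deg k i x : gKk k x -> gKk (k + gam i)%N (gKT i x).
Proof.
by move=> hx; rewrite -[gKk _ _]/(gXk s _ (incl gK (gKT i x))) gKTE; exact: gXk_fshift.
Qed.
Lemma proj_hnorm x : hnorm (proj gK x) <= hnorm x.
Proof.
have o := proj_orth x (incl_mem (V := gK) (proj gK x)).
have := pythagoras o; rewrite subrK incl_hnorm => h.
by apply: hnorm_le; rewrite ?hnorm_ge0 // h lerDr sqr_ge0.
Qed.
(** The adjoint of the restricted shift is the backward shift followed by the projection onto Ker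
    P. *)
Lemma gK_rc x : \sum_i hnorm (adj (gKT i) x) ^+ 2 <= hnorm x ^+ 2.
Proof.
rewrite -(incl_hnorm (V := gK) x); apply: le_trans (gX_rc (s := s) (incl gK x)).
apply: ler_sum => i _.
have -> : adj (gKT i) x = proj gK (adj (fshift i) (incl gK x)).
  by apply: ip_inj => y; rewrite !adjPl -gKTE incl_ip.
by rewrite ler_pXn2r ?nnegrE ?hnorm_ge0 ?proj_hnorm.
Qed.
Definition gnext : gsys R gam :=
  @GSys R n gam gKH gKk gKT gK_comm gK_sub gK_fin gK_orth gK_total
    (fun k i x => @gK_deg k i x) gK_rc.

(* This is Tor-independence: if z_1, .., z_l is regular on F / Ker P, then
   Ker P meets (z_1, .., z_l) F in (z_1, .., z_l) Ker P.  By regularity the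
   coefficient f_l of z_l can be corrected by an element of
   (z_1, .., z_(l-1)) F so as to lie in Ker P. *)
Lemma ker_gideal l k x : (l <= n)%N -> greg s l -> gideal F l k x -> gP x = 0 ->
  exists u : 'I_n -> X, (forall i, hsub F k i (u i) /\ gP (u i) = 0) /\
    x = \sum_(i < n | (i < l)%N) fshift i (u i).
Proof.
elim: l k x => [|l IH] k x ln reg [f [hf xE]] Px.
  exists (fun _ => 0); split=> [i|]; last by rewrite xE !big_pred0.
  by rewrite op0; split=> //; exact: subspace0 (hsub_subspace F k i).
pose j := Ordinal ln.
have split_sum (V : zmodType) (G : 'I_n -> V) :
    \sum_(i < n | (i < l.+1)%N) G i = G j + \sum_(i < n | (i < l)%N) G i.
  rewrite (bigD1 j) //=; congr (_ + _); apply: eq_bigl => i.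
  by rewrite ltnS ltn_neqAle andbC.
have reg' : greg s l by move=> i il; apply: reg; exact: leqW.
have hP i : hsub s k i (gP (f i)).
  have := hf i; rewrite /hsub; case: ifP => _; [exact: gP_deg|by move=> ->; rewrite op0].
have [d [hd Pd]] : exists d : 'I_n -> X, (forall i, hsub F k i (fshift j (d i))) /\
   (hsub F k j (f j - \sum_(i < n | (i < l)%N) fshift i (d i)) /\
   gP (f j - \sum_(i < n | (i < l)%N) fshift i (d i)) = 0).
  have := hf j; rewrite {1}/hsub; case: leqP => [le hfj|_ fj0]; last first.
    exists (fun _ => 0); split=> [i|].
      by rewrite op0; exact: subspace0 (hsub_subspace F k i).
    rewrite big1 => [|i _]; last by rewrite op0.
    rewrite fj0 subr0 op0; split=> //; exact: subspace0 (hsub_subspace F k j).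
  set k' := (k - gam j)%N in hfj; have kE : (k' + gam j)%N = k by rewrite subnK.
  have [|c [hc cE]] := reg j (ltnSn l) k' (gP (f j)) (gP_deg hfj).
    exists (fun i => - gP (f i)); split.
      by move=> i; rewrite kE; apply: (subspaceN (hsub_subspace s k i)).
    have := Px; rewrite xE split_sum opD gP_T op_sum => /eqP; rewrite addr_eq0.
    move=> /eqP ->; rewrite -sumrN; apply: eq_bigr => i _.
    by rewrite -[- gP (f i)]scaleN1r opZ scaleN1r -gP_T.
  have /choice [d hd] : forall i, exists d, hsub F k' i d /\ gP d = c i.
    move=> i; have := hc i; rewrite /hsub; case: ifP => _; last first.
      by move=> ->; exists 0; rewrite op0.
    by move=> /gP_onto [v hv vE]; exists v.
  exists d; split; first by move=> i; rewrite -kE; apply: (hsubD (s := F)); exact: (hd i).1.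
  split.
    rewrite -kE; apply: hsub_shift; apply: (subspaceB (g_sub F k')) => //.
    apply: (subspace_sum (g_sub F k')) => i _; exact: (hsub_T (s := F) (hd i).1).
  rewrite opB op_sum cE; apply/eqP; rewrite subr_eq0; apply/eqP.
  by apply: eq_bigr => i _; rewrite gP_T (hd i).2.
set g := f j - _ in Pd; have [hg Pg] := Pd.
(* The terms z_j z_i d_i taken from z_j f_j return to the summands of the z_i, so that x is
   unchanged. *)
pose x' := \sum_(i < n | (i < l)%N) fshift i (f i + fshift j (d i)).
have xE' : x = fshift j g + x'.
  rewrite xE split_sum /x' /g opB op_sum -[in RHS]addrA; congr (_ + _).
  rewrite [X in _ = _ + X](eq_bigr (fun i => fshift i (f i) + fshift j (fshift i (d i)))).
    by rewrite big_split /= addrCA addNr addr0.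
  by move=> i _; rewrite opD fshiftC.
have Px' : gP x' = 0.
  by have := Px; rewrite xE' opD gP_T Pg op0 add0r.
have [|u [hu uE]] := IH k x' (ltnW ln) reg' _ Px'.
  exists (fun i => f i + fshift j (d i)); split=> // i.
  by apply: (subspaceD (hsub_subspace F k i)).
exists (fun i => if i == j then g else u i); split.
  by move=> i; case: eqP => [->|_].
rewrite split_sum eqxx xE'; congr (_ + _); rewrite uE; apply: eq_bigr => i il.
by case: eqP => // ij; move: il; rewrite ij ltnn.
Qed.

(** Regularity of the Fock space puts x into the ideal of the preceding variables, and [ker_gideal]
    moves the coefficients into Ker P. This uses regularity on H only for the variables before z_j,
    whence the gain of one. *)
Lemma gnext_greg l : (l < n)%N -> greg s l -> greg gnext l.+1.
Proof.
move=> ln reg j jl k x hx [u [hu uE]].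
have reg' : greg s j by move=> i ij; apply: reg; exact: leq_trans ij jl.
have : gideal F j k (incl gK x).
  apply: (gF_greg (ltn_ord j)) => //; exists (fun i => incl gK (u i)); split.
    move=> i; have := hu i; rewrite /hsub; case: ifP => // _ ->; exact: op0.
  rewrite [LHS](_ : _ = incl gK (gT gnext j x)); last by rewrite [RHS]gKTE.
  by rewrite uE op_sum; apply: eq_bigr => i _; rewrite [LHS]gKTE.
move=> /(ker_gideal (ltnW (ltn_ord j)) reg') [|v [hv vE]]; first exact: (incl_mem (V := gK) x).
have /choice [y hy] : forall i, exists y, incl gK y = v i.
  by move=> i; apply: incl_onto; exact: (hv i).2.
exists y; split.
  move=> i; have := (hv i).1; rewrite /hsub; case: ifP => _.
    by rewrite -hy.
  by move=> v0; apply: (incl_inj (V := gK)); rewrite op0 hy.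
apply: (incl_inj (V := gK)); rewrite vE op_sum; apply: eq_bigr => i _.
by rewrite [RHS]gKTE hy.
Qed.

Lemma gnext_trivial : greg s n -> forall x : gH gnext, x = 0.
Proof.
move=> reg; suff h k (x : X) : gXk s k x -> gP x = 0 -> x = 0.
  move=> x; apply: (g_total (g := gnext)) => k y hy.
  have -> : y = 0; last exact: ip0r.
  by apply: (incl_inj (V := gK)); rewrite op0; apply: h hy _; exact: (incl_mem (V := gK) y).
elim/ltn_ind: k x => k IH x hx Px.
have [w [y [hw wk hy xE]]] := g_decomp (s := F) hx.
have wE : w = fcst n (fcoef w [::]).
  by apply: fcst_ker_bshift => i; rewrite -adj_fshift; exact: hw.
(* P w is a wandering vector, orthogonal to P y in the sum of the T_i H, while P w + P y = 0. *)
have w0 : w = 0.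
  rewrite wE; set d := fcoef _ _.
  have Pd : gincl d + gP y = 0 by rewrite -gP_fcst -wE -opD -xE.
  suff : gincl d = 0 by rewrite -(op0 gincl) => /(incl_inj (V := gWs s)) ->; exact: op0.
  apply: ip_eq0; have := congr1 (fun v => inner v (gincl d)) Pd.
  rewrite ipDl ip0l [X in _ + X](_ : _ = 0) ?addr0 //.
  have [u [hu ->]] := hy; rewrite op_sum ip_suml big1 // => i _.
  by rewrite gP_T adjP (gincl_W d i) ip0r.
move: hy; rewrite w0 add0r in xE; rewrite -xE => hy.
(* The coefficients now lie in Ker P and have lower degree, so they vanish by induction. *)
have [u [hu ->]] := ker_gideal (leqnn n) reg hy Px.
rewrite big1 // => i _; suff -> : u i = 0 by exact: op0.
have [] := hu i; rewrite /hsub; case: leqP => // le hui Pu.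
apply: IH hui Pu; by rewrite ltn_subrL gam_gt0 (leq_trans (gam_gt0 i)).
Qed.
End Step.

(** * The given tuple as a graded system *)

Section Initial_system.
Variables (R : realType) (n : nat) (H : hilbertType R) (Hk : nat -> set H).
Variables (gam : 'I_n -> nat) (T : 'I_n -> 'B(H, H)).
Hypothesis hHk : orthogonal_decomposition Hk.
Hypothesis hgam : forall i : 'I_n, (0 < gam i)%N.
Hypothesis hTcomm : commuting_tuple T.
Hypothesis hTgraded : fg_graded Hk gam T.
Hypothesis hTrow : row_contraction T.

Lemma Hk_closed k : closed_subspace (Hk k). Proof. by have [] := hHk. Qed.
Lemma Hk_sub k : subspace (Hk k).
Proof. exact/closed_subspace_subspace/Hk_closed. Qed.
Lemma Hk_orth k l x y : k <> l -> Hk k x -> Hk l y -> inner x y = 0.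
Proof. by have [_ h _] := hHk; exact: h. Qed.

Lemma Hk_total x : (forall k y, Hk k y -> inner x y = 0) -> x = 0.
Proof.
move=> h; have [_ _ /(_ x) [u [hu /cvgn_hnorm lim]]] := hHk.
apply: hnorm_eq0; apply/eqP; rewrite eq_le hnorm_ge0 andbT.
apply/ler_addgt0Pr => e e0; rewrite add0r; have [N /(_ N (leqnn N)) hN] := lim e e0.
have o : inner x (series u N) = 0.
  by rewrite /series /= ip_sumr big1 // => i _; exact: h (hu i).
have : hnorm x ^+ 2 <= hnorm x * hnorm (x - series u N).
  rewrite hnorm_ip; apply: le_trans (Re_le_cabs _) _.
  by have := cauchy_schwarz x (x - series u N); rewrite ipBr o subr0.
have [->|x0] := eqVneq (hnorm x) 0; first by move=> _; exact: ltW.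
rewrite expr2 ler_pM2l ?lt_def ?x0 ?hnorm_ge0 // => le.
exact: le_trans le (ltW hN).
Qed.

Lemma row_contraction_adj x : \sum_i hnorm (adj (T i) x) ^+ 2 <= hnorm x ^+ 2.
Proof.
have [T' [hT' /(_ x)]] := hTrow.
rewrite ip_suml ip_hnorm (eq_bigr (fun i => (hnorm (adj (T i) x) ^+ 2)%:C%C)).
  by rewrite -rmorph_sum lecR.
by move=> i _; rewrite (is_adjoint_adj (hT' i)) adjP -ip_hnorm.
Qed.

(** Unlike in [algebraic_sum], the k-th summand may lie in any component, which makes invariance
    under the T_i immediate. *)
Definition homog_sum : set H := [set x | exists (m : nat) (u : nat -> H),
  (forall k, exists l, Hk l (u k)) /\ x = \sum_(k < m) u k].

Lemma homog_sum_T i x : homog_sum x -> homog_sum (T i x).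
Proof.
move=> [m [u [hu ->]]]; exists m, (fun k => T i (u k)); split; last exact: op_sum.
by move=> k; have [l hl] := hu k; exists (l + gam i)%N; exact: hTgraded.1.
Qed.

Lemma monomial_act_cases m x : homog_sum x ->
  monomial_act T m x = x \/
  exists i y, homog_sum y /\ monomial_act T m x = T i y.
Proof.
move=> hx; rewrite /monomial_act.
suff h : forall s : seq 'I_n, let z := foldr
    (fun i y => iter (mpoly.fun_of_multinom m i) (T i) y) x s in
    homog_sum z /\ (z = x \/ exists i y, homog_sum y /\ z = T i y).
  by have [] := h (enum 'I_n).
elim=> [|i s [hz dz]] /=; first by split; [|left].
set z := foldr _ _ _ in hz dz *.
elim: (mpoly.fun_of_multinom m i) => [|k [hk _]]; first by split.
by rewrite iterS; split; [exact: homog_sum_T|right; exists i, (iter k (T i) z)].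
Qed.

(** The degree k part of sum_j p_j(T) g_j is a combination of the degree k parts of the generators
    plus elements of the T_i H_l with l + gamma_i = k, finite-dimensional by induction. *)
Lemma Hk_findim k : findim (Hk k).
Proof.
elim/ltn_ind: k => k IH.
have [m [g [hg gen]]] := hTgraded.2.
have /choice [pg hpg] : forall j, exists p, Hk k p /\ forall v, Hk k v -> inner (g j - p) v = 0.
  by move=> j; have [p] := projection_theorem (Hk_closed k) (g j); exists p.
pose hs i : set H := fun u => if (gam i <= k)%N then Hk (k - gam i) u else u = 0.
have hsP i : subspace (hs i).
  rewrite /hs; case: (gam i <= k)%N; first exact: Hk_sub.
  by split=> // a x y -> ->; rewrite scaler0 addr0.
have hsT i u : hs i u -> Hk k (T i u).
  rewrite /hs; case: leqP => [le hu|_ ->]; last by rewrite op0; exact: subspace0 (Hk_sub k).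
  by rewrite -(subnK le); exact: hTgraded.1.
have fT i : findim (T i @` hs i).
  apply: findim_img; rewrite /hs; case: leqP => le; last by exists [::] => x ->.
  by apply: IH; rewrite ltn_subrL hgam (leq_trans (hgam i)).
have fg : findim [set x | exists c : 'I_m -> R[i], x = \sum_j c j *: pg j].
  exists (map pg (enum 'I_m)) => _ [c ->].
  apply: (subspace_sum (lspan_subspace _)) => j _.
  apply: (subspaceZ (lspan_subspace _)); apply: lspan_mem.
  by apply: map_f; rewrite mem_enum.
have := findim_add (findim_sum (index_enum 'I_n) fT) fg.
set V := [set z | _] => fV; apply: (findim_sub _ fV) => x hx.
have sV : subspace V.
  split.
    exists 0, 0; split; last by rewrite addr0.
      exists (fun _ => 0); split; last by rewrite big1.
      by move=> i; exists 0; [exact: subspace0 (hsP i)|rewrite op0].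
    by exists (fun _ => 0); rewrite big1 // => j _; rewrite scale0r.
  move=> a _ _ [_ [_ [[u [hu ->]] [c ->] ->]]] [_ [_ [[v [hv ->]] [d ->] ->]]].
  exists (\sum_i (a *: u i + v i)), (\sum_j (a * c j + d j) *: pg j); split.
  - exists (fun i => a *: u i + v i); split=> // i.
    have [y hy <-] := hu i; have [z hz <-] := hv i.
    by exists (a *: y + z); [exact: (hsP i).2|rewrite opP].
  - by exists (fun j => a * c j + d j).
  - rewrite big_split /= -scaler_sumr scalerDr addrACA; congr (_ + _).
    rewrite scaler_sumr -big_split; apply: eq_bigr => j _.
    by rewrite scalerDl scalerA.
have VT i y : hs i y -> V (T i y).
  move=> hy; exists (T i y), 0; split; last by rewrite addr0.
    exists (fun j => if j == i then T i y else 0); split; last first.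
      by rewrite (bigD1 i) //= eqxx big1 ?addr0 // => j /negPf ->.
    move=> j; case: eqP => [->|_]; first by exists y.
    by exists 0; [exact: subspace0 (hsP j)|rewrite op0].
  by exists (fun _ => 0); rewrite big1 // => j _; rewrite scale0r.
have Vpg j : V (pg j).
  exists 0, (pg j); split; last by rewrite add0r.
    exists (fun _ => 0); split; last by rewrite big1.
    by move=> i; exists 0; [exact: subspace0 (hsP i)|rewrite op0].
  exists (fun i => (i == j)%:R); rewrite (bigD1 j) //= eqxx scale1r big1 ?addr0 //.
  by move=> i /negPf ->; rewrite scale0r.
have VH y : V y -> Hk k y.
  move=> [_ [_ [[u [hu ->]] [c ->] ->]]]; apply: (subspaceD (Hk_sub k)).
    apply: (subspace_sum (Hk_sub k)) => i _; have [x' hx' <-] := hu i; exact: hsT.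
  apply: (subspace_sum (Hk_sub k)) => j _; apply: (subspaceZ (Hk_sub k)).
  exact: (hpg j).1.
(* The vectors whose component of degree k lies in V. *)
pose good := [set y | exists2 z, V z & forall v, Hk k v -> inner (y - z) v = 0].
have sgood : subspace good.
  split; first by exists 0; [exact: subspace0|move=> v _; rewrite subr0 ip0l].
  move=> a y y' [z Vz hz] [z' Vz' hz']; exists (a *: z + z'); first exact: sV.2.
  move=> v hv; rewrite opprD addrACA -scalerBr ipDl ipZl hz // hz' //.
  by rewrite mulr0 addr0.
have goodT i y : homog_sum y -> good (T i y).
  move=> [M [u [hu ->]]]; rewrite op_sum; apply: (subspace_sum sgood) => j _.
  have [l hl] := hu j; have [le|/eqP ne] := eqVneq (l + gam i)%N k.
    exists (T i (u j)); last by move=> v _; rewrite subrr ip0l.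
    by apply: VT; rewrite /hs -le leq_addl addnK.
  exists 0; first exact: subspace0.
  by move=> v hv; rewrite subr0; apply: Hk_orth ne (hTgraded.1 _ i _ hl) hv.
have goodg j : good (g j) by exists (pg j) => // v hv; exact: (hpg j).2.
have gh j : homog_sum (g j).
  by have [M [u [hu ->]]] := hg j; exists M, u; split=> // l; exists l.
have : good x.
  have [|p ->] := gen x.
    exists k.+1, (fun l => if l == k then x else 0); split.
      by move=> l; case: eqP => [->//|_]; exact: subspace0 (Hk_sub l).
    by rewrite (bigD1 ord_max) //= eqxx big1 ?addr0 // => i; rewrite -val_eqE /= => /negPf ->.
  apply: (subspace_sum sgood) => j _; apply: (subspace_sum sgood) => mo _.
  apply: (subspaceZ sgood).
  by have [->|[i [y [hy ->]]]] := monomial_act_cases mo (gh j); [exact: goodg|exact: goodT].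
move=> [z Vz hz]; have -> : x = z; last by [].
apply/eqP; rewrite -subr_eq0; apply/eqP/ip_eq0/hz.
by apply: (subspaceB (Hk_sub k)) => //; exact: VH.
Qed.

Definition gsys0 : gsys R gam :=
  @GSys R n gam H Hk T hTcomm Hk_sub Hk_findim Hk_orth Hk_total
    (fun k i x => @hTgraded.1 k i x) row_contraction_adj.
End Initial_system.

(** * Assembling the resolution *)

Section Resolution.
Variables (R : realType) (n : nat) (gam : 'I_n -> nat).
Hypothesis gam_gt0 : forall i, (0 < gam i)%N.

Lemma gP_dense (s : gsys R gam) : closure (range (gP s)) = setT.
Proof.
apply: total_dense => [|x hx]; last first.
  by apply: (gP_total gam_gt0) => a; apply: hx; exists a.
split; first by exists 0; rewrite ?op0.
by move=> a _ _ [x _ <-] [y _ <-]; exists (a *: x + y); rewrite ?opP.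
Qed.

Lemma gP_unitary (s : gsys R gam) :
  restricts_to_unitary (gP s : 'B(fockDA n (gD s), gH s))
    (wandering (da_Mz (fockDA n (gD s))) setT) (wandering (gT s) setT).
Proof.
rewrite gW_wandering; split.
  apply/seteqP; split=> [_ [x /dcst_wandering [d ->] <-]|x hx].
    by rewrite dcst_fockDA [gP s _]gP_fcst; exact: gincl_W.
  have [d <-] := incl_onto (V := gWs s) hx.
  exists (dcst (fockDA n (gD s)) d); first by apply/dcst_wandering; exists d.
  by rewrite dcst_fockDA [LHS]gP_fcst.
move=> _ _ /dcst_wandering [d ->] /dcst_wandering [e ->].
by rewrite dcst_ip !dcst_fockDA ![gP s _]gP_fcst incl_ip.
Qed.

(** A weak resolution speaks of Ker P as a subset of the Fock space, the construction of an abstract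
    Hilbert space with its own tuple; this translates between the two. *)
Lemma wandering_gnext (s : gsys R gam) :
  wandering (da_Mz (fockDA n (gD s))) (ker_op (gP s)) =
  incl (gK s) @` wandering (gT (gnext gam_gt0 s)) setT.
Proof.
apply/seteqP; split=> [x [Kx hx]|_ [y [_ hy] <-]].
  have [y yE] := incl_onto (V := gK s) Kx; exists y => //; split=> // _ [u [_ ->]].
  rewrite -(incl_ip (V := gK s)) yE op_sum; apply: hx.
  exists (fun i => incl (gK s) (u i)); split=> [i|]; first exact: (incl_mem (V := gK s) (u i)).
  by apply: eq_bigr => i _; exact: gKTE.
split; first exact: (incl_mem (V := gK s) y).
move=> _ [u [hu ->]]; have /choice [v hv] : forall i, exists v, incl (gK s) v = u i.
  by move=> i; apply: incl_onto; exact: hu.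
have -> : \sum_i da_Mz (fockDA n (gD s)) i (u i) =
    incl (gK s) (\sum_i gT (gnext gam_gt0 s) i (v i)).
  by rewrite op_sum; apply: eq_bigr => i _; rewrite -hv [RHS]gKTE.
by rewrite incl_ip; apply: hy; exists v.
Qed.

Variable s0 : gsys R gam.
Definition stage i : gsys R gam := iter i (fun s => gnext gam_gt0 s) s0.
Definition resX i : druryArveson n (gD (stage i)) := fockDA n (gD (stage i)).
Definition resP0 : 'B(resX 0%N, gH s0) := gP s0.
Definition resP i : 'B(resX i.+1, resX i) :=
  comp_op (incl (gK (stage i))) (gP (stage i.+1)).

Lemma res_ker i : map_ker (Hs := fun i => resX i) resP0 resP i = ker_op (gP (stage i)).
Proof.
case: i => [//|i]; apply/seteqP; split=> x; rewrite /= /ker_op /= => h.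
  by apply: (incl_inj (V := gK (stage i))); rewrite op0.
by rewrite -[LHS]/(incl (gK (stage i)) (gP (stage i.+1) x)) h op0.
Qed.

Lemma res_weak_resolution :
  weak_resolution (gT s0) (fun i => da_Mz (resX i)) resP0 resP.
Proof.
split.
- by move=> i j k x; exact: fshiftC.
- by move=> j x; exact: gP_T.
- move=> i j x; rewrite -[LHS]/(incl (gK (stage i)) (gP (stage i.+1) (fshift j x))).
  by rewrite gP_T [LHS]gKTE.
- by move=> i x; rewrite res_ker; exact: (incl_mem (V := gK (stage i)) (gP (stage i.+1) x)).
- exact: gP_dense.
- move=> i; rewrite res_ker.
  have [_ _ /closedE_hnorm cl] := ker_closed_subspace (gP (stage i)).
  apply/seteqP; split=> x.
    move=> /closureE_hnorm h; apply: cl => e /h [_ [y _ <-] xy].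
    by exists (resP i y) => //; exact: (incl_mem (V := gK (stage i)) (gP (stage i.+1) y)).
  move=> /(incl_onto (V := gK (stage i))) [y <-]; apply/closureE_hnorm => e e0.
  have : closure (range (gP (stage i.+1))) y by rewrite gP_dense.
  move=> /closureE_hnorm /(_ e e0) [_ [a _ <-] ya]; exists (resP i a); first by exists a.
  rewrite -[resP i a]/(incl (gK (stage i)) (gP (stage i.+1) a)) -opB.
  by rewrite incl_hnorm.
- exact: gP_unitary.
- move=> i; rewrite res_ker wandering_gnext; have [PW iP] := gP_unitary (stage i.+1).
  split.
    rewrite -[gnext _ _]/(stage i.+1) -PW; apply/seteqP; split=> [_ [x hx <-]|_ [_ [x hx <-] <-]].
      by exists (gP (stage i.+1) x) => //; exists x.
    by exists x.
  by move=> x y hx hy; rewrite -iP //; exact: incl_ip.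
Qed.

Lemma stage_greg l : (l <= n)%N -> greg (stage l) l.
Proof.
elim: l => [_ j //|l IH ln]; apply: gnext_greg => //; exact/IH/ltnW.
Qed.

Lemma fock_trivial (s : gsys R gam) : (forall x : gH s, x = 0) ->
  forall f : fock n (gD s), f = 0.
Proof.
move=> h f; apply: fcoefI => w; apply: (incl_inj (V := gWs s)).
by rewrite [LHS]h [RHS]h.
Qed.

Lemma res_trivial i : (n < i)%N -> forall f : resX i, f = 0.
Proof.
(* All n variables are regular on stage n, so stage n + 1 vanishes, and each later stage is a kernel
   in a Fock space over a zero space. *)
suff h k : forall x : gH (stage (k + n).+1), x = 0.
  by move=> /subnK <-; rewrite addnS; apply: fock_trivial; exact: h.
elim: k => [|k IH] x; first exact: (gnext_trivial (stage_greg (leqnn n))).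
by apply: (incl_inj (V := gK (stage (k + n).+1))); rewrite op0; exact: fock_trivial.
Qed.
End Resolution.

Theorem theorem3p2 (R : realType) (n : nat) (H : hilbertType R)
    (Hk : nat -> set H) (gam : 'I_n -> nat) (T : 'I_n -> 'B(H, H))
    (hHk : orthogonal_decomposition Hk)
    (hgam : forall i : 'I_n, (0 < gam i)%N)
    (hTcomm : commuting_tuple T)
    (hTgraded : fg_graded Hk gam T)
    (hTrow : row_contraction T) :
  (exists (D : nat -> hilbertType R) (X : forall i : nat, druryArveson n (D i))
      (P0 : 'B(X 0%N, H)) (P : forall i : nat, 'B(X i.+1, X i)),
    weak_resolution T (fun i : nat => da_Mz (X i)) P0 P /\
    (forall i : nat, (n < i)%N -> forall f : X i, f = 0)) /\
  (forall (D : nat -> hilbertType R)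
      (X : forall i : nat, druryArveson n (D i))
      (P0 : 'B(X 0%N, H)) (P : forall i : nat, 'B(X i.+1, X i))
      (E : nat -> hilbertType R)
      (Y : forall i : nat, druryArveson n (E i))
      (G0 : 'B(Y 0%N, H)) (G : forall i : nat, 'B(Y i.+1, Y i)),
    weak_resolution T (fun i : nat => da_Mz (X i)) P0 P ->
    weak_resolution T (fun i : nat => da_Mz (Y i)) G0 G ->
    isomorphic_resolutions (fun i : nat => da_Mz (X i)) P0 P
      (fun i : nat => da_Mz (Y i)) G0 G).
Proof.
pose s0 := gsys0 hHk hgam hTcomm hTgraded hTrow.
split; last by move=> D X P0 P E Y G0 G hP hG; exact: (weak_resolution_unique hP hG).
exists (fun i => gD (stage hgam s0 i)), (resX hgam s0), (resP0 hgam s0), (resP hgam s0).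
split; [exact: (res_weak_resolution hgam s0)|exact: (@res_trivial _ _ _ hgam s0)].
Qed.
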